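(* Let $W$ be a Weyl group acting on $\mathbb{R}^n$ with $m$ positive roots, let $C^\circ$ be its open Weyl chamber, and let $h(x)=\prod_{\alpha>0}(\alpha,x)$ be the product of the positive roots. Let $r_0>0$, and let $Y$ be Brownian motion conditioned never to leave $C^\circ$ (the $h$-transformed Brownian motion in $C^\circ$), started at a random point $Y(0)$ of $\{x\in C^\circ:|x|=r_0\}$ whose distribution has density proportional to $h(x)^2$ with respect to surface measure on the sphere of radius $r_0$. Then the process $|Y(t)|$, $t\ge0$, is a Bessel process with parameter $n+2m$ (started at $r_0$).
   Context: $W$ is the Weyl group of a root system in $\mathbb{R}^n$ (whose roots need not span $\mathbb{R}^n$), with inner product $(\cdot,\cdot)$; $C^\circ=\{x:(\alpha,x)>0\text{ for all positive roots }\alpha\}$. One (reduced) root is counted for each hyperplane of reflection, so $m$ is the number of reflecting hyperplanes. The function $h$ is harmonic on $\mathbb{R}^n$, positive on $C^\circ$ and zero on its boundary. Brownian motion conditioned never to leave $C^\circ$ is the Doob $h$-transform: the Markov process on $C^\circ$ with transition density $\frac{h(y)}{h(x)}b_t(x,y)$, where $b_t(x,\cdot)$ is the density at time $t$ of standard $n$-dimensional Brownian motion started at $x$ and killed on first leaving $C^\circ$. The Bessel process with parameter $d$ (a positive integer) is the radial part $|B(t)|$ of $d$-dimensional standard Brownian motion $B$. *)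

(* Defs.v *)
From HB Require Import structures.
From mathcomp Require Import all_boot all_order all_algebra finmap.
From mathcomp Require Import all_classical all_reals all_analysis.
From mathcomp Require Import measurable_realfun.

Set Implicit Arguments.
Unset Strict Implicit.
Unset Printing Implicit Defensive.

Import Order.TTheory GRing.Theory Num.Theory.
Import numFieldNormedType.Exports.

Local Open Scope classical_set_scope.
Local Open Scope ring_scope.

Definition rV_display : measure_display -> measure_display.
Proof. exact. Qed.

(* R^n is 'rV[R]_n, with the product sigma-algebra generated by the coordinate
   functions (for a realType R these are the Borel sets). *)
Section measurable_rV.
Context {d} {T : measurableType d} (n : nat).

Let coords : 'I_n -> 'rV[T]_n -> T := fun i x => x ord0 i.

Let rV_set0 : g_sigma_preimage coords set0.
Proof. exact: sigma_algebra0. Qed.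

Let rV_setC A : g_sigma_preimage coords A -> g_sigma_preimage coords (~` A).
Proof. exact: sigma_algebraC. Qed.

Let rV_bigcup (F : _^nat) : (forall i, g_sigma_preimage coords (F i)) ->
  g_sigma_preimage coords (\bigcup_i (F i)).
Proof. exact: sigma_algebra_bigcup. Qed.

HB.instance Definition _ := @isMeasurable.Build (rV_display d)
  'rV[T]_n (g_sigma_preimage coords) rV_set0 rV_setC rV_bigcup.

Lemma measurable_coord (i : 'I_n) :
  measurable_fun [set: 'rV[T]_n] (fun x => x ord0 i).
Proof.
move=> _ Y mY; rewrite setTI; apply: sub_sigma_algebra => /=.
rewrite -bigcup_seq/=; exists i => /=; first by rewrite mem_index_enum.
by exists Y => //; rewrite setTI.
Qed.

Lemma measurable_fun_rVP d' (T' : measurableType d') (f : T' -> 'rV[T]_n) :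
  measurable_fun setT f <-> forall i, measurable_fun setT (fun x => f x ord0 i).
Proof.
split=> [mf i|mf]; first exact: (measurableT_comp (measurable_coord i) mf).
suff fS : g_sigma_preimage (fun i x => f x ord0 i) `<=` measurable.
  move=> _ A mA; rewrite setTI; apply: fS.
  rewrite (_ : (fun i x => f x ord0 i) = fun i => coords i \o f)//.
  by rewrite g_sigma_preimage_comp; exists A => //; rewrite setTI.
apply: smallest_sub; first exact: sigma_algebra_measurable.
rewrite -bigcup_seq/=; apply: bigcup_sub => i _ A [B mB <-].
exact: mf.
Qed.

End measurable_rV.

Section lebesgue_rV.
Context {R : realType}.
Local Open Scope ereal_scope.

(* Prepends a coordinate: R x R^n -> R^n.+1. *)
Definition consv n (p : R * 'rV[R]_n) : 'rV[R]_n.+1 :=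
  \row_i if unlift ord0 i is Some j then p.2 ord0 j else p.1.

Lemma measurable_consv n : measurable_fun setT (@consv n).
Proof.
apply/measurable_fun_rVP => i.
under eq_fun do rewrite mxE.
case: (unlift ord0 i) => [j|]; last first.
  exact: measurable_fst.
exact: (measurableT_comp (measurable_coord j) measurable_snd).
Qed.

Section cons_measure.
Context n (mu : {sigma_finite_measure set 'rV[R]_n -> \bar R}).

Definition cons_measure : set 'rV[R]_n.+1 -> \bar R :=
  pushforward (lebesgue_measure \x mu) (@consv n).

Let cons_measure0 : cons_measure set0 = 0.
Proof. by rewrite /cons_measure /pushforward preimage_set0 measure0. Qed.

Let cons_measure_ge0 A : 0 <= cons_measure A.
Proof. by rewrite /cons_measure /pushforward measure_ge0. Qed.

Let cons_measure_sigma_additive : semi_sigma_additive cons_measure.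
Proof.
move=> F mF tF mUF.
rewrite /cons_measure /pushforward preimage_bigcup.
have mc B : measurable B -> measurable (@consv n @^-1` B).
  by move=> mB; rewrite -[X in measurable X]setTI; exact: measurable_consv.
apply: measure_semi_sigma_additive.
- by move=> k; exact: mc.
- apply/trivIsetP => i j _ _ ij; rewrite -preimage_setI.
  by move/trivIsetP : tF => /(_ _ _ _ _ ij) ->//; rewrite preimage_set0.
- by rewrite -preimage_bigcup; exact: mc.
Qed.

HB.instance Definition _ := isMeasure.Build _ _ _ cons_measure
  cons_measure0 cons_measure_ge0 cons_measure_sigma_additive.

Lemma cons_measureX (A : set R) (B : set 'rV[R]_n) :
  measurable A -> measurable B ->
  cons_measure [set x | A (x ord0 ord0) /\
                        B (\row_j x ord0 (lift ord0 j))] =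
  lebesgue_measure A * mu B.
Proof.
move=> mA mB; rewrite /cons_measure /pushforward -product_measure1E//.
congr (_ _); apply/seteqP; split=> -[a v] /=; rewrite !mxE unlift_none;
  (have -> : \row_j consv (a, v) ord0 (lift ord0 j) = v
     by apply/rowP => j; rewrite !mxE liftK); by [].
Qed.

Let cons_measure_sigma_finite : sigma_finite setT cons_measure.
Proof.
have /sigma_finiteP[F [TF ndF Foo]] := sigma_finiteT (@lebesgue_measure R).
have /sigma_finiteP[G [TG ndG Goo]] := sigma_finiteT mu.
exists (fun k => [set x : 'rV[R]_n.+1 | F k (x ord0 ord0) /\
                          G k (\row_j x ord0 (lift ord0 j))]).
  apply/esym; rewrite -subTset => x _.
  have [i _ Fi] : (\bigcup_i F i) (x ord0 ord0) by rewrite -TF.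
  have [j _ Gj] : (\bigcup_i G i) (\row_j x ord0 (lift ord0 j)) by rewrite -TG.
  exists (maxn i j) => //; split.
  - by move: Fi; apply/subsetPset/ndF; rewrite leq_maxl.
  - by move: Gj; apply/subsetPset/ndG; rewrite leq_maxr.
move=> k; have [mF Fk] := Foo k; have [mG Gk] := Goo k; split.
  have m1 : measurable_fun setT (fun x : 'rV[R]_n.+1 => x ord0 ord0).
    exact: measurable_coord.
  have m2 : measurable_fun setT
      (fun x : 'rV[R]_n.+1 => \row_j x ord0 (lift ord0 j)).
    apply/measurable_fun_rVP => j; under eq_fun do rewrite mxE.
    exact: measurable_coord.
  have := measurableI _ _ (m1 measurableT _ mF) (m2 measurableT _ mG).
  by rewrite !setTI.
by rewrite cons_measureX// lte_mul_pinfty// ge0_fin_numE.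
Qed.

HB.instance Definition _ := Measure_isSigmaFinite.Build _ _ _ cons_measure
  cons_measure_sigma_finite.

End cons_measure.

(* Lebesgue measure on R^n, as an iterated product measure; its value on boxes
   is lebesgue_rV_box below. *)
Fixpoint lebesgue_rV n : {sigma_finite_measure set 'rV[R]_n -> \bar R} :=
  if n is n'.+1 then cons_measure (lebesgue_rV n') else dirac (0%R : 'rV[R]_0).

Lemma lebesgue_rV_box n (A : 'I_n -> set R) :
  (forall i, measurable (A i)) ->
  lebesgue_rV n [set x | forall i, A i (x ord0 i)] =
  \prod_(i < n) lebesgue_measure (A i).
Proof.
elim: n A => [|n IH] A mA /=.
  by rewrite big_ord0 diracE mem_set// => -[].
rewrite big_ord_recl -IH//.
have mB : measurable
    [set x : 'rV[R]_n | forall i : 'I_n, A (lift ord0 i) (x ord0 i)].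
  have -> : [set x : 'rV[R]_n | forall i, A (lift ord0 i) (x ord0 i)] =
      \bigcap_(i in [set: 'I_n]) ((fun x => x ord0 i) @^-1` A (lift ord0 i)).
    by apply/seteqP; split=> x /= H i; [move=> _; exact: H|exact: H].
  apply: fin_bigcap_measurable => // i _.
  by rewrite -[X in measurable X]setTI; exact: measurable_coord.
rewrite -cons_measureX//; congr (_ _); apply/seteqP; split=> x /=.
  by move=> H; split=> // i; rewrite mxE; exact: H.
move=> [H0 H] i; case: (unliftP ord0 i) => [j ->|->//].
by have := H j; rewrite mxE.
Qed.

End lebesgue_rV.

Section euclidean.
Context {R : realType} {n : nat}.
Implicit Types x y : 'rV[R]_n.

Definition dotv x y : R := \sum_(i < n) x ord0 i * y ord0 i.

(* The library norm `|x| on 'rV[R]_n is the sup norm, hence this definition. *)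
Definition enorm x : R := Num.sqrt (dotv x x).

Lemma measurable_dotvv : measurable_fun setT (fun x => dotv x x).
Proof.
by apply: measurable_sum => i; apply: measurable_funM; exact: measurable_coord.
Qed.

Lemma dotvv_ge0 x : 0 <= dotv x x.
Proof. by apply: sumr_ge0 => i _; rewrite -expr2 sqr_ge0. Qed.

Lemma enormE x : enorm x = dotv x x `^ 2^-1.
Proof. by rewrite /enorm -powR12_sqrt// dotvv_ge0. Qed.

Lemma measurable_enorm : measurable_fun setT enorm.
Proof.
rewrite (_ : enorm = (@powR R)^~ 2^-1 \o (fun x => dotv x x)).
  exact: (measurableT_comp (measurable_powR _) measurable_dotvv).
by apply/funext => x /=; exact: enormE.
Qed.

End euclidean.

Section sphere_measure.
Context {R : realType} (n : nat) (r : {posnum R}).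
Local Open Scope ereal_scope.

Definition radial_proj (x : 'rV[R]_n) : 'rV[R]_n :=
  (r%:num / enorm x)%R *: x.

Let pball : set 'rV[R]_n := [set x | (0 < enorm x <= r%:num)%R].

(* Surface measure on the sphere of radius r centred at 0: the area of a part A
   of the sphere is n / r times the volume of the cone
   { s a : 0 < s <= 1, a in A }. *)
Definition sphere_measure : set 'rV[R]_n -> \bar R := fun A =>
  (n%:R / r%:num)%:E *
  lebesgue_rV n ((radial_proj @^-1` A) `&` [set x | (0 < enorm x <= r%:num)%R]).

Lemma measurable_radial_proj : measurable_fun setT radial_proj.
Proof.
apply/measurable_fun_rVP => i; under eq_fun do rewrite mxE.
apply: measurable_funM; last exact: measurable_coord.
apply: measurable_funM => //.
rewrite (_ : (fun x => _) = (@powR R)^~ (- 2^-1)%R \o (fun x => dotv x x)).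
  exact: (measurableT_comp (measurable_powR _) measurable_dotvv).
by apply/funext => x /=; rewrite enormE powRN.
Qed.

Let mpball : measurable pball.
Proof.
rewrite (_ : pball = enorm @^-1` `]0%R, r%:num]).
  by rewrite -[X in measurable X]setTI; exact: measurable_enorm.
by apply/seteqP; split=> x; rewrite /pball/= in_itv.
Qed.

Let coef : {nonneg R} := (n%:R / r%:num)%:nng%R.

Let sphere_measureE A : sphere_measure A =
  mscale coef (mrestr (lebesgue_rV n) mpball) (radial_proj @^-1` A).
Proof. by []. Qed.

Let sphere_measure0 : sphere_measure set0 = 0.
Proof. by rewrite sphere_measureE preimage_set0 measure0. Qed.

Let sphere_measure_ge0 A : 0 <= sphere_measure A.
Proof. by rewrite sphere_measureE measure_ge0. Qed.

Let sphere_measure_sigma_additive : semi_sigma_additive sphere_measure.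
Proof.
move=> F mF tF mUF; rewrite sphere_measureE preimage_bigcup.
have mc B : measurable B -> measurable (radial_proj @^-1` B).
  by move=> mB; rewrite -[X in measurable X]setTI; exact: measurable_radial_proj.
apply: (@measure_semi_sigma_additive _ _ _
  (mscale coef (mrestr (lebesgue_rV n) mpball))).
- by move=> k; exact: mc.
- apply/trivIsetP => i j _ _ ij; rewrite -preimage_setI.
  by move/trivIsetP : tF => /(_ _ _ _ _ ij) ->//; rewrite preimage_set0.
- by rewrite -preimage_bigcup; exact: mc.
Qed.

HB.instance Definition _ := isMeasure.Build _ _ _ sphere_measure
  sphere_measure0 sphere_measure_ge0 sphere_measure_sigma_additive.

End sphere_measure.

Section root_systems.
Context {R : realType} {n : nat}.
Implicit Types (Phi : {fset 'rV[R]_n}) (a b v x : 'rV[R]_n).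

Definition reflection a b : 'rV[R]_n :=
  b - (2 * dotv a b / dotv a a) *: a.

(* The roots need not span R^n, and Phi need not be reduced. *)
Record root_system Phi : Prop := RootSystem {
  root_neq0 : forall a, a \in Phi -> a != 0;
  root_reflection : forall a b, a \in Phi -> b \in Phi ->
    reflection a b \in Phi;
  root_integral : forall a b, a \in Phi -> b \in Phi ->
    2 * dotv a b / dotv a a \is a Num.int }.

(* A choice of positive roots is given by a vector v orthogonal to no root:
   the positive roots are those on the positive side of the hyperplane v^perp. *)
Definition regular Phi v : Prop := forall a, a \in Phi -> dotv v a != 0.

Definition positive_roots Phi v : {fset 'rV[R]_n} :=
  [fset a in Phi | 0 < dotv v a]%fset.

(* One positive root for each reflecting hyperplane: by integrality, the
   positive multiples of a root that are roots are among its halves and doubles,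
   and the shortest one of them is kept. *)
Definition reduced_positive_roots Phi v : {fset 'rV[R]_n} :=
  [fset a in positive_roots Phi v | 2^-1 *: a \notin Phi]%fset.

Definition chamber Phi v : set 'rV[R]_n :=
  [set x | forall a, a \in positive_roots Phi v -> 0 < dotv a x].

Definition root_product Phi v x : R :=
  \prod_(a <- reduced_positive_roots Phi v) dotv a x.

End root_systems.

(* Processes are indexed by R; only their values at times t >= 0 matter. *)
Section processes.
Context {R : realType} {n : nat} d (T : measurableType d) (P : probability T R).
Implicit Types (X : R -> T -> 'rV[R]_n) (C : set 'rV[R]_n).
Local Open Scope ereal_scope.

(* Standard n-dimensional Brownian motion started at x0; the last clause says
   that the coordinates of the increments over successive time intervals are
   mutually independent centred normal variables with variance the length of
   the interval. *)
Definition brownian (x0 : 'rV[R]_n) X : Prop :=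
  [/\ forall t, (0 <= t)%R -> measurable_fun setT (X t),
      forall w, {within `[0%R, +oo[, continuous (fun t => X t w)},
      forall w, X 0%R w = x0 &
      forall (k : nat) (t : nat -> R) (A : 'I_k -> 'I_n -> set R),
        (0 <= t 0%N)%R -> (forall i, (i < k)%N -> (t i < t i.+1)%R) ->
        (forall i j, measurable (A i j)) ->
        P [set w | forall i j, A i j ((X (t i.+1) w - X (t i) w)%R ord0 j)] =
        \prod_(i < k) \prod_(j < n)
          normal_prob 0 (Num.sqrt (t i.+1 - t i)) (A i j)].

(* For X a Brownian motion started at 0, b t x is a density of the position at
   time t of the Brownian motion x + X killed on first leaving C. *)
Definition killed_density X C (b : R -> 'rV[R]_n -> 'rV[R]_n -> R) : Prop :=
  forall t x, (0 < t)%R -> C x ->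
  [/\ forall y, (0 <= b t x y)%R,
      measurable_fun setT (b t x) &
      forall A, measurable A ->
        \int[lebesgue_rV n]_(y in A) (b t x y)%:E =
        P [set w | A (x + X t w)%R /\
                   forall s, (0 <= s <= t)%R -> C (x + X s w)%R]].

Definition past X (s : R) : set (set T) :=
  <<s [set E | exists u (A : set 'rV[R]_n),
        [/\ (0 <= u <= s)%R, measurable A & E = X u @^-1` A] ]>>.

(* X is a Markov process on C with transition densities p t x y: for s < t, the
   conditional law of X t given the past up to time s is p (t - s) (X s) y dy. *)
Definition markov_process C (p : R -> 'rV[R]_n -> 'rV[R]_n -> R) X : Prop :=
  [/\ forall t, (0 <= t)%R -> measurable_fun setT (X t),
      forall t w, (0 <= t)%R -> C (X t w) &
      forall s t E A, (0 <= s < t)%R -> past X s E -> measurable A ->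
        P (E `&` X t @^-1` A) =
        \int[P]_(w in E)
          \int[lebesgue_rV n]_(y in C `&` A) (p (t - s)%R (X s w) y)%:E].

End processes.

Definition h_transform {R : realType} n (h : 'rV[R]_n -> R)
    (b : R -> 'rV[R]_n -> 'rV[R]_n -> R) (t : R) (x y : 'rV[R]_n) : R :=
  h y / h x * b t x y.

(* Equality in law of two real processes indexed by [0, +oo[, i.e. equality of
   their finite-dimensional distributions. *)
Definition same_law {R : realType}
    d (T : measurableType d) (P : probability T R) (Z : R -> T -> R)
    d' (T' : measurableType d') (P' : probability T' R) (Z' : R -> T' -> R)
    : Prop :=
  forall (k : nat) (t : 'I_k -> R) (A : 'I_k -> set R),
    (forall i, 0 <= t i) -> (forall i, measurable (A i)) ->
    P [set w | forall i, A i (Z (t i) w)] =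
    P' [set w | forall i, A i (Z' (t i) w)].

(* Z has the law of |B|, for B standard Brownian motion in R^k started at a
   point of norm r. *)
Definition bessel {R : realType} (k : nat) (r : R)
    d (T : measurableType d) (P : probability T R) (Z : R -> T -> R) : Prop :=
  (forall t, 0 <= t -> measurable_fun setT (Z t)) /\
  forall d' (T' : measurableType d') (P' : probability T' R)
         (x0 : 'rV[R]_k) (B : R -> T' -> 'rV[R]_k),
    enorm x0 = r -> brownian P' x0 B ->
    same_law P Z P' (fun t w => enorm (B t w)).

(* Main.v *)
From HB Require Import structures.
Require Import Defs.
From mathcomp Require Import all_boot all_order all_algebra finmap.
From mathcomp Require Import all_classical all_reals all_analysis.
From mathcomp Require Import measurable_realfun ring lra zify.

Set Implicit Arguments.
Unset Strict Implicit.
Unset Printing Implicit Defensive.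

Import Order.TTheory GRing.Theory Num.Theory.
Import numFieldNormedType.Exports.

Local Open Scope classical_set_scope.
Local Open Scope ring_scope.


(** The radial part of Y is compared with that of a Brownian motion B in
    dimension n + 2 m through the functions exp (- l |x|^2 / 2), l >= 0, called
    gweight below. Write a = 1 / (1 + l t).

    Completing the square in the Gaussian density (gauss_tilt), the heat flow at
    time t turns f * gweight l into a^(n/2) gweight (a l) x times the Gaussian
    mean of f around a x with variance a t. For f = 1 this is
    a^(n/2) gweight (a l) x. For f = h the mean is h (a x) = a^m h x, because h
    has the mean value property (gmean_root_product) and is homogeneous of
    degree m. Thus the heat flow of h * gweight l is
    a^((n + 2 m) / 2) h x gweight (a l) x: after division by h x, what is left
    is the formula for f = 1 in dimension n + 2 m.

    The mean value property does not go through the Laplacian. By Stein's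
    identity the Gaussian mean of a product of affine functions depends only on
    their values at the centre and on the inner products of their directions.
    Since h changes sign under the reflections, the mean of h around a point of
    a reflecting hyperplane is therefore 0. On a generic line, h and its mean
    are then polynomials with the same m roots and the same leading term, so
    they are equal.

    Killing at the boundary of the chamber does not affect these expectations
    (killed_heat_root): the heat flow of h * gweight l, evaluated along the
    Brownian path, is a bounded martingale which vanishes at the exit from the
    chamber, because h does; optional stopping is carried out on grids of times
    that become finer and finer.

    Consequently Y and B satisfy the same one-step relation gauss_step with the
    exponent n + 2 m (conditioned_gauss_step, brownian_gauss_step). It gives the
    Laplace transform of |Y t|^2 / 2, on an event of the past up to time s, as
    one of |Y s|^2 / 2. As Laplace transforms determine laws (laplace_unique),
    an induction on the number of times (eq_marginals) shows that the
    finite-dimensional distributions of the radial part are determined by the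
    law of the initial norm, which is r0 for both processes. *)

(** * Change of measure *)

Section density.
Local Open Scope ereal_scope.
Import HBNNSimple.

Lemma integral_mul_indic d (T : measurableType d) (R : realType)
    (mu : {measure set T -> \bar R}) (D : set T) (f : T -> \bar R) :
  \int[mu]_(x in D) f x = \int[mu]_x (f x * (\1_D x)%:E).
Proof.
rewrite integral_mkcond; apply: eq_integral => x _.
by rewrite patchE indicE; case: ifPn => _; rewrite ?mule1 ?mule0.
Qed.

(** By linearity and monotone convergence, from the case of indicators. One
    statement serves densities (J is the identity), restrictions (g is an
    indicator), image measures (g is 1) and their combinations. *)
Lemma ge0_integral_density d d' (S : measurableType d) (T : measurableType d')
    (R : realType) (nu : {measure set S -> \bar R})
    (mu : {measure set T -> \bar R}) (J : S -> T) (g : S -> R)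
    (F : T -> \bar R) :
  measurable_fun setT J -> measurable_fun setT g -> (forall x, (0 <= g x)%R) ->
  (forall A, measurable A -> mu A = \int[nu]_x ((g x)%:E * (\1_A (J x))%:E)) ->
  measurable_fun setT F -> (forall y, 0 <= F y) ->
  \int[mu]_y F y = \int[nu]_x ((g x)%:E * F (J x)).
Proof.
move=> mJ mg g0 muE mF F0.
have mgE : measurable_fun setT (fun x => (g x)%:E : \bar R) by exact/measurable_EFinP.
pose f_ := nnsfun_approx measurableT mF.
have cf y : (f_ n y)%:E @[n --> \oo] --> F y by exact: cvg_nnsfun_approx.
have simple n : \int[mu]_y (f_ n y)%:E = \int[nu]_x ((g x)%:E * (f_ n (J x))%:E).
  rewrite integralT_nnsfun sintegralE.
  have gE x : (g x)%:E * (f_ n (J x))%:E = \sum_(r \in range (f_ n))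
      (r%:E * ((g x)%:E * (\1_(f_ n @^-1` [set r]) (J x))%:E)).
    rewrite [in LHS]fimfunE -fsumEFin// ge0_mule_fsumr; last first.
      by move=> r; exact: nnfun_muleindic_ge0.
    by apply: eq_fsbigr => r _; rewrite EFinM muleCA.
  have mi r : measurable_fun setT (fun x => (\1_(f_ n @^-1` [set r]) (J x))%:E : \bar R).
    apply/measurable_EFinP; apply: (measurableT_comp _ mJ).
    exact: measurable_indic.
  under [RHS]eq_integral do rewrite gE.
  rewrite ge0_integral_fsum//; last 2 first.
  - by move=> r; apply: measurable_funeM; exact: emeasurable_funM.
  - move=> r x _; have [r0|r0] := leP 0%R r.
      by rewrite mule_ge0// mule_ge0// lee_fin.
    by rewrite preimage_nnfun0// indic0 !mule0.
  apply: eq_fsbigr => r _; have [r0|r0] := leP 0%R r.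
    rewrite ge0_integralZl// ?muE//.
    - by exact: emeasurable_funM.
    - by move=> x _; rewrite mule_ge0// lee_fin.
  rewrite preimage_nnfun0// measure0 mule0 integral0_eq// => x _.
  by rewrite indic0 !mule0.
transitivity (limn (fun n => \int[mu]_y (f_ n y)%:E)).
  rewrite -monotone_convergence//.
  - by apply: eq_integral => y _; apply/esym/cvg_lim => //; exact: cf.
  - by move=> n; exact/measurable_EFinP.
  - by move=> n y _; rewrite lee_fin.
  - by move=> y _ m n mn; rewrite lee_fin; exact/lefP/nd_nnsfun_approx.
under eq_fun do rewrite simple.
rewrite -monotone_convergence//.
- apply: eq_integral => x _; apply/cvg_lim => //; apply: cvgeZl => //.
- move=> n; apply: emeasurable_funM => //; apply/measurable_EFinP.
  exact: (measurableT_comp _ mJ).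
- by move=> n x _; rewrite mule_ge0// lee_fin.
- move=> x _ m n mn; apply: lee_wpmul2l; rewrite lee_fin//.
  exact/lefP/nd_nnsfun_approx.
Qed.

End density.

(** * Laplace transforms determine laws *)

Section laplace.
Context {R : realType}.

Lemma cvg_le_harmonic (u : nat -> R) (l K : R) :
  (forall n, `|u n - l| <= K / n.+1%:R) -> u n @[n --> \oo] --> l.
Proof.
move=> H; apply/cvgrPdist_le => e e0.
have K1 : 0 < `|K| + 1 by rewrite ltr_wpDl.
have e'0 : 0 < e / (`|K| + 1) by rewrite divr_gt0.
have := near_infty_natSinv_lt (PosNum e'0); apply: filterS => n /= hn.
rewrite distrC (le_trans (H n))//.
have : K / n.+1%:R <= (`|K| + 1) * n.+1%:R^-1.
  by apply: ler_wpM2r => //; rewrite (le_trans (ler_norm K))// lerDl.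
move=> /le_trans; apply; rewrite -ler_pdivlMl// mulrC; exact: ltW.
Qed.

Lemma bounded_cvg_integral d (T : measurableType d)
    (P : {finite_measure set T -> \bar R}) (E : set T) (f_ : nat -> T -> R)
    (f : T -> R) (M : R) :
  measurable E -> (forall n, measurable_fun E (f_ n)) ->
  (forall n x, E x -> `|f_ n x| <= M) ->
  (forall x, E x -> f_ n x @[n --> \oo] --> f x) ->
  (\int[P]_(x in E) (f_ n x)%:E @[n --> \oo] --> \int[P]_(x in E) (f x)%:E)%E.
Proof.
move=> mE mf fM fcvg.
apply: (@dominated_cvg _ _ _ _ _ mE _ _ (cst M%:E)) => //.
- by move=> n; exact/measurable_EFinP.
- by move=> x Ex; apply: cvg_EFin; [exact: nearW|exact: fcvg].
- exact: finite_measure_integrable_cst.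
Qed.

(** A polynomial in expR (- n.+1 x), hence known once Laplace transforms are,
    which tends to the indicator of c < x: it has about N = n.+1 e^(n.+1 c)
    factors, and N e^(- n.+1 x) tends to 0 for x > c and to infinity for
    x <= c. The factor n.+1 in N is what settles the case x = c. *)
Definition soft_step (c : R) (n : nat) (x : R) : R :=
  (1 - expR (- n.+1%:R * x)) ^+ (Num.truncn (n.+1%:R * expR (n.+1%:R * c))).+1.

Lemma soft_step_ge0_le1 c n x : 0 <= x -> 0 <= soft_step c n x <= 1.
Proof.
move=> x0; have z0 := expR_ge0 (- n.+1%:R * x).
have z1 : expR (- n.+1%:R * x) <= 1.
  by rewrite -expR0 ler_expR mulNr oppr_le0 mulr_ge0.
by apply/andP; split; [apply: exprn_ge0|apply: exprn_ile1]; lra.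
Qed.

Lemma bernoulli_le (z : R) N : 0 <= z <= 1 -> 1 - N%:R * z <= (1 - z) ^+ N.
Proof.
move=> /andP[z0 z1]; elim: N => [|N IH]; first by rewrite expr0 mul0r subr0.
rewrite exprS -natr1.
have N0 : 0 <= N%:R :> R by [].
have := ler_wpM2l (_ : 0 <= 1 - z) IH; rewrite subr_ge0 => /(_ z1).
nra.
Qed.

Lemma bernoulli_ge (z : R) N : 0 <= z <= 1 -> (1 - z) ^+ N <= (1 + N%:R * z)^-1.
Proof.
move=> /andP[z0 z1]; have N0 : 0 <= N%:R :> R by [].
have d0 : 0 < 1 + N%:R * z by nra.
rewrite -[leRHS]mul1r ler_pdivlMr//; elim: N N0 d0 => [|N IH] N0 d0.
  by rewrite expr0 mul0r addr0 mulr1.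
have N0' : 0 <= N%:R :> R by [].
have := IH N0'; have d0' : 0 < 1 + N%:R * z by nra.
move=> /(_ d0'); apply: le_trans.
rewrite exprS -natr1 mulrAC mulrC; apply: ler_wpM2l.
  by apply: exprn_ge0; lra.
nra.
Qed.

Lemma soft_step_cvg (c x : R) : 0 <= c -> 0 <= x ->
  soft_step c n x @[n --> \oo] --> ((c < x)%R%:R : R).
Proof.
move=> c0 x0.
have [cx|xc] := ltP c x.
  have xp : 0 < x by lra.
  pose dl := x - c; have dl0 : 0 < dl by rewrite subr_gt0.
  apply: (@cvg_le_harmonic _ _ (2 / dl ^+ 2 + x^-1)) => n.
  have /andP[s0 s1] := soft_step_ge0_le1 c n x0.
  rewrite /= distrC ger0_norm ?subr_ge0//.
  pose m : R := n.+1%:R; have m0 : 0 < m by rewrite ltr0n.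
  pose z := expR (- m * x).
  have z0 : 0 < z by exact: expR_gt0.
  have z1 : z <= 1 by rewrite -expR0 ler_expR mulNr oppr_le0 mulr_ge0// ltW.
  set N := (Num.truncn (m * expR (m * c))).+1.
  have N1 : N%:R <= m * expR (m * c) + 1.
    rewrite -natr1 lerD2r truncn_le// mulr_ge0 ?expR_ge0//; exact: ltW.
  have := @bernoulli_le z N; rewrite (ltW z0) z1 => /(_ isT) bl.
  have : 1 - soft_step c n x <= N%:R * z by rewrite /soft_step -/m -/z -/N; lra.
  move=> /le_trans; apply; apply: (@le_trans _ _ ((m * expR (m * c) + 1) * z)).
    by rewrite ler_pM2r.
  rewrite mulrDl mul1r [leRHS]mulrDl lerD//.
    rewrite -mulrA /z -expRD (_ : m * c + - m * x = - (m * dl)); last first.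
      by rewrite /dl; ring.
    rewrite expRN.
    have md0 : 0 <= m * dl by rewrite ltW// mulr_gt0.
    have := @expR_ge1Dxn _ _ 1 md0; rewrite (_ : 2`! = 2)%N // => e1.
    have h : (m * dl) ^+ 2 / 2 <= expR (m * dl) by move: e1; lra.
    rewrite -/m ler_pdivrMr ?expR_gt0//.
    apply: le_trans (_ : 2 / dl ^+ 2 / m * ((m * dl) ^+ 2 / 2) <= _); last first.
      by apply: ler_wpM2l => //; rewrite !mulr_ge0 ?invr_ge0 ?exprn_ge0// ltW.
    rewrite le_eqVlt; apply/orP; left; apply/eqP; field.
    by rewrite !gt_eqF.
  rewrite /z mulNr expRN -/m -invfM lef_pV2 ?posrE ?expR_gt0 ?mulr_gt0//.
  by have := expR_ge1Dx (m * x); lra.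
apply: (@cvg_le_harmonic _ _ 1) => n.
have /andP[s0 s1] := soft_step_ge0_le1 c n x0.
rewrite /= subr0 ger0_norm// mul1r.
pose m : R := n.+1%:R; have m0 : 0 < m by rewrite ltr0n.
pose z := expR (- m * x).
have z0 : 0 < z by exact: expR_gt0.
have z1 : z <= 1 by rewrite -expR0 ler_expR mulNr oppr_le0 mulr_ge0// ltW.
set N := (Num.truncn (m * expR (m * c))).+1.
have N1 : m * expR (m * c) <= N%:R by rewrite ltW// truncnS_gt.
have := @bernoulli_ge z N; rewrite (ltW z0) z1 => /(_ isT) /le_trans; apply.
rewrite -/m lef_pV2 ?posrE//; last first.
  by rewrite ltr_pwDl// mulr_ge0// ltW.
suff : m <= N%:R * z by lra.
apply: le_trans (_ : m * expR (m * c) * z <= _); last by rewrite ler_pM2r.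
rewrite -mulrA ler_peMr ?(ltW m0)// /z -expRD; apply: le_trans (expR_ge1Dx _); rewrite lerDl.
have : 0 <= m * (c - x) by rewrite mulr_ge0 ?subr_ge0// ltW.
lra.
Qed.


Lemma measurable_soft_step c n : measurable_fun setT (soft_step c n).
Proof.
apply: measurable_funX; apply: measurable_funB => //.
by apply: measurableT_comp => //; exact: measurable_funM.
Qed.

(* The laws of q1 on the event E1 and of q2 on the event E2 are compared: their
   Laplace transforms determine the masses of the half-lines ]c, +oo[. *)
Section laplace_unique.
Context d1 d2 (T1 : measurableType d1) (T2 : measurableType d2).
Variables (P1 : {finite_measure set T1 -> \bar R}).
Variables (P2 : {finite_measure set T2 -> \bar R}).
Variables (E1 : set T1) (E2 : set T2) (q1 : T1 -> R) (q2 : T2 -> R).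
Hypotheses (mE1 : measurable E1) (mE2 : measurable E2).
Hypotheses (mq1 : measurable_fun setT q1) (mq2 : measurable_fun setT q2).
Hypotheses (q1_ge0 : forall x, 0 <= q1 x) (q2_ge0 : forall x, 0 <= q2 x).
Hypothesis laplaceE : forall l : R, 0 <= l ->
  (\int[P1]_(x in E1) (expR (- l * q1 x))%:E =
   \int[P2]_(x in E2) (expR (- l * q2 x))%:E)%E.

(* The factor expR (- a * x) lets the induction on N go through: one more factor
   1 - expR (- b * x) is a difference of two terms of the same form. *)
Let w (a b : R) N (x : R) := expR (- a * x) * (1 - expR (- b * x)) ^+ N.

Let mw a b N : measurable_fun setT (w a b N).
Proof.
apply: measurable_funM; last apply: measurable_funX; last apply: measurable_funB => //;
  by apply: measurableT_comp => //; exact: measurable_funM.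
Qed.

Let w_le1 (a b : R) N (x : R) : 0 <= a -> 0 <= b -> 0 <= x -> `|w a b N x| <= 1.
Proof.
move=> a0 b0 x0.
have h t : 0 <= t -> expR (- t * x) <= 1.
  by move=> t0; rewrite -expR0 ler_expR mulNr oppr_le0 mulr_ge0.
have := h _ b0; have := h _ a0; have := expR_ge0 (- b * x).
have := expR_ge0 (- a * x) => ea eb ea1 eb1.
rewrite normrM ger0_norm// ger0_norm ?exprn_ge0 ?subr_ge0//.
by rewrite mulr_ile1// ?exprn_ile1// ?exprn_ge0 ?subr_ge0// gerBl.
Qed.

Let integrable_w d (T : measurableType d) (P : {finite_measure set T -> \bar R})
    (E : set T) (q : T -> R) (a b : R) N :
  measurable E -> measurable_fun setT q -> (forall x, 0 <= q x) ->
  0 <= a -> 0 <= b -> P.-integrable E (EFin \o (w a b N \o q)).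
Proof.
move=> mE mq q0 a0 b0; apply: measurable_bounded_integrable => //.
- by rewrite -ge0_fin_numE//; exact: fin_num_measure.
- by apply: measurable_funTS; exact: (measurableT_comp (mw a b N) mq).
- exists 1; split => // M M1 x _ /=; apply: le_trans (ltW M1).
  exact: w_le1.
Qed.

Let int_w N : forall a b : R, 0 <= a -> 0 <= b ->
  (\int[P1]_(x in E1) (w a b N (q1 x))%:E =
   \int[P2]_(x in E2) (w a b N (q2 x))%:E)%E.
Proof.
elim: N => [|N IH] a b a0 b0.
  transitivity (\int[P1]_(x in E1) (expR (- a * q1 x))%:E)%E.
    by apply: eq_integral => x _; rewrite /w expr0 mulr1.
  by rewrite laplaceE//; apply: eq_integral => x _; rewrite /w expr0 mulr1.
have wS x : w a b N.+1 x = w a b N x - w (a + b) b N x.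
  rewrite /w exprS (_ : - (a + b) * x = - a * x + - b * x); last by ring.
  by rewrite expRD; ring.
under eq_integral do rewrite wS EFinB.
under [RHS]eq_integral do rewrite wS EFinB.
have ab0 : 0 <= a + b by rewrite addr_ge0.
rewrite integralB//; [|exact: (integrable_w P1 N mE1 mq1)..].
by rewrite [RHS]integralB//; [|exact: (integrable_w P2 N mE2 mq2)..]; rewrite !IH.
Qed.

Let int_step c n :
  (\int[P1]_(x in E1) (soft_step c n (q1 x))%:E =
   \int[P2]_(x in E2) (soft_step c n (q2 x))%:E)%E.
Proof.
rewrite /soft_step; set N := (Num.truncn _).+1.
have e x : (1 - expR (- n.+1%:R * x)) ^+ N = w 0 n.+1%:R N x.
  by rewrite /w oppr0 mul0r expR0 mul1r.
under eq_integral do rewrite e.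
by under [RHS]eq_integral do rewrite e; exact: int_w.
Qed.

Let step_lim d (T : measurableType d) (P : {finite_measure set T -> \bar R})
    (E : set T) (q : T -> R) c :
  measurable E -> measurable_fun setT q -> (forall x, 0 <= q x) -> 0 <= c ->
  (\int[P]_(x in E) (soft_step c n (q x))%:E @[n --> \oo] -->
    P (E `&` q @^-1` `]c, +oo[))%E.
Proof.
move=> mE mq q0 c0.
have mqc : measurable (q @^-1` `]c, +oo[).
  by rewrite -[X in measurable X]setTI; exact: mq.
have -> : (P (E `&` q @^-1` `]c, +oo[) =
    \int[P]_(x in E) ((c < q x)%R%:R : R)%:E)%E.
  rewrite setIC -integral_indic//; apply: eq_integral => x _.
  rewrite indicE; congr EFin; congr (nat_of_bool _)%:R; apply/idP/idP; rewrite inE/= in_itv/= andbT//.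
apply: (@bounded_cvg_integral _ _ _ _ (fun n => soft_step c n \o q) _ 1) => //.
- move=> n; apply: measurable_funTS.
  exact: (measurableT_comp (measurable_soft_step c n) mq).
- move=> n x _ /=; have /andP[s0 s1] := soft_step_ge0_le1 c n (q0 x).
  by rewrite ger0_norm.
- by move=> x _; exact: soft_step_cvg.
Qed.

Lemma laplace_unique (A : set R) : measurable A ->
  P1 (E1 `&` q1 @^-1` A) = P2 (E2 `&` q2 @^-1` A).
Proof.
move=> mA.
pose m1 := pushforward (mrestr P1 mE1) q1.
pose m2 := pushforward (mrestr P2 mE2) q2.
have mass : P1 E1 = P2 E2.
  have := laplaceE (lexx 0).
  under eq_integral do rewrite oppr0 mul0r expR0.
  under [in X in _ = X -> _]eq_integral do rewrite oppr0 mul0r expR0.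
  by rewrite !integral_cst// !mul1e.
have m1E B : m1 B = P1 (E1 `&` q1 @^-1` B) by rewrite /m1/= /pushforward/= /mrestr setIC.
have m2E B : m2 B = P2 (E2 `&` q2 @^-1` B) by rewrite /m2/= /pushforward/= /mrestr setIC.
rewrite -m1E -m2E.
apply: (measure_unique (@RGenOInfty.G R) (fun k => `](- k%:R), +oo[%classic)) => //.
- exact: RGenOInfty.measurableE.
- move=> _ _ [a ->] [b ->]; exists (Num.max a b).
  by apply/seteqP; split => x /=; rewrite !in_itv/= !andbT gt_max;
    [by move=> [-> ->]|by move/andP].
- by move=> k; exists (- k%:R).
- rewrite -subTset => x _; exists (Num.truncn `|x|).+1 => //=.
  rewrite in_itv/= andbT ltrNl (le_lt_trans _ (truncnS_gt _))//.
  by rewrite -normrN ler_norm.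
- move=> _ [c ->]; rewrite -/m1 -/m2; transitivity (P1 (E1 `&` q1 @^-1` `]c, +oo[)).
    exact: m1E.
  transitivity (P2 (E2 `&` q2 @^-1` `]c, +oo[)); last exact/esym/m2E.
  have [c0|c0] := leP 0 c.
    have h1 := @step_lim _ _ P1 _ _ _ mE1 mq1 q1_ge0 c0; have h2 := @step_lim _ _ P2 _ _ _ mE2 mq2 q2_ge0 c0.
    have e12 : (fun n => \int[P1]_(x in E1) (soft_step c n (q1 x))%:E)%E =
               (fun n => \int[P2]_(x in E2) (soft_step c n (q2 x))%:E)%E.
      by apply/funext => n; exact: int_step.
    have l1 := cvg_lim (@ereal_hausdorff R) h1.
    have l2 := cvg_lim (@ereal_hausdorff R) h2.
    rewrite -[LHS]l1 -[RHS]l2; congr (limn _); exact: e12.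
  have full (T : Type) (E : set T) (q : T -> R) : (forall x, 0 <= q x) ->
      E `&` q @^-1` `]c, +oo[ = E.
    move=> q0; rewrite setIidl// => x _ /=.
    by rewrite in_itv/= andbT (lt_le_trans c0).
  by rewrite !full.
- move=> k; apply: (@le_lt_trans _ _ (P1 E1)); last by rewrite -ge0_fin_numE//; exact: fin_num_measure.
  rewrite [leLHS]m1E; apply: le_measure; rewrite ?inE//; apply: measurableI => //;
    rewrite -[X in measurable X]setTI; exact: mq1.
Qed.

End laplace_unique.
End laplace.

(** * Gaussian measures and their tilts *)

Section normal.
Context {R : realType}.
Local Open Scope ereal_scope.

Lemma lebesgue_measure_shift (x : R) (A : set R) : measurable A ->
  pushforward lebesgue_measure (fun z : measurableTypeR R => (x + z)%R : measurableTypeR R) A =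
  lebesgue_measure A.
Proof.
move=> mA; apply/esym/lebesgue_measure_unique => //=.
  exact: measurable_funD.
  move=> _ _ [[a b]] _ <-; rewrite /pushforward.
  rewrite (_ : _ @^-1` _ = `]a - x, b - x]%classic)%R; last first.
    by apply/seteqP; split => z /=; rewrite !in_itv/= ltrBlDl lerBrDl.
  rewrite !lebesgue_measure_itv/= !lte_fin ltrD2r; case: ifP => // _.
  by rewrite -!EFinB; congr EFin; ring.
Qed.

Lemma ge0_integral_shift (x : R) (G : R -> \bar R) :
  measurable_fun setT G -> (forall z, 0 <= G z) ->
  \int[lebesgue_measure]_z G (x + z)%R = \int[lebesgue_measure]_z G z.
Proof.
move=> mG G0.
pose f (z : measurableTypeR R) : measurableTypeR R := (x + z)%R.
have mf : measurable_fun setT f by exact: measurable_funD.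
rewrite -[LHS](@ge0_integral_pushforward _ _ _ _ R f mf lebesgue_measure setT G)//.
by apply: eq_measure_integral => A mA _; exact: lebesgue_measure_shift.
Qed.

Lemma ge0_integral_normal (m s : R) (G : R -> \bar R) :
  measurable_fun setT G -> (forall z, 0 <= G z) ->
  \int[normal_prob m s]_z G z =
  \int[lebesgue_measure]_z ((normal_pdf m s z)%:E * G z).
Proof.
move=> mG G0; apply: (@ge0_integral_density _ _ _ _ _ _ _ id) => //.
- exact: measurable_normal_pdf.
- by move=> x; exact: normal_pdf_ge0.
- by move=> A mA; rewrite /= /normal_prob integral_mul_indic.
Qed.

Lemma ge0_integral_normal_shift (s x : R) (G : R -> \bar R) :
  measurable_fun setT G -> (forall z, 0 <= G z) ->
  \int[normal_prob 0 s]_z G (x + z)%R =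
  \int[lebesgue_measure]_z ((normal_pdf 0 s (z - x))%:E * G z).
Proof.
move=> mG G0.
have mGx : measurable_fun setT (fun z => G (x + z)%R).
  by apply: (measurableT_comp mG); exact: measurable_funD.
rewrite (ge0_integral_normal 0 s mGx); last by move=> z; exact: G0.
have mp : measurable_fun setT
    (fun z : R => ((normal_pdf 0 s (z - x))%:E * G z) : \bar R).
  apply: emeasurable_funM => //; apply/measurable_EFinP.
  apply: measurableT_comp; first exact: measurable_normal_pdf.
  exact: measurable_funB.
rewrite -[RHS](ge0_integral_shift x mp); last first.
  by move=> z; rewrite mule_ge0// lee_fin normal_pdf_ge0.
by apply: eq_integral => z _; rewrite addrAC subrr add0r.
Qed.

(** Completing the square: a Gaussian density of variance t and centre x times
    exp (- l y^2 / 2) is, up to a constant, the Gaussian density of variance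
    a t and centre a x. A negative l is allowed as long as the product remains
    integrable. *)
Lemma normal_pdf_tilt (t l x y : R) : (0 < t)%R -> (0 < 1 + l * t)%R ->
  let a := ((1 + l * t)^-1)%R in
  (normal_pdf 0 (Num.sqrt t) (y - x) * expR (- l * (y ^+ 2 / 2)) =
   Num.sqrt a * expR (- (a * l) * (x ^+ 2 / 2)) *
     normal_pdf 0 (Num.sqrt (a * t)) (y - a * x))%R.
Proof.
move=> t0 lt0 a; have a0 : (0 < a)%R by rewrite invr_gt0.
have at0 : (0 < a * t)%R by exact: mulr_gt0.
rewrite !normal_pdfE ?gt_eqF ?sqrtr_gt0// /normal_peak /normal_fun.
rewrite !sqr_sqrtr; [|exact: ltW..].
rewrite !subr0.
have -> : (a * t * pi *+ 2 = a * (t * pi *+ 2) :> R)%R by ring.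
rewrite [in RHS]sqrtrM; last exact: ltW.
rewrite invfM.
have sa : (Num.sqrt a != 0)%R by rewrite gt_eqF ?sqrtr_gt0.
set p := (Num.sqrt (t * _ *+ 2))^-1%R.
have e : (- (y - x) ^+ 2 / (t *+ 2) + - l * (y ^+ 2 / 2) =
    - (a * l) * (x ^+ 2 / 2) + - (y - a * x) ^+ 2 / (a * t *+ 2))%R.
  by rewrite /a; field; rewrite !gt_eqF.
move/(congr1 (@expR R)): e; rewrite !expRD => e.
rewrite -[LHS]mulrA e; by field.
Qed.

Lemma normal_tilt (t l x : R) (F : R -> \bar R) :
  (0 < t)%R -> (0 < 1 + l * t)%R ->
  measurable_fun setT F -> (forall z, 0 <= F z) ->
  let a := ((1 + l * t)^-1)%R in
  \int[normal_prob 0 (Num.sqrt t)]_z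
     (F (x + z)%R * (expR (- l * ((x + z) ^+ 2 / 2)))%:E) =
  (Num.sqrt a * expR (- (a * l) * (x ^+ 2 / 2)))%:E *
  \int[normal_prob 0 (Num.sqrt (a * t))]_z F (a * x + z)%R.
Proof.
move=> t0 lt0 mF F0 a.
have me : measurable_fun setT (fun y : R => (expR (- l * (y ^+ 2 / 2)))%:E : \bar R).
  apply/measurable_EFinP; apply: measurableT_comp => //.
  by apply: measurable_funM => //; apply: measurable_funM => //; exact: measurable_funX.
have mFe : measurable_fun setT
    (fun y : R => (F y * (expR (- l * (y ^+ 2 / 2)))%:E) : \bar R).
  exact: emeasurable_funM.
have Fe0 (y : R) : 0 <= F y * (expR (- l * (y ^+ 2 / 2)))%:E.
  by rewrite mule_ge0// lee_fin expR_ge0.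
have mpF : measurable_fun setT (fun y : R =>
    ((normal_pdf 0 (Num.sqrt (a * t)) (y - a * x))%:E * F y) : \bar R).
  apply: emeasurable_funM => //; apply/measurable_EFinP.
  apply: measurableT_comp; first exact: measurable_normal_pdf.
  exact: measurable_funB.
rewrite [X in _ = _ * X](ge0_integral_normal_shift _ (a * x) mF F0).
etransitivity.
  exact: (ge0_integral_normal_shift (Num.sqrt t) x mFe Fe0).
rewrite -ge0_integralZl//.
2: by move=> z _; rewrite mule_ge0// lee_fin normal_pdf_ge0.
apply: eq_integral => y _.
rewrite (muleC (F y)) muleA -EFinM normal_pdf_tilt//.
by rewrite [in RHS]muleA -EFinM.
Qed.

End normal.

Section gauss.
Context {R : realType}.
Local Open Scope ereal_scope.

(** The same fact as [measurable_consv], for the structure that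
    [normal_prob] gives to the factor R. *)
Lemma mconsv n : measurable_fun [set: measurableTypeR R * 'rV[R]_n]
  (@consv R n : measurableTypeR R * 'rV[R]_n -> 'rV[R]_n.+1).
Proof. exact: measurable_consv. Qed.

Section cons_prob.
Context n (s : R) (mu : probability 'rV[R]_n R).

Definition cons_prob : set 'rV[R]_n.+1 -> \bar R :=
  pushforward (normal_prob 0 s \x mu) (@consv R n).

Let cons_prob0 : cons_prob set0 = 0.
Proof. by rewrite /cons_prob /pushforward preimage_set0 measure0. Qed.

Let cons_prob_ge0 A : 0 <= cons_prob A.
Proof. by rewrite /cons_prob /pushforward measure_ge0. Qed.

Let cons_prob_sigma_additive : semi_sigma_additive cons_prob.
Proof.
move=> F mF tF mUF.
rewrite /cons_prob /pushforward preimage_bigcup.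
have mc B : measurable B -> measurable (@consv R n @^-1` B).
  by move=> mB; rewrite -[X in measurable X]setTI; exact: measurable_consv.
apply: measure_semi_sigma_additive.
- by move=> k; exact: mc.
- apply/trivIsetP => i j _ _ ij; rewrite -preimage_setI.
  by move/trivIsetP : tF => /(_ _ _ _ _ ij) ->//; rewrite preimage_set0.
- by rewrite -preimage_bigcup; exact: mc.
Qed.

HB.instance Definition _ := isMeasure.Build _ _ _ cons_prob
  cons_prob0 cons_prob_ge0 cons_prob_sigma_additive.

Let cons_probT : cons_prob setT = 1.
Proof.
by rewrite /cons_prob /pushforward preimage_setT; exact: probability_setT.
Qed.

HB.instance Definition _ :=
  Measure_isProbability.Build _ _ _ cons_prob cons_probT.

End cons_prob.

(** Law of a centred Gaussian vector of covariance t times the identity. *)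
Fixpoint gauss n (t : R) : probability 'rV[R]_n R :=
  if n is n'.+1 then cons_prob (Num.sqrt t) (gauss n' t)
  else dirac (0%R : 'rV[R]_0).

Lemma ge0_integral_gaussS n t (F : 'rV[R]_n.+1 -> \bar R) :
  measurable_fun setT F -> (forall x, 0 <= F x) ->
  \int[gauss n.+1 t]_x F x =
  \int[normal_prob 0 (Num.sqrt t)]_a \int[gauss n t]_v F (consv (a, v)).
Proof.
move=> mF F0; etransitivity.
  exact: (ge0_integral_pushforward (@mconsv n)
    (normal_prob 0 (Num.sqrt t) \x gauss n t) measurableT mF (in1W F0)).
rewrite preimage_setT fubini_tonelli1//.
  exact: (measurableT_comp mF (@mconsv n)).
by move=> x /=.
Qed.

Lemma integrable_consv n t (F : 'rV[R]_n.+1 -> \bar R) :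
  (gauss n.+1 t).-integrable setT F ->
  (normal_prob 0 (Num.sqrt t) \x gauss n t).-integrable setT (F \o @consv R n).
Proof.
move=> iF; have mF := measurable_int _ iF.
have mFc := measurableT_comp mF (@mconsv n).
move/integrableP : iF => [_ iF]; apply/integrableP; split => //.
apply: le_lt_trans iF; rewrite le_eqVlt; apply/orP; left; apply/eqP/esym.
have mFa : measurable_fun setT (abse \o F) by exact: measurableT_comp.
by etransitivity; [exact: (ge0_integral_pushforward (@mconsv n)
  (normal_prob 0 (Num.sqrt t) \x gauss n t) measurableT mFa
  (in1W (fun x => abse_ge0 (F x))))|rewrite preimage_setT].
Qed.

Lemma integral_gaussS n t (F : 'rV[R]_n.+1 -> \bar R) :
  (gauss n.+1 t).-integrable setT F ->
  \int[gauss n.+1 t]_x F x =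
  \int[normal_prob 0 (Num.sqrt t)]_a \int[gauss n t]_v F (consv (a, v)).
Proof.
move=> iF; have iFc := integrable_consv iF.
etransitivity.
  apply: (integral_pushforward (@mconsv n)
    (mu := normal_prob 0 (Num.sqrt t) \x gauss n t) (measurable_int _ iF)) => //.
by rewrite preimage_setT -(integral12_prod_meas1 iFc).
Qed.

Lemma integral_gauss0 t (F : 'rV[R]_0 -> \bar R) :
  \int[gauss 0 t]_x F x = F 0%R.
Proof.
rewrite /= integral_dirac// ?diracT ?mul1e//.
apply: (eq_measurable_fun (cst (F 0%R))) => // x _.
by rewrite (thinmx0 x).
Qed.

(* The boxes are a pi-system generating the sigma-algebra of R^n. *)
Definition boxes n : set (set 'rV[R]_n) :=
  [set E | exists2 A : 'I_n -> set R, (forall i, measurable (A i)) &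
     E = [set x : 'rV[R]_n | forall i, A i (x ord0 i)]].

Lemma measurable_box n (A : 'I_n -> set R) : (forall i, measurable (A i)) ->
  measurable [set x : 'rV[R]_n | forall i, A i (x ord0 i)].
Proof.
move=> mA.
have -> : [set x : 'rV[R]_n | forall i, A i (x ord0 i)] =
    \bigcap_(i in [set: 'I_n]) ((fun x => x ord0 i) @^-1` A i).
  by apply/seteqP; split=> x /= H i; [move=> _; exact: H|exact: H].
apply: fin_bigcap_measurable => // i _.
by rewrite -[X in measurable X]setTI; exact: measurable_coord.
Qed.

Lemma measurable_boxes n : @measurable _ 'rV[R]_n = <<s @boxes n >>.
Proof.
apply/seteqP; split.
  apply: smallest_sub; first exact: smallest_sigma_algebra.
  rewrite -bigcup_seq/=; apply: bigcup_sub => i _ _ [B mB <-].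
  apply: sub_sigma_algebra; exists (fun j => if j == i then B else setT).
    by move=> j; case: ifP.
  rewrite setTI; apply/seteqP; split => x /=.
    by move=> Bx j; case: eqP => // ->.
  by move=> /(_ i); rewrite eqxx.
apply: smallest_sub; first exact: sigma_algebra_measurable.
by move=> _ [A mA ->]; exact: measurable_box.
Qed.

Lemma setI_closed_boxes n : setI_closed (@boxes n).
Proof.
move=> _ _ [A mA ->] [B mB ->]; exists (fun i => A i `&` B i).
  by move=> i; exact: measurableI.
by apply/seteqP; split => x /=; [move=> [Ax Bx] i; split|
  move=> H; split => i; have [] := H i].
Qed.

Lemma boxes_unique n (m1 m2 : {measure set 'rV[R]_n -> \bar R}) :
  m1 setT < +oo -> (forall E, boxes E -> m1 E = m2 E) ->
  forall E, measurable E -> m1 E = m2 E.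
Proof.
move=> m1fin m12.
apply: (measure_unique (@boxes n) (fun _ => setT)) => //.
- exact: measurable_boxes.
- exact: setI_closed_boxes.
- move=> _; exists (fun=> setT) => //.
  by apply/seteqP; split.
- by apply/seteqP; split => // x _; exists 0%N.
Qed.

Lemma gauss_box n t (A : 'I_n -> set R) : (forall i, measurable (A i)) ->
  gauss n t [set x : 'rV[R]_n | forall i, A i (x ord0 i)] =
  \prod_(i < n) normal_prob 0 (Num.sqrt t) (A i).
Proof.
elim: n A => [|n IH] A mA /=.
  by rewrite big_ord0 diracE mem_set// => -[].
have mB := @measurable_box n _ (fun i => mA (lift ord0 i)).
rewrite big_ord_recl -IH// -product_measure1E//; last exact: (mA ord0).
rewrite /cons_prob /pushforward; congr (_ _).
apply/seteqP; split => -[a v] /=.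
  move=> H; split => [|i].
    by have := H ord0; rewrite mxE unlift_none.
  by have := H (lift ord0 i); rewrite mxE liftK.
move=> [Aa Av] i; rewrite mxE; case: unliftP => [j ->|->//].
exact: Av.
Qed.

End gauss.

#[global] Opaque gauss.

Section gauss_weight.
Context {R : realType}.

(** The Laplace variable l is paired with |x|^2 / 2; for negative l these
    functions measure growth. *)
Definition gweight n (l : R) (x : 'rV[R]_n) : R := expR (- l * (dotv x x / 2)).

Lemma measurable_gweight n l : measurable_fun setT (@gweight n l).
Proof.
apply: measurableT_comp => //; apply: measurable_funM => //.
by apply: measurable_funM => //; exact: measurable_dotvv.
Qed.

Lemma gweight_gt0 n l x : 0 < @gweight n l x.
Proof. exact: expR_gt0. Qed.

Lemma gweightD n l k x : @gweight n (l + k) x = gweight l x * gweight k x.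
Proof. by rewrite /gweight -expRD; congr expR; ring. Qed.

Lemma gweight0 n x : @gweight n 0 x = 1.
Proof. by rewrite /gweight oppr0 mul0r expR0. Qed.

Lemma measurable_dotv n (a : 'rV[R]_n) : measurable_fun setT (dotv a).
Proof.
by apply: measurable_sum => i; apply: measurable_funM => //; exact: measurable_coord.
Qed.

Lemma dotv_consv n (p q : R * 'rV[R]_n) :
  dotv (consv p) (consv q) = p.1 * q.1 + dotv p.2 q.2.
Proof.
rewrite /dotv big_ord_recl !mxE unlift_none; congr (_ + _).
by apply: eq_bigr => i _; rewrite !mxE liftK.
Qed.

Lemma consvE n (x : 'rV[R]_n.+1) :
  x = consv (x ord0 ord0, \row_j x ord0 (lift ord0 j)).
Proof.
by apply/rowP => i; rewrite mxE; case: unliftP => [j|] -> //=; rewrite mxE.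
Qed.

Lemma consvD n (p q : R * 'rV[R]_n) :
  consv p + consv q = consv (p.1 + q.1, p.2 + q.2).
Proof.
by apply/rowP => i; rewrite !mxE; case: (unlift ord0 i) => [j|]; rewrite ?mxE.
Qed.

Lemma consvZ n (a : R) (p : R * 'rV[R]_n) : a *: consv p = consv (a * p.1, a *: p.2).
Proof.
by apply/rowP => i; rewrite !mxE; case: (unlift ord0 i) => [j|]; rewrite ?mxE.
Qed.

Lemma gweight_consv n l (p : R * 'rV[R]_n) :
  gweight l (consv p) = expR (- l * (p.1 ^+ 2 / 2)) * gweight l p.2.
Proof. by rewrite /gweight dotv_consv -expRD; congr expR; ring. Qed.

Lemma measurable_rVD n (x : 'rV[R]_n) :
  measurable_fun setT (fun z : 'rV[R]_n => x + z).
Proof.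
apply/measurable_fun_rVP => i; under eq_fun do rewrite mxE.
by apply: measurable_funD => //; exact: measurable_coord.
Qed.

Lemma measurable_consv_pair d (T : measurableType d) n (f : T -> R)
    (g : T -> 'rV[R]_n) :
  measurable_fun setT f -> measurable_fun setT g ->
  measurable_fun setT (fun w => consv (f w, g w)).
Proof.
move=> mf mg; apply/measurable_fun_rVP => i; under eq_fun do rewrite mxE.
case: (unlift ord0 i) => [j|//].
exact: (measurableT_comp (measurable_coord j) mg).
Qed.

Local Open Scope ereal_scope.

(** The coordinates are tilted one after the other: gweight is a product over
    them, and a does not depend on the coordinate. *)
Lemma gauss_tilt n (t l : R) : (0 < t)%R -> (0 < 1 + l * t)%R ->
  let a := ((1 + l * t)^-1)%R in
  forall (x : 'rV[R]_n) (F : 'rV[R]_n -> \bar R),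
  measurable_fun setT F -> (forall z, 0 <= F z) ->
  \int[gauss n t]_z (F (x + z)%R * (gweight l (x + z)%R)%:E) =
  (Num.sqrt a ^+ n * gweight (a * l) x)%:E *
  \int[gauss n (a * t)]_z F (a *: x + z)%R.
Proof.
move=> t0 lt0 a; elim: n => [|n IH] x F mF F0.
  rewrite !integral_gauss0 !addr0 (thinmx0 x) scaler0 expr0 mul1r.
  by rewrite /gweight /dotv !big_ord0 !mul0r !mulr0 muleC.
have a0 : (0 < a)%R by rewrite invr_gt0.
have mFg : measurable_fun setT
    (fun z : 'rV[R]_n.+1 => F (x + z)%R * (gweight l (x + z)%R)%:E).
  apply: emeasurable_funM; first exact: (measurableT_comp mF (measurable_rVD x)).
  apply/measurable_EFinP.
  exact: (measurableT_comp (@measurable_gweight _ l) (measurable_rVD x)).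
have Fg0 (z : 'rV[R]_n.+1) : 0 <= F (x + z)%R * (gweight l (x + z)%R)%:E.
  by rewrite mule_ge0// lee_fin ltW// gweight_gt0.
etransitivity; first exact: (ge0_integral_gaussS _ mFg Fg0).
have mFx : measurable_fun setT (fun z : 'rV[R]_n.+1 => F (a *: x + z)%R).
  exact: (measurableT_comp mF (measurable_rVD _)).
rewrite [X in _ = _ * X](ge0_integral_gaussS _ mFx (fun z => F0 _)).
set x0 := x ord0 ord0; set x' := \row_j x ord0 (lift ord0 j).
have xE : x = consv (x0, x') by exact: consvE.
pose c := (Num.sqrt a ^+ n * gweight (a * l) x')%R.
have c0 : (0 <= c)%R by rewrite mulr_ge0 ?exprn_ge0// ltW// gweight_gt0.
pose G (y : R) := c%:E * \int[gauss n (a * t)]_v F (consv (y, a *: x' + v)%R).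
have mcF : measurable_fun setT (fun p : measurableTypeR R * 'rV[R]_n =>
    F (consv (p.1, a *: x' + p.2)%R)).
  apply: (measurableT_comp mF); apply: measurable_consv_pair => //.
  exact: (measurableT_comp (measurable_rVD _) measurable_snd).
have mG : measurable_fun setT G.
  apply: measurable_funeM.
  exact: (@measurable_fun_fubini_tonelli_F _ _ _ _ _ (gauss n (a * t)) _ mcF).
have G0 y : 0 <= G y by rewrite mule_ge0 ?lee_fin// integral_ge0.
have inner (y : R) : \int[gauss n t]_v (F (x + consv (y, v))%R *
      (gweight l (x + consv (y, v))%R)%:E) =
    G (x0 + y)%R * (expR (- l * ((x0 + y) ^+ 2 / 2)))%:E.
  have mFy : measurable_fun setT (fun v : 'rV[R]_n => F (consv (x0 + y, v)%R)).
    by apply: (measurableT_comp mF); exact: measurable_consv_pair.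
  rewrite {}xE.
  under eq_integral => v _ do
    rewrite consvD/= gweight_consv/= EFinM (muleC (expR _)%:E) muleA.
  rewrite ge0_integralZr//.
  - by rewrite (IH x' _ mFy).
  - apply: emeasurable_funM; first exact: (measurableT_comp mFy (measurable_rVD x')).
    apply/measurable_EFinP.
    exact: (measurableT_comp (@measurable_gweight _ l) (measurable_rVD x')).
  - by move=> v _; rewrite mule_ge0// lee_fin ltW// gweight_gt0.
etransitivity; first by apply: eq_integral => y _; exact: inner.
etransitivity; first exact: (normal_tilt x0 t0 lt0 mG G0).
rewrite -/a /G.
have mI : measurable_fun setT (fun z : R => \int[gauss n (a * t)]_v
    F (consv (a * x0 + z, a *: x' + v)%R)).
  have := @measurable_fun_fubini_tonelli_F _ _ _ _ _ (gauss n (a * t)) _ mcF.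
  move=> h; apply: (measurableT_comp (h _)) => //.
  exact: measurable_funD.
rewrite ge0_integralZl//; last by move=> z _; rewrite integral_ge0.
rewrite muleA -EFinM; congr (_%:E * _).
  by rewrite xE gweight_consv/= (exprS (Num.sqrt a) n) /c; ring.
apply: eq_integral => z _; apply: eq_integral => v _.
by rewrite xE consvZ consvD.
Qed.

End gauss_weight.

(** * Functions of moderate growth *)

Section tame.
Context {R : realType} {n : nat}.
Implicit Types f g : 'rV[R]_n -> R.

(** Growth slower than every Gaussian exp (mu |z|^2 / 2): this class contains the
    polynomials, is stable under products because mu can be halved, and is
    integrable for every Gaussian law. *)
Definition tame f := measurable_fun setT f /\
  forall mu, 0 < mu -> exists C, forall z, `|f z| <= C * gweight (- mu) z.

Lemma gweightN_ge (mu : R) (z : 'rV[R]_n) : 1 + mu * (dotv z z / 2) <= gweight (- mu) z.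
Proof. by rewrite /gweight opprK expR_ge1Dx. Qed.

Lemma gweightN_ge1 (mu : R) (z : 'rV[R]_n) : 0 < mu -> 1 <= gweight (- mu) z.
Proof.
move=> mu0; apply: le_trans (gweightN_ge _ _); rewrite lerDl.
by rewrite mulr_ge0 ?(ltW mu0)// divr_ge0 ?dotvv_ge0.
Qed.

Lemma tame_cst (c : R) : tame (fun=> c).
Proof.
split=> // mu mu0; exists `|c| => z; rewrite ler_peMr//.
exact: gweightN_ge1.
Qed.

Lemma tame_coord i : tame (fun z => z ord0 i).
Proof.
split=> [|mu mu0]; first exact: measurable_coord.
exists (1 + 2 / mu) => z.
have zi : z ord0 i ^+ 2 <= dotv z z.
  rewrite /dotv (bigD1 i)//= -expr2 lerDl sumr_ge0// => j _.
  by rewrite -expr2 sqr_ge0.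
apply: (@le_trans _ _ (1 + dotv z z)).
  apply: le_trans (_ : 1 + z ord0 i ^+ 2 <= _); last by rewrite lerD2l.
  have := sqr_ge0 (`|z ord0 i| - 1); rewrite -[z ord0 i ^+ 2](real_normK (num_real _)).
  have := normr_ge0 (z ord0 i); nra.
have k0 : 0 <= 1 + 2 / mu by rewrite addr_ge0// divr_ge0// ltW.
apply: le_trans (ler_wpM2l k0 (gweightN_ge mu z)).
have d0 := dotvv_ge0 z.
have -> : (1 + 2 / mu) * (1 + mu * (dotv z z / 2)) =
    1 + dotv z z + (2 / mu + mu * dotv z z / 2) by field; rewrite gt_eqF.
by rewrite lerDl addr_ge0// ?divr_ge0// ?mulr_ge0// ltW.
Qed.

Lemma tameD f g : tame f -> tame g -> tame (fun z => f z + g z).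
Proof.
move=> [mf tf] [mg tg]; split=> [|mu mu0]; first exact: measurable_funD.
have [C fC] := tf _ mu0; have [D gD] := tg _ mu0; exists (C + D) => z.
by rewrite (le_trans (ler_normD _ _))// mulrDl lerD.
Qed.

Lemma tameM f g : tame f -> tame g -> tame (fun z => f z * g z).
Proof.
move=> [mf tf] [mg tg]; split=> [|mu mu0]; first exact: measurable_funM.
have mu2 : 0 < mu / 2 by rewrite divr_gt0.
have [C fC] := tf _ mu2; have [D gD] := tg _ mu2; exists (C * D) => z.
have -> : - mu = - (mu / 2) + - (mu / 2) by field.
by rewrite normrM gweightD mulrACA ler_pM.
Qed.

Lemma tameZ (c : R) f : tame f -> tame (fun z => c * f z).
Proof. exact/tameM/tame_cst. Qed.

Lemma tameB f g : tame f -> tame g -> tame (fun z => f z - g z).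
Proof.
move=> tf tg; under eq_fun do rewrite -mulN1r.
exact/tameD/tameZ.
Qed.

Lemma tame_sum (I : Type) (s : seq I) (P : pred I) (F : I -> 'rV[R]_n -> R) :
  (forall i, tame (F i)) -> tame (fun z => \sum_(i <- s | P i) F i z).
Proof.
move=> tF; elim: s => [|i s IH].
  by under eq_fun do rewrite big_nil; exact: tame_cst.
under eq_fun do rewrite big_cons.
by case: (P i) => //; exact: tameD.
Qed.

Lemma tame_prod (I : Type) (s : seq I) (P : pred I) (F : I -> 'rV[R]_n -> R) :
  (forall i, tame (F i)) -> tame (fun z => \prod_(i <- s | P i) F i z).
Proof.
move=> tF; elim: s => [|i s IH].
  by under eq_fun do rewrite big_nil; exact: tame_cst.
under eq_fun do rewrite big_cons.
by case: (P i) => //; exact: tameM.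
Qed.

Lemma tame_affine (c : R) a : tame (fun z => c + dotv a z).
Proof.
apply: tameD; first exact: tame_cst.
by apply: tame_sum => i; apply: tameZ; exact: tame_coord.
Qed.

Lemma tame_bounded f (l : R) : 0 < l -> tame f ->
  exists C, forall z, `|f z * gweight l z| <= C.
Proof.
move=> l0 [_ /(_ _ l0)[C fC]]; exists C => z.
rewrite normrM [X in _ * X]ger0_norm; last by rewrite ltW// gweight_gt0.
apply: le_trans (ler_wpM2r (ltW (gweight_gt0 _ _)) (fC z)) _.
by rewrite -mulrA -gweightD addNr gweight0 mulr1.
Qed.

(** The tilt by a negative parameter shows that the dominating function
    gweight (- 1 / (2 t)) has a finite integral. *)
Lemma tame_integrable f (t : R) : 0 < t -> tame f ->
  (gauss n t).-integrable setT (EFin \o f).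
Proof.
move=> t0 [mf tf]; have mu0 : 0 < (2 * t)^-1 by rewrite invr_gt0 mulr_gt0.
have [C fC] := tf _ mu0; apply/integrableP; split; first exact/measurable_EFinP.
have C0 : 0 <= C.
  have := fC 0; rewrite /gweight /dotv big1 ?mul0r ?mulr0 ?expR0 ?mulr1; last first.
    by move=> i _; rewrite mxE mul0r.
  exact: le_trans.
have lt0 : 0 < 1 + - (2 * t)^-1 * t.
  by rewrite (_ : 1 + _ = 2^-1) ?invr_gt0//; field; rewrite gt_eqF.
have mg : measurable_fun setT (fun z : 'rV[R]_n => (gweight (- (2 * t)^-1) z)%:E : \bar R).
  by apply/measurable_EFinP; exact: (@measurable_gweight _ n _).
apply: (@le_lt_trans _ _ (\int[gauss n t]_z (C%:E * (gweight (- (2 * t)^-1) z)%:E)))%E.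
  apply: ge0_le_integral => //.
  - by apply: measurableT_comp => //; exact/measurable_EFinP.
  - by apply: measurable_funeM; exact: mg.
  - by move=> z _; rewrite /= -EFinM lee_fin.
rewrite ge0_integralZl//; last by move=> z _; rewrite lee_fin ltW// gweight_gt0.
have := @gauss_tilt R n t (- (2 * t)^-1) t0 lt0 0 (cst 1%E)
  (measurable_cst _) (fun=> lee01).
rewrite (_ : (\int[gauss n t]_z _ = \int[gauss n t]_z (gweight (- (2 * t)^-1) z)%:E)%E).
  move=> ->; rewrite [X in (_ * (_ * X))%E](_ : _ = 1%E); first by rewrite mule1 -EFinM ltry.
  by rewrite integral_cst// mul1e; exact: probability_setT.
by apply: eq_integral => z _; rewrite /= mul1e add0r.
Qed.

End tame.

(** * Stein's identity and Gaussian moments *)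

Section stein1.
Context {R : realType}.
Implicit Types p : {poly R}.
Local Notation mu := lebesgue_measure.

Lemma poly_growth p (m : R) : 0 < m ->
  exists2 C, 0 <= C & forall a : R, `|p.[a]| <= C * expR (m * (a ^+ 2 / 2)).
Proof.
move=> m0; have tX i : tame (fun z : 'rV[R]_1 => z ord0 ord0 ^+ i).
  elim: i => [|i IH]; first exact: tame_cst.
  by under eq_fun do rewrite exprS; apply: tameM => //; exact: tame_coord.
have [_ /(_ _ m0)[C pC]] : tame (fun z : 'rV[R]_1 => p.[z ord0 ord0]).
  under eq_fun do rewrite horner_coef.
  by apply: tame_sum => i; exact: tameZ.
have pC' a : `|p.[a]| <= C * expR (m * (a ^+ 2 / 2)).
  have := pC (const_mx a); rewrite mxE /gweight opprK /dotv big_ord1 !mxE.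
  by rewrite -expr2.
exists C => //; have := pC' 0; rewrite expr0n/= mul0r mulr0 expR0 mulr1.
exact: le_trans.
Qed.

Section fixed_variance.
Variables (t : R) (t0 : 0 < t).

Let e (a : R) := expR (- (a ^+ 2 / (2 * t))).

Let e_decay p : exists2 C, 0 <= C &
  forall a, `|p.[a] * e a| <= C * expR (- (a ^+ 2 / (4 * t))).
Proof.
have m0 : 0 < (2 * t)^-1 by rewrite invr_gt0 mulr_gt0.
have [C C0 pC] := poly_growth p m0; exists C => // a.
rewrite normrM [X in _ * X]ger0_norm ?expR_ge0//.
apply: le_trans (ler_wpM2r (expR_ge0 _) (pC a)) _.
rewrite -mulrA -expRD le_eqVlt; apply/orP; left; apply/eqP.
by congr (_ * expR _); field; rewrite gt_eqF.
Qed.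

Let q p := p^`() - t^-1 *: ('X * p).

Let is_derive_pe p (x : R) : is_derive x (1 : R) (fun a => p.[a] * e a) ((q p).[x] * e x).
Proof.
have de : is_derive x (1 : R) e (- (t^-1 * x) * e x).
  have -> : e = expR \o (fun a => (- (2 * t)^-1 *: 'X^2).[a]).
    apply/funext => a /=; rewrite /e hornerZ hornerXn; congr expR; field.
    by rewrite gt_eqF.
  apply: is_derive_eq; rewrite /=.
  rewrite derivZ derivXn !hornerZ hornerMn !hornerXn.
  rewrite mulrC; congr (_ * expR _); rewrite /= -[x *+ 2]mulr_natr; field.
  by rewrite gt_eqF.
have dp := is_derive_poly p x.
apply: is_derive_eq; rewrite /q !(hornerD, hornerN, hornerZ, hornerM, hornerX) /=.
by rewrite /GRing.scale /=; ring.
Qed.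

Let J p a := (q p).[a] * e a.

Let cJ p : continuous (J p).
Proof.
move=> x; apply: differentiable_continuous; apply/derivable1_diffP.
have h := is_derive_pe (q p) x; exact: (@ex_derive _ _ _ _ _ _ _ h).
Qed.

Let mJ p : measurable_fun setT (J p).
Proof. by apply: continuous_measurable_fun; exact: cJ. Qed.

Let integrable_gauss (C : R) :
  mu.-integrable setT (fun a => (C * expR (- (a ^+ 2 / (4 * t))))%:E).
Proof.
pose s := Num.sqrt (2 * t); have s0 : s != 0 by rewrite gt_eqF ?sqrtr_gt0 ?mulr_gt0.
have -> : (fun a => (C * expR (- (a ^+ 2 / (4 * t))))%:E) =
    (fun a => (C / normal_peak s)%:E * (normal_pdf 0 s a)%:E)%E.
  apply/funext => a; rewrite -EFinM normal_pdfE// /normal_fun subr0.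
  rewrite mulrA divfK ?gt_eqF ?normal_peak_gt0//; congr (_ * expR _)%:E.
  rewrite /s sqr_sqrtr ?mulr_ge0 ?ltW//; first by field; rewrite gt_eqF.
exact/integrableZl/integrable_normal_pdf.
Qed.

Let FTC p (m : R) : 0 < m -> (\int[mu]_(a in `[(- m)%R, m]) (J p a)%:E =
  (p.[m] * e m)%:E - (p.[- m] * e (- m))%:E)%E.
Proof.
move=> m0; have cpe : continuous (fun a => p.[a] * e a).
  move=> x; apply: differentiable_continuous; apply/derivable1_diffP.
  exact: (@ex_derive _ _ _ _ _ _ _ (is_derive_pe p x)).
apply: (@continuous_FTC2 _ (J p) (fun a => p.[a] * e a)).
- by rewrite -subr_gt0 opprK addr_gt0.
- by apply: continuous_subspaceT => x; exact: cJ.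
- split; last 2 first.
  + exact/cvg_at_right_filter/cpe.
  + exact/cvg_at_left_filter/cpe.
  + by move=> x _; exact: (@ex_derive _ _ _ _ _ _ _ (is_derive_pe p x)).
- move=> x _; rewrite derive1E; exact: (@derive_val _ _ _ _ _ _ _ (is_derive_pe p x)).
Qed.

(* The derivative of p times the Gaussian factor has integral 0, since the
   boundary terms vanish at infinity. *)
Let lebesgue_J p : (\int[mu]_a (J p a)%:E = 0)%E.
Proof.
have [C C0 JC] := e_decay (q p); have [D D0 pD] := e_decay p.
pose I n : set R := `[- n.+1%:R, n.+1%:R]%classic.
have mI n : measurable (I n) by exact: measurable_itv.
have lim1 : (\int[mu]_(a in I n) (J p a)%:E @[n --> \oo] -->
    \int[mu]_a (J p a)%:E)%E.
  under eq_fun do rewrite integral_mkcond.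
  apply: (@dominated_cvg _ _ _ mu setT measurableT _ _
    (fun a => (C * expR (- (a ^+ 2 / (4 * t))))%:E)) => //.
  - move=> n; apply: (measurable_restrictT _ (mI n)).1.
    by apply: measurable_funTS; exact/measurable_EFinP.
  - move=> a _; apply: cvg_near_cst.
    exists (Num.truncn `|a|) => // n /= an; rewrite patchE mem_set// /I /= in_itv/=.
    rewrite -ler_norml; apply: le_trans (ltW (truncnS_gt _)) _.
    by rewrite ler_nat.
  - move=> n a _; rewrite patchE; case: ifPn => _; first exact: JC.
    by rewrite abse0 lee_fin mulr_ge0// expR_ge0.
have lim2 : (\int[mu]_(a in I n) (J p a)%:E @[n --> \oo] --> 0)%E.
  under eq_fun do rewrite FTC// -EFinB.
  apply: cvg_EFin; first exact: nearW.
  apply: (@cvg_le_harmonic _ _ _ (D * (4 * t) + D * (4 * t))) => n; rewrite subr0.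
  have m1 : 1 <= n.+1%:R :> R by rewrite ler1n.
  move: (n.+1%:R) m1 => m m1 /=.
  have bnd (x : R) : x ^+ 2 = m ^+ 2 -> `|p.[x] * e x| <= D * (4 * t) / m.
    move=> xm; apply: le_trans (pD x) _; rewrite xm -mulrA ler_wpM2l//.
    have m0 : 0 < m by exact: lt_le_trans m1.
    have t4 : 0 < 4 * t by rewrite mulr_gt0.
    rewrite expRN invf_ple ?posrE ?expR_gt0 ?divr_gt0//.
    rewrite invf_div; apply: le_trans (expR_ge1Dx _).
    apply: (@le_trans _ _ (m ^+ 2 / (4 * t))); last by rewrite lerDr.
    by rewrite ler_pM2r ?invr_gt0// expr2 ler_peMr// ltW.
  apply: le_trans (ler_normB _ _) _; rewrite mulrDl.
  by rewrite lerD// bnd// sqrrN.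
exact: (cvg_unique _ lim1 lim2).
Qed.

Lemma integral_normal (s : R) (G : R -> R) : measurable_fun setT G ->
  (\int[normal_prob 0 s]_a (G a)%:E = \int[mu]_a (normal_pdf 0 s a * G a)%:E)%E.
Proof.
move=> mG; have mGE : measurable_fun setT (EFin \o G) by exact/measurable_EFinP.
rewrite integralE [RHS]integralE.
rewrite !ge0_integral_normal//; last 2 first.
- exact: measurable_funeneg.
- exact: measurable_funepos.
congr (_ - _)%E; apply: eq_integral => a _; have p0 := normal_pdf_ge0 0 s a.
- rewrite !funeposE -!EFin_max -EFinM; congr EFin.
  by rewrite maxr_pMr// mulr0.
- rewrite !funenegE -!EFinN -!EFin_max -EFinM; congr EFin.
  by rewrite maxr_pMr// mulr0 mulrN.
Qed.

(** Integration by parts: t times the Gaussian density has derivative - a times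
    the density, so the integrand is a derivative. *)
Lemma normal_stein p :
  (\int[normal_prob 0 (Num.sqrt t)]_a (a * p.[a] - t * p^`().[a])%:E = 0)%E.
Proof.
have mG : measurable_fun setT (fun a : R => a * p.[a] - t * p^`().[a]).
  apply: measurable_funB; apply: measurable_funM => //; exact: measurable_poly.
rewrite integral_normal//.
transitivity (\int[mu]_a (- (t * normal_peak (Num.sqrt t)) * J p a)%:E)%E.
  apply: eq_integral => a _; congr EFin.
  rewrite normal_pdfE ?gt_eqF ?sqrtr_gt0// /normal_fun subr0 sqr_sqrtr ?ltW//.
  rewrite /J /q /e !(hornerD, hornerN, hornerZ, hornerM, hornerX).
  rewrite (_ : - a ^+ 2 / (t *+ 2) = - (a ^+ 2 / (2 * t))).
    by field; rewrite gt_eqF.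
  by field; rewrite gt_eqF.
under eq_integral do rewrite EFinM.
rewrite integralZl//; first by rewrite lebesgue_J mule0.
have [C C0 JC] := e_decay (q p).
apply: (le_integrable _ _ _ (integrable_gauss C)) => //.
  by apply/measurable_EFinP; exact: mJ.
by move=> a _; rewrite !abse_EFin lee_fin (le_trans (JC a))// ler_norm.
Qed.

End fixed_variance.
End stein1.

Section stein.
Context {R : realType} {I : finType}.
Implicit Types (c d : I -> R) (A : {set I}).

Lemma deriv_prod_affine c d A :
  (\prod_(i in A) ((c i)%:P + d i *: 'X))^`() =
  \sum_(j in A) d j *: \prod_(i in A :\ j) ((c i)%:P + d i *: 'X).
Proof.
have [m] := ubnP #|A|; elim: m A => // m IH A; rewrite ltnS => Am.
have [->|/set0Pn[j0 j0A]] := eqVneq A finset.set0.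
  by rewrite !big_set0 derivC.
rewrite (big_setD1 j0)//= derivM derivD derivC add0r derivZ derivX.
rewrite IH; last first.
  by move: Am; rewrite (cardsD1 j0 A) j0A.
rewrite [RHS](big_setD1 j0)//= -[d j0 *: 1]mul_polyC mulr1 mul_polyC; congr (_ + _).
rewrite big_distrr/=; apply: eq_bigr => j; rewrite in_setD1 => /andP[jj0 jA].
rewrite -scalerAr (big_setD1 j0 (A := A :\ j))/=; last first.
  by rewrite in_setD1 eq_sym jj0.
by rewrite finset.setDDl finset.setUC -finset.setDDl.
Qed.

(** Products of affine functions: h is one of them around every point, and this
    class is stable under derivation up to sums. *)
Definition aprod n c (al : I -> 'rV[R]_n) A (z : 'rV[R]_n) : R :=
  \prod_(i in A) (c i + dotv (al i) z).

Lemma tame_aprod n c (al : I -> 'rV[R]_n) A : tame (aprod c al A).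
Proof. by apply: tame_prod => i; exact: tame_affine. Qed.

(** The two sides of Stein's identity are gathered in one function of integral 0:
    integrating over one group of coordinates first, it is then enough that
    each inner integral vanishes. *)
Definition stein_defect n (t : R) c (al : I -> 'rV[R]_n) A (k : 'I_n)
    (z : 'rV[R]_n) : R :=
  z ord0 k * aprod c al A z -
  t * \sum_(j in A) al j ord0 k * aprod c al (A :\ j) z.

Lemma tame_stein_defect n t c (al : I -> 'rV[R]_n) A k :
  tame (stein_defect t c al A k).
Proof.
apply: tameB; first by apply: tameM; [exact: tame_coord|exact: tame_aprod].
by apply: tameZ; apply: tame_sum => j; apply: tameZ; exact: tame_aprod.
Qed.

Lemma stein n (t : R) c (al : I -> 'rV[R]_n) A (k : 'I_n) : 0 < t ->
  (\int[gauss n t]_z (stein_defect t c al A k z)%:E = 0)%E.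
Proof.
move=> t0; elim: n c al k => [|n IH] c al k; first by case: k.
pose al0 i := al i ord0 ord0; pose al' i := \row_j al i ord0 (lift ord0 j).
have alE i : al i = consv (al0 i, al' i) by exact: consvE.
have ti : (gauss n.+1 t).-integrable setT (EFin \o stein_defect t c al A k).
  exact/tame_integrable/tame_stein_defect.
have aE a v (B : {set I}) : aprod c al B (consv (a, v)) =
    \prod_(i in B) (c i + al0 i * a + dotv (al' i) v).
  by apply: eq_bigr => i _; rewrite {1}alE dotv_consv addrA.
rewrite (integral_gaussS ti).
case: (unliftP ord0 k) => [k'|] kE; last first.
  rewrite (Fubini (integrable_consv ti)) integral0_eq// => v _.
  pose p := \prod_(i in A) ((c i + dotv (al' i) v)%:P + al0 i *: 'X).
  have pE (B : {set I}) a : (\prod_(i in B) ((c i + dotv (al' i) v)%:P + al0 i *: 'X)).[a] =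
      aprod c al B (consv (a, v)).
    rewrite aE horner_prod; apply: eq_bigr => i _.
    by rewrite hornerD hornerC hornerZ hornerX addrAC.
  rewrite -[RHS](normal_stein t0 p); apply: eq_integral => a _ /=; congr EFin.
  rewrite /stein_defect kE mxE unlift_none/= /p deriv_prod_affine pE.
  congr (_ - _ * _); rewrite horner_sum; apply: eq_bigr => j _.
  by rewrite hornerZ pE.
rewrite integral0_eq// => a _.
rewrite -[RHS](IH (fun i => c i + al0 i * a) al' k').
apply: eq_integral => v _; congr EFin; rewrite /stein_defect kE mxE liftK/= aE.
congr (_ - _ * _); apply: eq_bigr => j _; rewrite aE.
by rewrite [in RHS]mxE.
Qed.

End stein.

Section moments.
Context {R : realType} {n : nat}.
Variables (t : R) (t0 : 0 < t).

Definition gmean (f : 'rV[R]_n -> R) : R := \int[gauss n t]_z f z.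

Lemma gmeanD f g : tame f -> tame g ->
  gmean (fun z => f z + g z) = gmean f + gmean g.
Proof. by move=> tf tg; apply: RintegralD => //; exact: tame_integrable. Qed.

Lemma gmeanZ (c : R) f : tame f -> gmean (fun z => c * f z) = c * gmean f.
Proof. by move=> tf; apply: RintegralZl => //; exact: tame_integrable. Qed.

Lemma gmean_sum (I : Type) (s : seq I) (P : pred I) (F : I -> 'rV[R]_n -> R) :
  (forall i, tame (F i)) ->
  gmean (fun z => \sum_(i <- s | P i) F i z) = \sum_(i <- s | P i) gmean (F i).
Proof.
move=> tF; elim: s => [|i s IH].
  rewrite big_nil /gmean; under eq_Rintegral do rewrite big_nil.
  by rewrite /Rintegral integral0.
rewrite big_cons -IH /gmean; under eq_Rintegral do rewrite big_cons.
by case: (P i) => //; rewrite -gmeanD//; exact: tame_sum.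
Qed.

Context {I : finType}.
Implicit Types (c d : I -> R) (al : I -> 'rV[R]_n) (A : {set I}).

Lemma gmean_stein c al A k : gmean (fun z => z ord0 k * aprod c al A z) =
  t * \sum_(j in A) al j ord0 k * gmean (aprod c al (A :\ j)).
Proof.
have tz : tame (fun z => z ord0 k * aprod c al A z).
  by apply: tameM; [exact: tame_coord|exact: tame_aprod].
have ta j : tame (fun z => al j ord0 k * aprod c al (A :\ j) z).
  by apply: tameZ; exact: tame_aprod.
have tts : tame (fun z => t * \sum_(j in A) al j ord0 k * aprod c al (A :\ j) z).
  by apply: tameZ; exact: tame_sum.
have : gmean (stein_defect t c al A k) = 0 by rewrite /gmean /Rintegral stein.
rewrite /gmean RintegralB//; [|exact: tame_integrable..].
move/eqP; rewrite subr_eq0 => /eqP ->.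
rewrite -/(gmean _) gmeanZ ?gmean_sum//; last exact: tame_sum.
by congr (_ * _); apply: eq_bigr => j _; rewrite gmeanZ//; exact: tame_aprod.
Qed.

(** Wick's recursion: the factor i contributes its constant term, or its
    direction is paired with that of another factor. *)
Lemma gmean_aprodS c al A i : i \in A -> gmean (aprod c al A) =
  c i * gmean (aprod c al (A :\ i)) +
  t * \sum_(j in A :\ i) dotv (al i) (al j) * gmean (aprod c al (A :\ i :\ j)).
Proof.
move=> iA.
have tzk k : tame (fun z => z ord0 k * aprod c al (A :\ i) z).
  by apply: tameM; [exact: tame_coord|exact: tame_aprod].
have -> : aprod c al A = fun z => c i * aprod c al (A :\ i) z +
    \sum_(k < n) al i ord0 k * (z ord0 k * aprod c al (A :\ i) z).
  apply/funext => z; rewrite /aprod (big_setD1 i)//= mulrDl; congr (_ + _).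
  by rewrite /dotv mulr_suml; apply: eq_bigr => k _; rewrite mulrA.
rewrite gmeanD; last 2 first.
- by apply: tameZ; exact: tame_aprod.
- by apply: tame_sum => k; exact: tameZ.
rewrite gmeanZ; last exact: tame_aprod.
congr (_ + _); rewrite gmean_sum; last by move=> k; exact: tameZ.
under eq_bigr do rewrite gmeanZ// gmean_stein mulrCA mulr_sumr.
rewrite -mulr_sumr exchange_big/=; congr (_ * _); apply: eq_bigr => j _.
by rewrite /dotv mulr_suml; apply: eq_bigr => k _; rewrite mulrA.
Qed.

Lemma gmean_aprod0 c al : gmean (aprod c al finset.set0) = 1.
Proof.
rewrite /gmean /Rintegral (eq_integral (cst 1%E)); last first.
  by move=> z _; rewrite /aprod big_set0.
by rewrite integral_cst// mul1e [X in fine X](_ : _ = 1%E)//; exact: probability_setT.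
Qed.

(** In the recursion gmean_aprodS the directions enter only through their inner
    products. *)
Lemma gmean_aprod_gram c al be A :
  (forall i j, dotv (al i) (al j) = dotv (be i) (be j)) ->
  gmean (aprod c al A) = gmean (aprod c be A).
Proof.
move=> gram; have [m] := ubnP #|A|; elim: m A => // m IH A; rewrite ltnS => Am.
have [->|/set0Pn[i iA]] := eqVneq A finset.set0; first by rewrite !gmean_aprod0.
have Ai : (#|A :\ i| < m)%N by move: Am; rewrite (cardsD1 i A) iA.
rewrite !(gmean_aprodS _ _ iA) IH//; congr (_ + _ * _).
apply: eq_bigr => j _; rewrite gram IH//.
exact: leq_ltn_trans (subset_leq_card (subsetDl _ _)) Ai.
Qed.

(** Only the term of the recursion gmean_aprodS without any pairing has degree
    #|A| in s: each pairing consumes two factors. *)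
Lemma gmean_aprod_line c d al A : exists Q : {poly R},
  (forall s, gmean (aprod (fun i => c i + d i * s) al A) = Q.[s]) /\
  (size (Q - \prod_(i in A) ((c i)%:P + d i *: 'X))%R <= #|A|)%N.
Proof.
have [m] := ubnP #|A|; elim: m A => // m IH A; rewrite ltnS => Am.
have [->|/set0Pn[i iA]] := eqVneq A finset.set0.
  exists 1; split=> [s|]; first by rewrite gmean_aprod0 hornerC.
  by rewrite big_set0 subrr size_poly0.
have cA : #|A| = #|A :\ i|.+1 by rewrite (cardsD1 i A) iA.
have Ai : (#|A :\ i| < m)%N by rewrite -ltnS -cA ltnS.
have [Q [QE Qs]] := IH _ Ai.
have Aij j : (#|A :\ i :\ j| < m)%N.
  exact: leq_ltn_trans (subset_leq_card (subsetDl _ _)) Ai.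
have H j := cid (IH _ (Aij j)).
pose q j := projT1 (H j).
have qE j s : gmean (aprod (fun i => c i + d i * s) al (A :\ i :\ j)) = (q j).[s].
  by have [] := projT2 (H j).
have sprod (B : {set I}) : (size (\prod_(i in B) ((c i)%:P + d i *: 'X))%R <= #|B|.+1)%N.
  rewrite -big_enum cardE.
  elim: (enum B) => [|b s IHs]; first by rewrite big_nil size_poly1.
  rewrite big_cons; apply: leq_trans (size_polyMleq _ _) _.
  have : (size ((c b)%:P + d b *: 'X)%R <= 2)%N.
    rewrite (leq_trans (size_polyD _ _))// geq_max (leq_trans (size_polyC_leq1 _))//.
    by rewrite (leq_trans (size_scale_leq _ _))// size_polyX.
  move: IHs => /=; lia.
have qs j : j \in A :\ i -> (size (q j) <= #|A :\ i|)%N.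
  move=> jA; have [_ sq] := projT2 (H j).
  rewrite -[q j](subrK (\prod_(k in A :\ i :\ j) ((c k)%:P + d k *: 'X))).
  rewrite (leq_trans (size_polyD _ _))// geq_max.
  have cj : #|A :\ i| = #|A :\ i :\ j|.+1 by rewrite (cardsD1 j (A :\ i)) jA.
  by rewrite cj sprod andbT (leq_trans sq).
exists (((c i)%:P + d i *: 'X) * Q + t *: \sum_(j in A :\ i) dotv (al i) (al j) *: q j).
split=> [s|].
  rewrite (gmean_aprodS _ _ iA) QE hornerD hornerM hornerD hornerC hornerZ hornerX.
  rewrite hornerZ horner_sum; congr (_ + _ * _).
  by apply: eq_bigr => j _; rewrite hornerZ qE.
rewrite (big_setD1 i iA)/= addrAC -mulrBr (leq_trans (size_polyD _ _))// geq_max.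
apply/andP; split.
  apply: leq_trans (size_polyMleq _ _) _.
  have : (size ((c i)%:P + d i *: 'X)%R <= 2)%N.
    rewrite (leq_trans (size_polyD _ _))// geq_max (leq_trans (size_polyC_leq1 _))//.
    by rewrite (leq_trans (size_scale_leq _ _))// size_polyX.
  by move=> h; rewrite cA -subn1 leq_subLR add1n; exact: leq_add h Qs.
rewrite (leq_trans (size_scale_leq _ _))// (leq_trans (size_sum _ _ _))//.
apply/bigmax_leqP => j jA; rewrite (leq_trans (size_scale_leq _ _))//.
by rewrite (leq_trans (qs _ jA))// cA.
Qed.

End moments.

(** * Root systems and the product of the roots *)

Section dotv_theory.
Context {R : realType} {n : nat}.
Implicit Types (x y z a b : 'rV[R]_n) (k : R).

Lemma dotvC x y : dotv x y = dotv y x.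
Proof. by apply: eq_bigr => i _; rewrite mulrC. Qed.

Lemma dotvDr x y z : dotv x (y + z) = dotv x y + dotv x z.
Proof. by rewrite -big_split/=; apply: eq_bigr => i _; rewrite mxE mulrDr. Qed.

Lemma dotvZr k x y : dotv x (k *: y) = k * dotv x y.
Proof. by rewrite mulr_sumr; apply: eq_bigr => i _; rewrite mxE mulrCA. Qed.

Lemma dotvNr x y : dotv x (- y) = - dotv x y.
Proof. by rewrite -scaleN1r dotvZr mulN1r. Qed.

Lemma dotvBr x y z : dotv x (y - z) = dotv x y - dotv x z.
Proof. by rewrite dotvDr dotvNr. Qed.

Lemma dotvZl k x y : dotv (k *: x) y = k * dotv x y.
Proof. by rewrite dotvC dotvZr dotvC. Qed.

Lemma dotvNl x y : dotv (- x) y = - dotv x y.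
Proof. by rewrite dotvC dotvNr dotvC. Qed.

Lemma dotvBl x y z : dotv (x - y) z = dotv x z - dotv y z.
Proof. by rewrite dotvC dotvBr !(dotvC z). Qed.

Lemma dotvv_eq0 x : (dotv x x == 0) = (x == 0).
Proof.
apply/idP/eqP => [|->]; last by rewrite /dotv big1// => i _; rewrite mxE mul0r.
rewrite psumr_eq0 => [/allP h|i _]; last by rewrite -expr2 sqr_ge0.
apply/rowP => i; rewrite mxE; apply/eqP; rewrite -sqrf_eq0 expr2.
by have := h i (mem_index_enum _).
Qed.

Lemma dotvv_gt0 x : x != 0 -> 0 < dotv x x.
Proof. by move=> x0; rewrite lt_def dotvv_eq0 x0 dotvv_ge0. Qed.

Lemma poly_nonroot (p : {poly R}) : p != 0 -> exists s : R, p.[s] != 0.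
Proof.
move=> p0; apply: contrapT => /forallNP h; move/negP: p0; apply.
pose rs : seq R := [seq i%:R | i <- iota 0 (size p)].
apply/eqP; apply: (@roots_geq_poly_eq0 _ p rs).
- apply/allP => x _; rewrite /root; apply/eqP; apply: contrapT => /eqP px.
  exact: (h x).
- by rewrite map_inj_uniq ?iota_uniq// => i j /eqP; rewrite eqr_nat => /eqP.
- by rewrite size_map size_iota.
Qed.

(** Finitely many hyperplanes do not cover R^n. From a z0 that avoids the first
    ones, move in the direction d: the product over the hyperplanes of the
    linear forms along this line is a nonzero polynomial. *)
Lemma generic_vector (D : seq 'rV[R]_n) : all (fun d => d != 0) D ->
  exists z, all (fun d => dotv d z != 0) D.
Proof.
elim: D => [|d D IH] /=; first by exists 0.
move=> /andP[d0 /IH[z0 /allP z0D]].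
pose p : {poly R} := \prod_(e <- d :: D) ((dotv e z0)%:P + dotv e d *: 'X).
have /poly_nonroot[s ps] : p != 0.
  rewrite prodf_seq_neq0; apply/allP => e; rewrite inE => /orP[/eqP ->|eD] /=.
    apply: contraNneq d0 => /(congr1 (fun q : {poly R} => q`_1)).
    rewrite coefD coefC/= add0r coefZ coefX/= mulr1 coef0 => /eqP.
    by rewrite dotvv_eq0.
  apply: contraNneq (z0D e eD) => /(congr1 (fun q : {poly R} => q`_0)).
  by rewrite coefD coefC/= coefZ coefX/= mulr0 addr0 coef0 => ->.
exists (z0 + s *: d); have pse e : e \in d :: D -> dotv e (z0 + s *: d) != 0.
  move: ps; rewrite /p horner_prod prodf_seq_neq0 => /allP/(_ e) h /h /=.
  by rewrite hornerD hornerC hornerZ hornerX dotvDr dotvZr mulrC.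
apply/andP; split; first by rewrite pse ?mem_head.
by apply/allP => e eD; rewrite pse// inE eD orbT.
Qed.

Section reflection.
Variables (a : 'rV[R]_n) (a0 : a != 0).

Lemma dotv_reflection x y : dotv (reflection a x) y = dotv x (reflection a y).
Proof.
rewrite /reflection dotvBl dotvBr dotvZl dotvZr (dotvC x a); ring.
Qed.

Lemma reflectionK x : reflection a (reflection a x) = x.
Proof.
have aa := dotvv_gt0 a0; rewrite {1}/reflection; set r := reflection a x.
have -> : dotv a r = - dotv a x.
  by rewrite /r /reflection dotvBr dotvZr; field; rewrite gt_eqF.
by rewrite /r /reflection mulrN mulNr scaleNr opprK subrK.
Qed.

Lemma dotv_reflection2 x y :
  dotv (reflection a x) (reflection a y) = dotv x y.
Proof. by rewrite dotv_reflection reflectionK. Qed.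

Lemma reflectionN x : reflection a (- x) = - reflection a x.
Proof.
by rewrite /reflection dotvNr mulrN mulNr scaleNr opprK opprB addrC.
Qed.

Lemma reflectionZ k x : reflection a (k *: x) = k *: reflection a x.
Proof.
rewrite /reflection dotvZr scalerBr scalerA; congr (_ - _ *: _); ring.
Qed.

Lemma reflection_id : reflection a a = - a.
Proof.
rewrite /reflection mulfK ?dotvv_eq0// scaler_nat mulr2n opprD addrA subrr sub0r//.
Qed.

Lemma reflection_orth x : dotv a x = 0 -> reflection a x = x.
Proof. by rewrite /reflection => ->; rewrite mulr0 mul0r scale0r subr0. Qed.

End reflection.
End dotv_theory.

Section roots.
Context {R : realType} {n : nat}.
Variables (Phi : {fset 'rV[R]_n}) (v : 'rV[R]_n).
Hypotheses (rsPhi : root_system Phi) (regv : regular Phi v).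
Implicit Types (a b x y z : 'rV[R]_n).

Local Notation Psi := (reduced_positive_roots Phi v).
Local Notation h := (root_product Phi v).

Lemma mem_positive a : (a \in positive_roots Phi v) = (a \in Phi) && (0 < dotv v a).
Proof. by rewrite !inE. Qed.

Lemma mem_reduced a :
  (a \in Psi) = [&& a \in Phi, 0 < dotv v a & 2^-1 *: a \notin Phi].
Proof. by rewrite !inE andbA. Qed.

Lemma root_opp a : a \in Phi -> - a \in Phi.
Proof.
move=> aP; rewrite -reflection_id ?(root_neq0 rsPhi)//.
exact: (root_reflection rsPhi).
Qed.

(** When b and b / 2 are roots, b / 4 is not: its Cartan integer with b would be
    1 / 2. *)
Lemma reduced_root_of b : b \in positive_roots Phi v ->
  exists2 a, a \in Psi & b = a \/ b = 2 *: a.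
Proof.
rewrite mem_positive => /andP[bP vb].
have [hb|nhb] := boolP (2^-1 *: b \in Phi); last first.
  by exists b; [rewrite mem_reduced bP vb|left].
have b0 := root_neq0 rsPhi bP.
exists (2^-1 *: b); last by right; rewrite scalerA divff ?scale1r// pnatr_eq0.
rewrite mem_reduced hb dotvZr mulr_gt0 ?invr_gt0//=.
apply/negP => qb; have := root_integral rsPhi bP qb.
rewrite !dotvZr mulrA mulrA mulfK ?dotvv_eq0// divff ?pnatr_eq0// mul1r.
move=> /intrP[z zE]; have : (z * 2)%:~R = 1 :> R.
  by rewrite intrM -zE mulVf// pnatr_eq0.
by move/eqP; rewrite -[1]/(1%:~R) eqr_int; lia.
Qed.

(** The Cartan integers 2 k and 2 / k of a and b have product 4, so k is 1 / 2,
    1 or 2; in the extreme cases one of the two roots is half the other, which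
    a reduced root excludes. *)
Lemma reduced_roots_prop a b k : a \in Psi -> b \in Psi -> b = k *: a -> b = a.
Proof.
rewrite !mem_reduced => /and3P[aP va ha] /and3P[bP vb hb] bE.
have k0 : 0 < k by move: vb; rewrite bE dotvZr pmulr_lgt0.
have aa := dotvv_gt0 (root_neq0 rsPhi aP).
have /intrP[z1 z1E] := root_integral rsPhi aP bP.
have /intrP[z2 z2E] := root_integral rsPhi bP aP.
have {}z1E : z1%:~R = 2 * k.
  by rewrite -z1E bE dotvZr; field; rewrite gt_eqF.
have {}z2E : z2%:~R = 2 / k.
  by rewrite -z2E bE !(dotvZr, dotvZl); field; rewrite !gt_eqF.
have z12 : (z1 * z2 = 4)%R.
  apply/eqP; rewrite -(eqr_int R) intrM z1E z2E; apply/eqP; field.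
  by rewrite gt_eqF.
have z10 : (0 < z1)%R by rewrite -(ltr0z R) z1E mulr_gt0.
have z20 : (0 < z2)%R by rewrite -(ltr0z R) z2E divr_gt0.
have : z1 = 1 \/ z1 = 2 \/ z1 = 4 by nia.
move=> [|[|]] zE; rewrite {}zE in z1E.
- have kE : k = 2^-1 by apply: (@mulfI _ 2); rewrite ?pnatr_eq0// -z1E divff ?pnatr_eq0.
  by move: ha; rewrite -kE -bE bP.
- have kE : k = 1 by apply: (@mulfI _ 2); rewrite ?pnatr_eq0// -z1E mulr1.
  by rewrite bE kE scale1r.
- have kE : k = 2 by apply: (@mulfI _ 2); rewrite ?pnatr_eq0// -z1E -natrM.
  by move: hb; rewrite bE kE scalerA mulVf ?pnatr_eq0// scale1r aP.
Qed.

(** The reflection in the root a permutes the lines spanned by the roots; read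
    on the reduced positive representatives it is the involution below. *)
Definition reflect_pos a b : 'rV[R]_n :=
  let r := reflection a b in if 0 < dotv v r then r else - r.

Lemma reflect_pos_reduced a b : a \in Phi -> b \in Psi -> reflect_pos a b \in Psi.
Proof.
move=> aP; rewrite mem_reduced => /and3P[bP vb hb].
have a0 := root_neq0 rsPhi aP; have rP := root_reflection rsPhi aP bP.
have hr : 2^-1 *: reflection a b \notin Phi.
  apply: contra hb => hr; rewrite -[b](reflectionK a0) -reflectionZ//.
  exact: (root_reflection rsPhi).
rewrite /reflect_pos; case: ifPn => vr; rewrite mem_reduced.
  by rewrite rP vr.
rewrite root_opp//= dotvNr oppr_gt0 lt_neqAle (regv rP) leNgt vr/=.
apply: contra hr => /root_opp.
by rewrite scalerN opprK.
Qed.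

Lemma reflect_posK a b : a \in Phi -> b \in Psi ->
  reflect_pos a (reflect_pos a b) = b.
Proof.
move=> aP; rewrite mem_reduced => /and3P[bP vb hb].
have a0 := root_neq0 rsPhi aP; rewrite /reflect_pos.
case: (ifPn (0 < dotv v (reflection a b))) => vr/=; first by rewrite reflectionK// vb.
by rewrite reflectionN/= reflectionK// dotvNr oppr_gt0 ltNge (ltW vb)/= opprK.
Qed.

Lemma reflect_pos_id a : a \in Psi -> reflect_pos a a = a.
Proof.
rewrite mem_reduced => /and3P[aP va ha].
rewrite /reflect_pos reflection_id ?(root_neq0 rsPhi)// dotvNr oppr_gt0.
by rewrite ltNge (ltW va)/= opprK.
Qed.

Let others a := [seq b <- Psi | b != a].

Let perm_others a : a \in Psi -> perm_eq (map (reflect_pos a) (others a)) (others a).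
Proof.
move=> aPsi; have aP : a \in Phi by move: aPsi; rewrite mem_reduced => /and3P[].
have uo : uniq (others a) by rewrite filter_uniq// fset_uniq.
have sub b : b \in others a -> reflect_pos a b \in others a.
  rewrite !mem_filter => /andP[ba bPsi]; rewrite reflect_pos_reduced// andbT.
  by apply: contra ba => /eqP rb; rewrite -[b](reflect_posK aP)// rb reflect_pos_id.
apply: uniq_perm => //.
  rewrite map_inj_in_uniq// => b c; rewrite !mem_filter => /andP[_ bP] /andP[_ cP] e.
  by rewrite -[b](reflect_posK aP)// e reflect_posK.
move=> b; apply/mapP/idP => [[c cP ->]|bo]; first exact: sub.
exists (reflect_pos a b); first exact: sub.
by rewrite reflect_posK//; move: bo; rewrite mem_filter => /andP[].
Qed.

Let root_product_split a x : a \in Psi ->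
  h x = dotv a x * \prod_(b <- others a) dotv b x.
Proof.
move=> aPsi; rewrite /root_product (bigD1_seq a)//= ?fset_uniq//.
by rewrite big_filter.
Qed.

Let sgnr a b : R := if 0 < dotv v (reflection a b) then 1 else -1.

Let others_reflection a x : a \in Psi ->
  \prod_(b <- others a) dotv b (reflection a x) =
  \prod_(b <- others a) sgnr a b * \prod_(b <- others a) dotv b x.
Proof.
move=> aPsi; rewrite -[X in _ = _ * X](perm_big _ (perm_others aPsi)) big_map.
rewrite -big_split/=; apply: eq_bigr => b _; rewrite -dotv_reflection.
by rewrite /sgnr /reflect_pos; case: ifP; rewrite ?mul1r// dotvNl mulN1r opprK.
Qed.

(** The reflection in a sends a to - a and permutes the other reduced roots up
    to signs. The product of these signs is 1: otherwise the product of the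
    other roots would change sign at the points of the hyperplane of a, which
    are fixed, whereas it is nonzero at some of them. *)
Lemma root_product_reflection a x : a \in Psi ->
  h (reflection a x) = - h x.
Proof.
move=> aPsi; have aP : a \in Phi by move: aPsi; rewrite mem_reduced => /and3P[].
have a0 := root_neq0 rsPhi aP; have aa := dotvv_gt0 a0.
suff sgn1 : \prod_(b <- others a) sgnr a b = 1.
  rewrite !(root_product_split _ aPsi) others_reflection// sgn1 mul1r.
  by rewrite -dotv_reflection reflection_id// dotvNl mulNr.
(* pr z, for z generic, lies on the hyperplane of a and on no other one *)
pose pr b := b - (dotv a b / dotv a a) *: a.
have [z /allP zP] : exists z, all (fun d => dotv d z != 0) (map pr (others a)).
  apply: generic_vector; apply/allP => _ /mapP[b + ->].
  rewrite mem_filter => /andP[ba bPsi]; rewrite subr_eq0.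
  by apply: contraNneq ba => bE; apply/eqP; exact: (reduced_roots_prop aPsi bPsi bE).
pose x0 := pr z.
have ax0 : dotv a x0 = 0.
  by rewrite /x0 /pr dotvBr dotvZr; field; rewrite gt_eqF.
have bx0 b : dotv b x0 = dotv (pr b) z.
  by rewrite /x0 /pr dotvBr dotvBl dotvZr dotvZl (dotvC b a); ring.
have := others_reflection x0 aPsi; rewrite (reflection_orth ax0).
set P := \prod_(b <- others a) dotv b x0.
have P0 : P != 0.
  rewrite /P prodf_seq_neq0; apply/allP => b bo /=; rewrite bx0.
  by apply: zP; apply: map_f.
by move=> e; apply: (mulIf P0); rewrite mul1r.
Qed.

Let roots := in_tuple (enum_fset Psi).
Let m := size (enum_fset Psi).
Let al (i : 'I_m) := tnth roots i.

Let hE x : h x = \prod_(i in [set: 'I_m]%SET) dotv (al i) x.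
Proof.
rewrite /root_product big_tnth; apply: eq_bigl => i.
by rewrite finset.in_setT.
Qed.

Let al_reduced i : al i \in Psi.
Proof. exact: mem_tnth. Qed.

Let hD y : (fun z => h (y + z)) = aprod (fun i => dotv (al i) y) al [set: 'I_m]%SET.
Proof.
by apply/funext => z; rewrite hE /aprod; apply: eq_bigr => i _; rewrite dotvDr.
Qed.

Lemma tame_root_productD y : tame (fun z => h (y + z)).
Proof. by rewrite hD; exact: tame_aprod. Qed.

Lemma tame_root_product : tame h.
Proof.
by have := tame_root_productD 0; under eq_fun do rewrite add0r.
Qed.

Lemma root_productZ k x : h (k *: x) = k ^+ #|` Psi| * h x.
Proof.
rewrite /root_product; under eq_bigr do rewrite dotvZr.
by rewrite big_split/= big_const_seq count_predT -Monoid.iteropE.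
Qed.

Lemma root_product_gt0 x : chamber Phi v x -> 0 < h x.
Proof.
move=> Cx; rewrite /root_product big_seq; apply: prodr_gt0 => a.
rewrite mem_reduced => /and3P[aP va _]; apply: Cx.
by rewrite mem_positive aP.
Qed.

Lemma root_product_boundary a x : a \in positive_roots Phi v -> dotv a x = 0 ->
  h x = 0.
Proof.
move=> /reduced_root_of[b bPsi ab] ax; have bx : dotv b x = 0.
  case: ab ax => [->//|->]; rewrite dotvZl => /eqP.
  by rewrite mulf_eq0 pnatr_eq0/= => /eqP.
by rewrite (root_product_split _ bPsi) bx mul0r.
Qed.

Variables (t : R) (t0 : 0 < t).

(* The means are unchanged when all directions are reflected in a, which fixes
   y, and h changes sign: the mean is its own opposite. *)
Let gmean_boundary a y : a \in Psi -> dotv a y = 0 ->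
  gmean t (fun z => h (y + z)) = 0.
Proof.
move=> aPsi ay; have aP : a \in Phi by move: aPsi; rewrite mem_reduced => /and3P[].
have a0 := root_neq0 rsPhi aP.
suff : gmean t (fun z => h (y + z)) = - gmean t (fun z => h (y + z)) by lra.
rewrite {1}hD (@gmean_aprod_gram _ _ _ t0 _ _ _ (fun i => reflection a (al i))).
  rewrite -mulN1r -gmeanZ//; last exact: tame_root_productD.
  congr gmean; apply/funext => z; rewrite mulN1r -(root_product_reflection _ aPsi) hE.
  apply: eq_bigr => i _; rewrite -dotv_reflection dotvDr; congr (_ + _).
  by rewrite dotv_reflection reflection_orth.
by move=> i j; rewrite dotv_reflection2.
Qed.

(** Mean value property of h: the Gaussian average of h around y is a
    polynomial in y with the same leading part as h and, by antisymmetry, with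
    the same zeros, so on a generic line through y both have the same leading
    coefficient and the same m roots. *)
Lemma gmean_root_product y : gmean t (fun z => h (y + z)) = h y.
Proof.
have [[i yi]|ny] := pselect (exists i, dotv (al i) y = 0).
  rewrite (gmean_boundary (al_reduced i) yi) hE.
  by rewrite (bigD1 i)/= ?finset.in_setT// yi mul0r.
have {}ny i : dotv (al i) y != 0.
  by apply/eqP => yi; apply: ny; exists i.
pose D := [seq al i | i <- enum 'I_m] ++
  [seq dotv (al p.1) y *: al p.2 - dotv (al p.2) y *: al p.1 |
    p <- [seq p <- enum {: 'I_m * 'I_m} | p.1 != p.2]].
have [z /allP zD] : exists z, all (fun d => dotv d z != 0) D.
  apply: generic_vector; rewrite all_cat; apply/andP; split.
    apply/allP => _ /mapP[i _ ->]; have := al_reduced i.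
    by rewrite mem_reduced => /and3P[iP _ _]; exact: (root_neq0 rsPhi).
  apply/allP => _ /mapP[[i j] + ->]; rewrite mem_filter/= => /andP[ij _].
  rewrite subr_eq0; apply: contraNneq ij => e.
  have : al j = (dotv (al j) y / dotv (al i) y) *: al i.
    apply: (scalerI (ny i)); rewrite e scalerA; congr (_ *: _).
    by rewrite mulrC divfK.
  move=> /(reduced_roots_prop (al_reduced i) (al_reduced j)) aji.
  have : uniq (enum_fset Psi) by exact: fset_uniq.
  rewrite -[enum_fset Psi]/(val roots) => /tuple_uniqP inj.
  by apply/eqP/inj; rewrite -/(al i) -/(al j) aji.
pose c i := dotv (al i) y; pose d i := dotv (al i) z.
have d0 i : d i != 0.
  by apply: zD; rewrite mem_cat; apply/orP; left; apply: map_f; rewrite mem_enum.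
have [Q [QE Qs]] := @gmean_aprod_line _ _ _ t0 _ c d al [set: 'I_m]%SET.
have QE' s : Q.[s] = gmean t (fun w => h ((y + s *: z) + w)).
  rewrite -QE hD; congr gmean; congr aprod.
  by apply/funext => i; rewrite dotvDr dotvZr mulrC.
pose P := \prod_(i in [set: 'I_m]%SET) ((c i)%:P + d i *: 'X).
have PE s : P.[s] = h (y + s *: z).
  rewrite /P horner_prod hE; apply: eq_bigr => i _.
  by rewrite hornerD hornerC hornerZ hornerX dotvDr dotvZr mulrC.
pose rs := [seq - (c i / d i) | i <- enum 'I_m].
have QP : Q - P = 0.
  apply: (@roots_geq_poly_eq0 _ _ rs).
  - apply/allP => _ /mapP[i _ ->]; rewrite /root hornerD hornerN QE' PE.
    have yz : dotv (al i) (y + - (c i / d i) *: z) = 0.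
      by rewrite dotvDr dotvZr mulNr -/(d i) divfK// subrr.
    rewrite (gmean_boundary (al_reduced i) yz) hE (bigD1 i)/= ?finset.in_setT//.
    by rewrite yz mul0r subr0.
  - rewrite map_inj_in_uniq ?enum_uniq// => i j _ _ /oppr_inj e.
    apply/eqP; apply: contraT => ij.
    have /zD : dotv (al i) y *: al j - dotv (al j) y *: al i \in D.
      rewrite mem_cat; apply/orP; right; apply/mapP; exists (i, j) => //.
      by rewrite mem_filter/= ij mem_enum.
    rewrite dotvBl !dotvZl -/(c i) -/(c j) -/(d i) -/(d j).
    have -> : c i = c j / d j * d i by rewrite -e divfK.
    suff -> : c j / d j * d i * d j - c j * d i = 0 by rewrite eqxx.
    by field; exact: d0.
  - by rewrite size_map size_enum_ord; move: Qs; rewrite cardsT card_ord.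
have := QE' 0; rewrite scale0r addr0 => <-.
have := PE 0; rewrite scale0r addr0 => <-.
by move/eqP: QP; rewrite subr_eq0 => /eqP ->.
Qed.

End roots.

(** * Heat flow of the product of the roots *)

Section heat.
Context {R : realType} {n : nat}.
Implicit Types (x z : 'rV[R]_n).

Lemma gmean_tilt (t l : R) (f : 'rV[R]_n -> R) x : 0 < t -> 0 < 1 + l * t ->
  let a := (1 + l * t)^-1 in
  measurable_fun setT f -> tame (fun z => f (a *: x + z)) ->
  gmean t (fun z => f (x + z) * gweight l (x + z)) =
  Num.sqrt a ^+ n * gweight (a * l) x * gmean (a * t) (fun z => f (a *: x + z)).
Proof.
move=> t0 lt0 a mf tf; have a0 : 0 < a by rewrite invr_gt0.
have at0 : 0 < a * t by rewrite mulr_gt0.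
have fi := tame_integrable at0 tf.
have mfE : measurable_fun setT (EFin \o f) by exact/measurable_EFinP.
rewrite /gmean /Rintegral integralE.
have -> : (fun z => (f (x + z) * gweight l (x + z))%:E)^\+%E =
    (fun z => (EFin \o f)^\+%E (x + z)%R * (gweight l (x + z)%R)%:E)%E.
  apply/funext => z; rewrite !funeposE/= -!EFin_max -EFinM; congr EFin.
  by rewrite maxr_pMl ?mul0r// ltW// gweight_gt0.
have -> : (fun z => (f (x + z) * gweight l (x + z))%:E)^\-%E =
    (fun z => (EFin \o f)^\-%E (x + z)%R * (gweight l (x + z)%R)%:E)%E.
  apply/funext => z; rewrite !funenegE/= -!EFin_max -EFinM; congr EFin.
  by rewrite maxr_pMl ?mul0r ?mulNr// ltW// gweight_gt0.
rewrite !gauss_tilt//; last 2 first.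
- exact: measurable_funeneg.
- exact: measurable_funepos.
have pE : (fun z => (EFin \o f)^\+ (a *: x + z)%R)%E = (EFin \o (fun z => f (a *: x + z)%R))^\+%E.
  by apply/funext => z; rewrite !funeposE.
have nE : (fun z => (EFin \o f)^\- (a *: x + z)%R)%E = (EFin \o (fun z => f (a *: x + z)%R))^\-%E.
  by apply/funext => z; rewrite !funenegE.
rewrite -/a pE nE -muleBr//; last first.
  by rewrite fin_num_adde_defr// integrable_pos_fin_num.
by rewrite -integralE fineM// integrable_fin_num.
Qed.

Variables (Phi : {fset 'rV[R]_n}) (v : 'rV[R]_n).
Hypotheses (rsPhi : root_system Phi) (regv : regular Phi v).
Local Notation h := (root_product Phi v).
Local Notation m := #|` reduced_positive_roots Phi v|.

(** The source of the dimension n + 2 m: the tilt contributes (sqrt a)^n, and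
    the homogeneity of h at the new centre a x contributes
    a^m = (sqrt a)^(2 m). *)
Lemma gmean_root_product_gweight (t l : R) x : 0 < t -> 0 <= l ->
  let a := (1 + l * t)^-1 in
  gmean t (fun z => h (x + z) * gweight l (x + z)) =
  Num.sqrt a ^+ (n + 2 * m) * (h x * gweight (a * l) x).
Proof.
move=> t0 l0 a; have lt0 : 0 < 1 + l * t by rewrite ltr_wpDr// mulr_ge0// ltW.
have a0 : 0 < a by rewrite invr_gt0.
rewrite gmean_tilt//; last 2 first.
- by have [] := tame_root_product Phi v.
- exact: tame_root_productD.
rewrite -/a gmean_root_product// ?mulr_gt0// root_productZ.
rewrite exprD exprM.
rewrite sqr_sqrtr; last exact: ltW.
set p := a ^+ _; set q := h x; set g := gweight _ x; set r := _ ^+ n.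
by rewrite -!mulrA; congr (_ * _); rewrite mulrC mulrA.
Qed.

Lemma integral_gauss_gweight (t l : R) x : 0 < t -> 0 <= l ->
  let a := (1 + l * t)^-1 in
  (\int[gauss n t]_z (gweight l (x + z)%R)%:E =
   (Num.sqrt a ^+ n * gweight (a * l) x)%R%:E)%E.
Proof.
move=> t0 l0 a; have lt0 : 0 < 1 + l * t by rewrite ltr_wpDr// mulr_ge0// ltW.
have := @gauss_tilt R n t l t0 lt0 x (cst 1%E) (measurable_cst _) (fun=> lee01).
rewrite (_ : (\int[gauss n t]_z _ = \int[gauss n t]_z (gweight l (x + z)%R)%:E)%E).
  move=> ->; rewrite [X in (_ * X)%E](_ : _ = 1%E) ?mule1//.
  by rewrite integral_cst// mul1e; exact: probability_setT.
by apply: eq_integral => z _; rewrite /= mul1e.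
Qed.

End heat.

(** * Markov property of Brownian motion *)

Lemma past_measurable (R : realType) n d (T : measurableType d)
    (Z : R -> T -> 'rV[R]_n) :
  (forall t, 0 <= t -> measurable_fun setT (Z t)) ->
  forall s E, past Z s E -> measurable E.
Proof.
move=> mZ s; apply: smallest_sub; first exact: sigma_algebra_measurable.
move=> _ [u [A [/andP[u0 _] mA ->]]].
by rewrite -[X in measurable X]setTI; exact: mZ.
Qed.

Section markov.
Context {R : realType} {n : nat} d (T : measurableType d) (P : probability T R).
Local Open Scope ereal_scope.

(** Dynkin's pi-lambda theorem: both sides are finite measures in E. *)
Lemma indep_extend (G : set (set T)) (q : R) (F : set T) :
  G `<=` measurable -> G setT -> setI_closed G -> (0 <= q)%R -> measurable F ->
  (forall E, G E -> P (E `&` F) = P E * q%:E) ->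
  forall E, <<s G >> E -> P (E `&` F) = P E * q%:E.
Proof.
move=> Gm GT GI q0 mF H E sE.
pose m2 := mscale (NngNum q0) P.
have m2E A : m2 A = P A * q%:E by rewrite /m2 /mscale/= muleC.
rewrite -m2E; apply: (g_sigma_algebra_measure_unique G Gm (fun=> setT) _ _
    (mrestr P mF) m2) => //.
- by apply/seteqP; split => // x _; exists 0%N.
- by move=> A GA; rewrite [RHS]m2E /=/mrestr; exact: H.
- move=> _; rewrite /= /mrestr setTI.
  by rewrite -ge0_fin_numE// fin_num_measure.
Qed.

Variables (x0 : 'rV[R]_n) (B : R -> T -> 'rV[R]_n).
Hypothesis BB : brownian P x0 B.

Let mB t : (0 <= t)%R -> measurable_fun setT (B t).
Proof. by have [mB _ _ _] := BB; exact: mB. Qed.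

Let mBA t A : (0 <= t)%R -> measurable A -> measurable (B t @^-1` A).
Proof. by move=> t0 mA; rewrite -[X in measurable X]setTI; exact: mB. Qed.

Section increment.
Variables (s t : R) (s0 : (0 <= s)%R) (st : (s < t)%R).

Let D w := (B t w - B s w)%R.

Let mD : measurable_fun setT D.
Proof.
apply/measurable_fun_rVP => i; under eq_fun do rewrite !mxE.
apply: measurable_funB; apply: (measurableT_comp (measurable_coord i)).
  by apply: mB; rewrite (le_trans s0)// ltW.
exact: mB.
Qed.

Let mDC C : measurable C -> measurable (D @^-1` C).
Proof. by move=> mC; rewrite -[X in measurable X]setTI; exact: mD. Qed.

(* The independence of increments is given on grids of times only; the grid
   starts at time 0, has s as its last time but one and t as its last time. *)
Section grid.
Variables (k : nat) (tau : nat -> R).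
Hypotheses (tau0 : tau 0%N = 0%R) (tauk : tau k = s) (tauS : tau k.+1 = t).
Hypothesis tau_lt : forall i, (i < k.+1)%N -> (tau i < tau i.+1)%R.

Let inc i w := (B (tau i.+1) w - B (tau i) w)%R.

Let tau_ge0 i : (i <= k.+1)%N -> (0 <= tau i)%R.
Proof.
elim: i => [|i IH] ik; first by rewrite tau0.
by rewrite (le_trans (IH (ltnW ik)))// ltW// tau_lt.
Qed.

Let minc i j : (i < k.+1)%N -> measurable_fun setT (fun w => inc i w ord0 j).
Proof.
move=> ik; under eq_fun do rewrite !mxE.
by apply: measurable_funB; apply: (measurableT_comp (measurable_coord j)); apply: mB;
  apply: tau_ge0 => //; exact: ltnW.
Qed.

Let rects : set (set T) := [set E | exists2 A : 'I_k -> 'I_n -> set R,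
  (forall i j, measurable (A i j)) & E = [set w | forall i j, A i j (inc i w ord0 j)]].

Let rects_measurable : rects `<=` measurable.
Proof.
move=> _ [A mA ->].
rewrite (_ : [set _ | _] = \bigcap_(p in [set: 'I_k * 'I_n])
    (fun w => inc p.1 w ord0 p.2) @^-1` A p.1 p.2); last first.
  apply/seteqP; split => w /= H; first by move=> p _; exact: H.
  by move=> i j; exact: (H (i, j)).
apply: fin_bigcap_measurable => // -[i j] _ /=.
rewrite -[X in measurable X]setTI; apply: minc => //.
by rewrite ltnS ltnW.
Qed.

Let rectsT : rects setT.
Proof. by exists (fun _ _ => setT) => //; apply/seteqP; split. Qed.

Let rectsI : setI_closed rects.
Proof.
move=> _ _ [A mA ->] [A' mA' ->]; exists (fun i j => A i j `&` A' i j).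
  by move=> i j; exact: measurableI.
by apply/seteqP; split => w /=; [move=> [H H'] i j; split|
  move=> H; split => i j; have [] := H i j].
Qed.

Let rects_box E (C : 'I_n -> set R) : rects E -> (forall j, measurable (C j)) ->
  P (E `&` D @^-1` [set x : 'rV[R]_n | forall j, C j (x ord0 j)]) =
  P E * gauss n (t - s) [set x : 'rV[R]_n | forall j, C j (x ord0 j)].
Proof.
move=> [A mA ->] mC.
pose A' (C : 'I_n -> set R) (i : 'I_k.+1) : 'I_n -> set R :=
  if insub (i : nat) is Some i' then A i' else C.
have A'w C0 (i : 'I_k) : A' C0 (widen_ord (leqnSn k) i) = A i.
  rewrite /A'; case: insubP => [i' _ e|]; first by congr A; exact: val_inj.
  by rewrite /= ltn_ord.
have A'm C0 : A' C0 ord_max = C0 by rewrite /A' insubF//= ltnn.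
have mA' C0 : (forall j, measurable (C0 j)) -> forall i j, measurable (A' C0 i j).
  by move=> mC0 i j; rewrite /A'; case: insubP.
have key C0 : (forall j, measurable (C0 j)) ->
    P [set w | (forall (i : 'I_k) j, A i j (inc i w ord0 j)) /\ forall j, C0 j (D w ord0 j)] =
    \prod_(i < k) \prod_(j < n)
       normal_prob 0 (Num.sqrt (tau i.+1 - tau i)) (A i j) *
    \prod_(j < n) normal_prob 0 (Num.sqrt (t - s)) (C0 j).
  move=> mC0; have [_ _ _ /(_ k.+1 tau (A' C0))] := BB.
  rewrite tau0 => /(_ (lexx _) tau_lt (mA' _ mC0)).
  rewrite big_ord_recr/= A'm tauk tauS.
  under eq_bigr do rewrite A'w/=.
  move=> <-; congr (P _); apply/seteqP; split => w /=.
    move=> [H1 H2] i j; have [ik|ki] := ltnP i k.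
      have -> : i = widen_ord (leqnSn k) (Ordinal ik) by exact: val_inj.
      by rewrite A'w; exact: H1.
    have -> : i = ord_max by apply: val_inj; apply/eqP; rewrite eqn_leq ki -ltnS ltn_ord.
    by rewrite A'm/= tauk tauS; exact: H2.
  move=> H; split => [i j|j].
    by have := H (widen_ord (leqnSn k) i) j; rewrite A'w.
  by have := H ord_max j; rewrite A'm/= tauk tauS.
have -> : P [set w | forall i j, A i j (inc i w ord0 j)] =
    \prod_(i < k) \prod_(j < n) normal_prob 0 (Num.sqrt (tau i.+1 - tau i)) (A i j).
  have := key (fun=> setT) (fun=> measurableT).
  rewrite [X in _ * X]big1 ?mule1; last by move=> j _; exact: probability_setT.
  by move=> <-; congr (P _); apply/seteqP; split => w /=; [move=> H; split|case].
by rewrite gauss_box// -key.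
Qed.

Let rects_indep E C : <<s rects >> E -> measurable C ->
  P (E `&` D @^-1` C) = P E * gauss n (t - s) C.
Proof.
move=> sE; have mE : measurable E.
  move: sE; apply: smallest_sub; first exact: sigma_algebra_measurable.
  exact: rects_measurable.
have PEq : (0 <= fine (P E))%R by rewrite fine_ge0.
pose m1 := pushforward (mrestr P mE) D.
pose m2 := mscale (NngNum PEq) (gauss n (t - s)).
have m1E A : m1 A = P (E `&` D @^-1` A) by rewrite /m1/= /pushforward/= /mrestr setIC.
have m2E A : m2 A = P E * gauss n (t - s) A.
  by rewrite /m2 /mscale/= fineK ?fin_num_measure.
move=> mC; rewrite -m1E -m2E; apply: boxes_unique => //.
- rewrite [ltLHS]m1E preimage_setT setIT.
  by rewrite -ge0_fin_numE// fin_num_measure.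
- move=> _ [A mA ->]; rewrite [LHS]m1E [RHS]m2E.
  have mbox := measurable_box mA.
  have := fin_num_measure (gauss n (t - s)) _ mbox => /fineK <-.
  apply: (@indep_extend rects) => //.
  + by rewrite fine_ge0.
  + exact: mDC.
  + by move=> E' rE'; rewrite fineK ?fin_num_measure//; exact: rects_box.
Qed.

Let rects_B i : (i <= k)%N ->
  measurable_fun [set: g_sigma_algebraType rects]
    (B (tau i) : g_sigma_algebraType rects -> 'rV[R]_n).
Proof.
elim: i => [|i IH] ik.
  have [_ _ B0 _] := BB.
  rewrite tau0 (_ : B 0%R = fun=> x0); first exact: measurable_cst.
  by apply/funext => w; exact: B0.
have incE w : B (tau i.+1) w = (B (tau i) w + inc i w)%R.
  by rewrite /inc addrC subrK.
apply/measurable_fun_rVP => j; under eq_fun do rewrite incE mxE.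
apply: measurable_funD.
  exact: (measurableT_comp (measurable_coord j) (IH (ltnW ik))).
move=> _ Y mY; rewrite setTI; apply: sub_sigma_algebra.
exists (fun i' j' => if (i' == Ordinal ik) && (j' == j) then Y else setT).
  by move=> i' j'; case: ifP.
apply/seteqP; split => w /=.
  by move=> Yw i' j'; case: ifPn => // /andP[/eqP -> /eqP ->].
by move=> /(_ (Ordinal ik) j); rewrite !eqxx.
Qed.

(** The positions at the times of the grid are sums of increments, so they are
    measurable for the sigma-algebra generated by the rectangles of
    increments. *)
Lemma grid_indep E C : measurable C ->
  <<s [set E | exists i A, [/\ (i <= k)%N, measurable A & E = B (tau i) @^-1` A]] >> E ->
  P (E `&` D @^-1` C) = P E * gauss n (t - s) C.
Proof.
move=> mC sE; apply: rects_indep => //.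
move: sE; apply: smallest_sub; first exact: smallest_sigma_algebra.
move=> _ [i [A [ik mA ->]]].
by have := rects_B ik measurableT mA; rewrite setTI.
Qed.

End grid.

Let times (U : seq R) : set (set T) :=
  <<s [set E | exists u A, [/\ u \in U, measurable A & E = B u @^-1` A]] >>.

(* Finitely many times in [0, s], together with 0 and s, form a grid once they
   are sorted. *)
Let times_indep U E C : (forall u, u \in U -> (0 <= u <= s)%R) ->
  times U E -> measurable C -> P (E `&` D @^-1` C) = P E * gauss n (t - s) C.
Proof.
move=> U0s tE mC.
pose L' := sort <=%R (undup [seq u <- s :: U | (0 < u)%R]).
pose L := 0%R :: L'.
have mem_L u : (u \in L) = (u == 0%R) || (0 < u)%R && (u \in s :: U).
  by rewrite in_cons mem_sort mem_undup mem_filter.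
have L_le u : u \in L -> (0 <= u <= s)%R.
  rewrite mem_L => /orP[/eqP ->|/andP[u0]]; first by rewrite lexx.
  by rewrite inE => /orP[/eqP ->|/U0s//]; rewrite lexx s0.
have UL u : u \in U -> u \in L.
  move=> uU; rewrite mem_L inE uU orbT andbT.
  by have /andP[u0 _] := U0s _ uU; move: u0; rewrite le_eqVlt eq_sym.
have sL : s \in L by rewrite mem_L mem_head andbT -[_ == _]eq_sym -le_eqVlt.
have sortL : path <%R 0%R (rcons L' t).
  rewrite rcons_path; apply/andP; split.
    rewrite path_sortedE; last exact: lt_trans.
    rewrite sort_lt_sorted undup_uniq andbT; apply/allP => u.
    by rewrite mem_sort mem_undup mem_filter => /andP[].
  set l := last _ _; have : l \in L by exact: mem_last.
  by move=> /L_le/andP[_ ls]; exact: le_lt_trans st.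
pose k := (size L).-1; pose tau i := nth t L i.
have tau_lt i : (i < k.+1)%N -> (tau i < tau i.+1)%R.
  move=> ik; have nthL j : nth t (rcons L t) j = tau j.
    rewrite nth_rcons /tau; case: ltnP => // Lj; rewrite nth_default//.
    by case: ifP.
  have /(pathP t)/(_ i) := sortL; rewrite size_rcons => /(_ ik).
  by rewrite -(nthL i) -(nthL i.+1).
have szL : size L = k.+1 by [].
have tauk : tau k = s.
  have iL : (index s L <= k)%N by rewrite -ltnS -szL index_mem.
  have -> : k = index s L; last exact: nth_index.
  apply/eqP; rewrite eqn_leq iL andbT leqNgt; apply/negP => ik.
  have := tau_lt (index s L); rewrite /tau (nth_index t sL) => /(_ (leqW ik)).
  have /L_le/andP[_] : nth t L (index s L).+1 \in L by apply: mem_nth; rewrite szL ltnS.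
  by rewrite leNgt => /negbTE ->.
have tauS : tau k.+1 = t by rewrite /tau nth_default//.
apply: (@grid_indep k tau) => //.
move: tE; apply: smallest_sub; first exact: smallest_sigma_algebra.
move=> _ [u [A [uU mA ->]]]; apply: sub_sigma_algebra.
exists (index u L), A; split => //.
  by rewrite -ltnS -szL index_mem UL.
by rewrite /tau nth_index// UL.
Qed.

(** The events that depend on finitely many times are a pi-system generating the
    past. *)
Lemma past_indep E C : past B s E -> measurable C ->
  P (E `&` D @^-1` C) = P E * gauss n (t - s) C.
Proof.
move=> pE mC.
pose G : set (set T) := [set E | exists2 U : seq R,
  (forall u, u \in U -> (0 <= u <= s)%R) & times U E].
have timesS U V : {subset U <= V} -> times U `<=` times V.
  move=> UV; apply: smallest_sub; first exact: smallest_sigma_algebra.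
  move=> _ [u [A [uU mA ->]]]; apply: sub_sigma_algebra.
  by exists u, A; split => //; exact: UV.
rewrite -(fineK (fin_num_measure (gauss n (t - s)) _ mC)).
apply: (@indep_extend G) => //.
- move=> E' [U U0s]; apply: smallest_sub; first exact: sigma_algebra_measurable.
  by move=> _ [u [A [/U0s/andP[u0 _] mA ->]]]; exact: mBA.
- exists [::] => //; exact: (@measurableT _ (g_sigma_algebraType _)).
- move=> E1 E2 [U U0s tU] [V V0s tV]; exists (U ++ V).
    by move=> u; rewrite mem_cat => /orP[/U0s|/V0s].
  apply: (@measurableI _ (g_sigma_algebraType
    [set E | exists u A, [/\ u \in U ++ V, measurable A & E = B u @^-1` A]])).
    by apply: (timesS U) tU => u uU; rewrite mem_cat uU.
  by apply: (timesS V) tV => u uV; rewrite mem_cat uV orbT.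
- by rewrite fine_ge0.
- exact: mDC.
- move=> E' [U U0s tU]; rewrite fineK ?fin_num_measure//.
  exact: times_indep tU mC.
- move: pE; apply: smallest_sub; first exact: smallest_sigma_algebra.
  move=> _ [u [A [u0s mA ->]]]; apply: sub_sigma_algebra.
  exists [:: u]; first by move=> u'; rewrite inE => /eqP ->.
  by apply: sub_sigma_algebra; exists u, A; split => //; rewrite mem_head.
Qed.

(** The independence of the past and of the increment turns into a product
    measure, to which Tonelli's theorem applies. *)
Lemma brownian_markov E (F : 'rV[R]_n -> \bar R) : past B s E ->
  measurable_fun setT F -> (forall x, 0 <= F x) ->
  \int[P]_(w in E) F (B t w) =
  \int[P]_(w in E) \int[gauss n (t - s)]_z F (B s w + z)%R.
Proof.
move=> pE mF F0; have mE := past_measurable mB pE.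
have t0 : (0 <= t)%R by rewrite (le_trans s0)// ltW.
pose ga := gauss n (t - s).
pose J (p : T * 'rV[R]_n) := (B s p.1 + p.2)%R.
have mJ : measurable_fun setT J.
  apply/measurable_fun_rVP => i; under eq_fun do rewrite mxE.
  apply: measurable_funD.
    apply: (measurableT_comp (measurable_coord i)).
    by apply: (measurableT_comp (mB s0)); exact: measurable_fst.
  exact: (measurableT_comp (measurable_coord i) measurable_snd).
(* On E, the position at time s and the increment have the product law, which
   is carried by the product of the probability space with R^n. *)
pose K w := (B s w, D w).
have mK : measurable_fun setT K.
  by apply/measurable_fun_pairP; split; [exact: mB|exact: mD].
pose H (p : T * 'rV[R]_n) := (B s p.1, p.2).
have mH : measurable_fun setT H.
  apply/measurable_fun_pairP; split; last exact: measurable_snd.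
  by apply: (measurableT_comp (mB s0)); exact: measurable_fst.
have mET : measurable (E `*` [set: 'rV[R]_n]) by exact: measurableX.
have joint X : measurable X -> P (E `&` K @^-1` X) =
    (P \x ga) ((E `*` setT) `&` H @^-1` X).
  move=> mX.
  pose m1 := pushforward (mrestr P mE) K.
  pose m2 := pushforward (mrestr (P \x ga) mET) H.
  have m1E A : m1 A = P (E `&` K @^-1` A).
    by rewrite /m1/= /pushforward/= /mrestr setIC.
  have m2E A : m2 A = (P \x ga) ((E `*` setT) `&` H @^-1` A).
    by rewrite /m2/= /pushforward/= /mrestr setIC.
  rewrite -m1E -m2E.
  apply: (measure_unique [set A1 `*` A2 | A1 in measurable & A2 in measurable]
    (fun=> setT)) => //.
  - exact: measurable_prod_measurableType.
  - move=> _ _ [A1 mA1 [A2 mA2 <-]] [A1' mA1' [A2' mA2' <-]].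
    exists (A1 `&` A1'); first exact: measurableI.
    exists (A2 `&` A2'); first exact: measurableI.
    by rewrite setXI.
  - by move=> _; exists setT => //; exists setT => //; rewrite setXTT.
  - by apply/seteqP; split => // x _; exists 0%N.
  - move=> _ [A1 mA1 [A2 mA2 <-]]; rewrite [LHS]m1E [RHS]m2E.
    have -> : (E `*` setT) `&` H @^-1` (A1 `*` A2) = (E `&` B s @^-1` A1) `*` A2.
      by apply/seteqP; split => -[w z] /=; rewrite /H/=; tauto.
    rewrite product_measure1E//; last by apply: measurableI => //; exact: mBA.
    rewrite -past_indep//; first by rewrite -setIA.
    apply: (@measurableI _ (g_sigma_algebraType _)); first exact: pE.
    apply: sub_sigma_algebra; exists s, A1; split => //.
    by rewrite s0 lexx.
  - move=> _; rewrite [ltLHS]m1E preimage_setT setIT.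
    by rewrite -ge0_fin_numE// fin_num_measure.
pose mu := pushforward (mrestr P mE) (B t).
have muE A : mu A = P (E `&` B t @^-1` A).
  by rewrite /mu/= /pushforward/= /mrestr setIC.
have indicI d' (T' : measurableType d') (m' : {measure set T' -> \bar R}) (A A' : set T') :
    measurable A -> measurable A' ->
    m' (A `&` A') = \int[m']_x ((\1_A x)%:E * (\1_A' x)%:E).
  move=> mA mA'; rewrite -integral_mul_indic integral_indic// setIC//.
have mFs w : measurable_fun setT (fun z => F (B s w + z)%R).
  exact: (measurableT_comp mF (measurable_rVD _)).
have e1 : \int[mu]_y F y = \int[P]_w ((\1_E w)%:E * F (B t w)).
  apply: (ge0_integral_density (mB t0)) => //; first exact: mB.
  move=> ? A mA; etransitivity; first exact: muE.
  by rewrite indicI//; exact: mBA.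
have e2 : \int[mu]_y F y =
    \int[P \x ga]_p ((\1_(E `*` [set: 'rV[R]_n]) p)%:E * F (J p)).
  apply: (ge0_integral_density mJ) => //; first exact: mB.
  move=> ? A mA; etransitivity; first exact: muE.
  have mA' : measurable [set p : 'rV[R]_n * 'rV[R]_n | A (p.1 + p.2)%R].
    rewrite -[X in measurable X]setTI.
    apply: (_ : measurable_fun setT (fun p : 'rV[R]_n * 'rV[R]_n => p.1 + p.2)%R) => //.
    apply/measurable_fun_rVP => i; under eq_fun do rewrite mxE.
    apply: measurable_funD; apply: (measurableT_comp (measurable_coord i)).
      exact: measurable_fst.
    exact: measurable_snd.
  have -> : B t @^-1` A = K @^-1` [set p | A (p.1 + p.2)%R].
    by apply/seteqP; split => w /=; rewrite addrC subrK.
  rewrite joint// indicI//.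
  by rewrite -[X in measurable X]setTI; exact: mJ.
transitivity (\int[mu]_y F y).
  by rewrite [RHS]e1 [LHS]integral_mul_indic; apply: eq_integral => w _; rewrite muleC.
rewrite e2 fubini_tonelli1//; last 2 first.
- apply: emeasurable_funM; first exact/measurable_EFinP.
  exact: (measurableT_comp mF mJ).
- by move=> p; rewrite mule_ge0// lee_fin.
rewrite [RHS]integral_mul_indic; apply: eq_integral => w _.
rewrite /fubini_F muleC -ge0_integralZl//.
apply: eq_integral => z _; rewrite !indicE in_setX/= in_setT andbT//.
Qed.

End increment.
End markov.

(** * Exit from the chamber *)

Section paths.
Context {R : realType} {n : nat}.
Implicit Types (y : R -> 'rV[R]_n) (g : 'rV[R]_n -> R).

Lemma continuous_big_sum (I : Type) (s : seq I) (F : I -> 'rV[R]_n -> R) :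
  (forall i, continuous (F i)) -> continuous (fun x => \sum_(i <- s) F i x).
Proof.
move=> cF; elim: s => [|i s IH].
  rewrite (_ : (fun x => _) = cst 0); first by move=> x; exact: cst_continuous.
  by apply/funext => x; rewrite big_nil.
rewrite (_ : (fun x => _) = (fun x => F i x + \sum_(j <- s) F j x)).
  by move=> x; apply: continuousD; [exact: cF|exact: IH].
by apply/funext => x; rewrite big_cons.
Qed.

Lemma continuous_big_prod (I : Type) (s : seq I) (F : I -> 'rV[R]_n -> R) :
  (forall i, continuous (F i)) -> continuous (fun x => \prod_(i <- s) F i x).
Proof.
move=> cF; elim: s => [|i s IH].
  rewrite (_ : (fun x => _) = cst 1); first by move=> x; exact: cst_continuous.
  by apply/funext => x; rewrite big_nil.
rewrite (_ : (fun x => _) = (fun x => F i x * \prod_(j <- s) F j x)).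
  by move=> x; apply: continuousM; [exact: cF|exact: IH].
by apply/funext => x; rewrite big_cons.
Qed.

Lemma continuous_dotv (a : 'rV[R]_n) : continuous (dotv a).
Proof.
apply: continuous_big_sum => i x; apply: continuousM; first exact: cst_continuous.
exact: coord_continuous.
Qed.

Lemma continuous_root_product (Phi : {fset 'rV[R]_n}) v :
  continuous (root_product Phi v).
Proof. by apply: continuous_big_prod => a; exact: continuous_dotv. Qed.

Lemma path_continuous y g (s e : R) : {within `[0, +oo[, continuous y} ->
  continuous g -> 0 <= s -> 0 < e ->
  exists2 dl, 0 < dl & forall u, 0 <= u -> `|u - s| < dl ->
    `|g (y u) - g (y s)| < e.
Proof.
move=> cy cg s0 e0.
have cgy : {within `[0, +oo[, continuous (g \o y)}.
  by apply: within_continuous_comp => // z _; exact: cg.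
have /subspace_continuousP/(_ s) := cgy.
rewrite /= in_itv/= andbT => /(_ s0)/cvgrPdist_lt/(_ e e0).
rewrite near_withinE => /nbhs_ballP[dl /= dl0 H]; exists dl => // u u0 us.
rewrite distrC; apply: (H u); last by rewrite /= in_itv/= andbT.
by rewrite /ball/= distrC.
Qed.

Lemma grid_dense (r s e : R) : 0 <= s <= r -> 0 < e ->
  exists k i : nat, (i <= k.+1)%N /\ `|r * (i%:R / k.+1%:R) - s| < e.
Proof.
move=> /andP[s0 sr] e0; have [r0|r0] := leP r 0.
  have -> : s = 0 by apply/eqP; rewrite eq_le s0 (le_trans sr).
  by exists 0%N, 0%N; split => //; rewrite mul0r mulr0 subr0 normr0.
pose k := Num.truncn (r / e); pose m : R := k.+1%:R.
have m0 : 0 < m by rewrite ltr0n.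
have rm : r / m < e.
  by rewrite ltr_pdivrMr// mulrC -ltr_pdivrMr// truncnS_gt.
have x0 : 0 <= s * m / r by rewrite divr_ge0 ?mulr_ge0// ltW.
have /andP[i1 i2] := truncn_itv x0.
exists k, (Num.truncn (s * m / r)); split.
  rewrite -(ler_nat R) (le_trans i1)// ler_pdivrMr// mulrC ler_wpM2l// ltW//.
rewrite -natr1 in i2; rewrite -/m; move: (Num.truncn _)%:R i1 i2 => i i1 i2.
have {}i1 : r * (i / m) <= s.
  by rewrite mulrA ler_pdivrMr// mulrC -ler_pdivlMr.
have {}i2 : s < r * (i / m) + r / m.
  rewrite (_ : _ + _ = (i + 1) * r / m); last by field; rewrite gt_eqF.
  by rewrite ltr_pdivlMr// -ltr_pdivrMr.
by rewrite ler0_norm ?subr_le0// opprB (le_lt_trans _ rm)// lerBlDl ltW.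
Qed.

(** A positive continuous function has a positive minimum on [0, r], and a lower
    bound at the points of all regular subdivisions of [0, r] extends to
    [0, r] by density. This expresses the uncountably many conditions of
    staying in the chamber by countably many. *)
Lemma stay_positiveP (f : R -> R) (r : R) : 0 <= r ->
  {within `[0, +oo[, continuous f} ->
  (forall s, 0 <= s <= r -> 0 < f s) <->
  exists p : nat, forall k i : nat, (i <= k.+1)%N ->
    p.+1%:R^-1 <= f (r * (i%:R / k.+1%:R)).
Proof.
move=> r0 cf.
have grid k i : (i <= k.+1)%N -> 0 <= r * (i%:R / k.+1%:R) <= r.
  move=> ik; rewrite mulr_ge0//= ler_piMr// ler_pdivrMr ?ltr0n// mul1r.
  by rewrite ler_nat.
split=> [f0|[p pf] s sr].
  have cfr : {within `[0, r], continuous f}.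
    apply: continuous_subspaceW cf => x /=; rewrite !in_itv/= andbT.
    by move=> /andP[].
  have [c] := EVT_min r0 cfr; rewrite in_itv/= => /f0 fc cmin.
  exists (Num.truncn (f c)^-1) => k i /grid ik.
  apply: (@le_trans _ _ (f c)); last by apply: cmin; rewrite in_itv.
  by rewrite invf_ple ?posrE ?ltr0n// ltW// truncnS_gt.
have e0 : 0 < p.+1%:R^-1 :> R by rewrite invr_gt0 ltr0n.
rewrite ltNge; apply/negP => fs.
have s0 : 0 <= s by case/andP: sr.
have /subspace_continuousP/(_ s) := cf.
rewrite /= in_itv/= andbT => /(_ s0)/cvgrPdist_lt/(_ _ e0).
rewrite near_withinE => /nbhs_ballP[dl /= dl0 H].
have [k [i [ik]]] := grid_dense sr dl0.
have /andP[u0 _] := grid _ _ ik; have := pf _ _ ik.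
move: (r * _) u0 => u u0 fu us.
have := H u; rewrite /ball/= distrC in_itv/= andbT => /(_ us u0).
rewrite distrC => /(le_lt_trans (ler_norm _))/(le_lt_trans (lerB fu fs)).
by rewrite subr0 ltxx.
Qed.

End paths.

Section stay.
Context {R : realType} {n : nat}.
Variables (Phi : {fset 'rV[R]_n}) (v : 'rV[R]_n).
Local Notation C := (chamber Phi v).

Definition stay (T : Type) (Z : R -> T -> 'rV[R]_n) (r : R) : set T :=
  [set w | forall s, 0 <= s <= r -> C (Z s w)].

Lemma measurable_stay d (T : measurableType d) (Z : R -> T -> 'rV[R]_n) (r : R) :
  0 <= r -> (forall s, 0 <= s <= r -> measurable_fun setT (Z s)) ->
  (forall w, {within `[0, +oo[, continuous (fun s => Z s w)}) ->
  measurable (stay Z r).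
Proof.
move=> r0 mZ cZ.
have grid k i : (i <= k.+1)%N -> 0 <= r * (i%:R / k.+1%:R) <= r.
  move=> ik; rewrite mulr_ge0//= ler_piMr// ler_pdivrMr ?ltr0n// mul1r.
  by rewrite ler_nat.
pose E a p k i := [set w | ((i <= k.+1)%N ==>
  (p.+1%:R^-1 <= dotv a (Z (r * (i%:R / k.+1%:R)) w)))].
have cdZ a w : {within `[0, +oo[, continuous (fun s => dotv a (Z s w))}.
  apply: (@within_continuous_comp _ _ _ _ (fun s => Z s w) (dotv a)) => // z _.
  exact: continuous_dotv.
have -> : stay Z r = \bigcap_(a in [set` positive_roots Phi v])
    \bigcup_(p in [set: nat]) \bigcap_(k in [set: nat]) \bigcap_(i in [set: nat]) E a p k i.
  apply/seteqP; split => w /=.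
    move=> Zw a aP.
    have [p pw] := (stay_positiveP r0 (cdZ a w)).1 (fun s sr => Zw s sr a aP).
    by exists p => // k _ i _; apply/implyP; exact: pw.
  move=> H s sr a aP; have [p _ Hp] := H a aP.
  apply: ((stay_positiveP r0 (cdZ a w)).2 _ s sr).
  by exists p => k i ik; have /implyP := Hp k I i I; apply.
apply: fin_bigcap_measurable => // a _.
apply: bigcup_measurable => p _; apply: bigcapT_measurable => k.
apply: bigcapT_measurable => i; rewrite /E.
have [ik|ik] := leqP i k.+1; last first.
  by rewrite (_ : [set _ | _] = setT)//; apply/seteqP; split.
rewrite (_ : [set _ | _] = (fun w => dotv a (Z (r * (i%:R / k.+1%:R)) w)) @^-1`
    `[p.+1%:R^-1, +oo[); last first.
  by apply/seteqP; split => w /=; rewrite in_itv/= andbT.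
rewrite -[X in measurable X]setTI.
apply: (measurableT_comp (@measurable_dotv _ _ a) (mZ _ (grid _ _ ik))) => //.
Qed.

(** Take for tau the infimum of the times spent outside. The chamber being open,
    some root is nonpositive at time tau; it is not negative, since it is
    positive just before. The bracketing of tau locates it between any two
    times that surround the exit, such as consecutive times of a grid. *)
Lemma exit_time (y : R -> 'rV[R]_n) (T : R) : root_system Phi ->
  {within `[0, +oo[, continuous y} -> C (y 0) -> 0 <= T ->
  ~ (forall s, 0 <= s <= T -> C (y s)) ->
  exists2 tau, 0 <= tau <= T /\ root_product Phi v (y tau) = 0 &
    forall r1 r2, 0 <= r1 -> r2 <= T -> (forall s, 0 <= s <= r1 -> C (y s)) ->
      ~ (forall s, 0 <= s <= r2 -> C (y s)) -> r1 <= tau <= r2.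
Proof.
move=> rsPhi cy C0 T0 exitT.
pose S := [set s | 0 <= s <= T /\ ~ C (y s)].
have S0 : S !=set0.
  apply: contrapT => nS; apply: exitT => s sT; apply: contrapT => nC.
  by apply: nS; exists s.
have lbS : lbound S 0 by move=> s [/andP[]].
have infS : has_inf S by split => //; exists 0.
have tauS r1 r2 : 0 <= r1 -> r2 <= T -> (forall s, 0 <= s <= r1 -> C (y s)) ->
    ~ (forall s, 0 <= s <= r2 -> C (y s)) -> r1 <= inf S <= r2.
  move=> r10 r2T C1 nC2; apply/andP; split.
    apply: lb_le_inf => // s [/andP[s0 _] nC]; rewrite leNgt; apply/negP => sr.
    by apply: nC; apply: C1; rewrite s0 ltW.
  have [s [sr nC]] : exists s, 0 <= s <= r2 /\ ~ C (y s).
    apply: contrapT => nS; apply: nC2 => s sr; apply: contrapT => nC.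
    by apply: nS; exists s.
  apply: (@le_trans _ _ s); last by case/andP: sr.
  apply: ge_inf; first by exists 0.
  by split => //; case/andP: sr => -> /le_trans ->.
have tau0 : 0 <= inf S by exact: lb_le_inf.
exists (inf S) => //; split.
  have := tauS 0 T (lexx _) (lexx _) _ exitT; apply.
  by move=> s; rewrite andbC -eq_le => /eqP ->.
have [a aP a0] : exists2 a, a \in positive_roots Phi v & dotv a (y (inf S)) <= 0.
  apply: contrapT => na.
  have Ca a : a \in positive_roots Phi v -> 0 < dotv a (y (inf S)).
    by move=> aP; rewrite ltNge; apply/negP => a0; apply: na; exists a.
  have [dl dl0 H] : exists2 dl, 0 < dl & forall u, 0 <= u -> `|u - inf S| < dl -> C (y u).
    suff [dl dl0 H] : exists2 dl, 0 < dl & forall a, a \in enum_fset (positive_roots Phi v) ->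
        forall u, 0 <= u -> `|u - inf S| < dl -> 0 < dotv a (y u).
      by exists dl => // u u0 us a aP; exact: H.
    have sub : {subset enum_fset (positive_roots Phi v) <= positive_roots Phi v} by [].
    elim: (enum_fset _) sub => [|a s IH] sub; first by exists 1.
    have [|dl1 dl10 H1] := IH; first by move=> b bs; apply: sub; rewrite inE bs orbT.
    have aP : a \in positive_roots Phi v by apply: sub; rewrite mem_head.
    have [dl2 dl20 H2] := path_continuous cy (@continuous_dotv _ _ a) tau0 (Ca a aP).
    exists (Num.min dl1 dl2); first by rewrite lt_min dl10.
    move=> b; rewrite inE => /orP[/eqP ->|bs] u u0; rewrite lt_min => /andP[u1 u2].
      by have := H2 u u0 u2; rewrite distrC => /(le_lt_trans (ler_norm _)); lra.
    exact: (H1 b bs).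
  have [s sS slt] := inf_adherent dl0 infS.
  have infs : inf S <= s by apply: ge_inf => //; exists 0.
  case: sS => /andP[s0 _]; apply; apply: H => //.
  by rewrite ger0_norm ?subr_ge0// ltrBlDl.
apply: (root_product_boundary rsPhi aP); apply/eqP; rewrite eq_le a0/=.
rewrite leNgt; apply/negP => an.
have taup : 0 < inf S.
  rewrite lt_neqAle tau0 andbT; apply/eqP => e.
  by have := C0 a aP; rewrite e; lra.
have ap : 0 < - dotv a (y (inf S)) by rewrite oppr_gt0.
have [dl dl0 H] := path_continuous cy (@continuous_dotv _ _ a) tau0 ap.
pose u := Num.max 0 (inf S - dl / 2).
have u0 : 0 <= u by rewrite le_max lexx.
have ult : u < inf S by rewrite gt_max taup/= ltrBlDr ltrDl divr_gt0.
have udl : `|u - inf S| < dl.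
  rewrite ler0_norm ?subr_le0 ?(ltW ult)// opprB.
  have : inf S - dl / 2 <= u by rewrite le_max lexx orbT.
  lra.
have /le_lt_trans := H u u0 udl => /(_ _ (ler_norm _)) ya.
have Cu : C (y u).
  apply: contrapT => nC; have := ult; rewrite ltNge => /negP; apply.
  apply: ge_inf; first by exists 0.
  split => //; rewrite u0/=; have [s sS] := S0; have [/andP[_ sT] _] := sS.
  apply: le_trans (ltW ult) _; apply: le_trans sT.
  by apply: ge_inf => //; exists 0.
have := Cu a aP; lra.
Qed.

End stay.

(** * Killing does not change the heat flow *)

Section killed.
Context {R : realType} {n : nat}.
Variables (Phi : {fset 'rV[R]_n}) (v : 'rV[R]_n).
Hypotheses (rsPhi : root_system Phi) (regv : regular Phi v).
Local Notation C := (chamber Phi v).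
Local Notation h := (root_product Phi v).
Local Notation m := #|` reduced_positive_roots Phi v|.

(** The heat flow at time tau of h * gweight l, as computed by
    gmean_root_product_gweight; the closed form makes sense at tau = 0 too. *)
Definition heat_root (l tau : R) (y : 'rV[R]_n) : R :=
  Num.sqrt (1 + l * tau)^-1 ^+ (n + 2 * m) *
  (h y * gweight ((1 + l * tau)^-1 * l) y).

Lemma heat_root0 l y : heat_root l 0 y = h y * gweight l y.
Proof. by rewrite /heat_root mulr0 addr0 invr1 sqrtr1 expr1n !mul1r. Qed.

Lemma measurable_heat_root l tau : measurable_fun setT (heat_root l tau).
Proof.
apply: measurable_funM => //; apply: measurable_funM.
  by have [] := tame_root_product Phi v.
exact: (@measurable_gweight _ n _).
Qed.

(** Uniformly in tau, the heat flow is small where h is small. *)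
Lemma heat_root_le l tau y : 0 <= l -> 0 <= tau -> `|heat_root l tau y| <= `|h y|.
Proof.
move=> l0 t0; have a0 : 0 <= (1 + l * tau)^-1.
  by rewrite invr_ge0 addr_ge0// mulr_ge0.
rewrite /heat_root; set A := _ ^+ _; set G := gweight _ y.
have A0 : 0 <= A by rewrite exprn_ge0.
have A1 : A <= 1.
  rewrite exprn_ile1// -[leRHS]sqrtr1 ler_sqrt// invf_le1 ?lerDl ?mulr_ge0//.
  by rewrite ltr_wpDr// mulr_ge0.
have G0 : 0 <= G by rewrite ltW// gweight_gt0.
have G1 : G <= 1.
  rewrite /G /gweight -[leRHS]expR0 ler_expR mulNr oppr_le0.
  by apply: mulr_ge0; [exact: mulr_ge0|rewrite divr_ge0// dotvv_ge0].
rewrite mulrCA normrM ler_piMr// ger0_norm ?mulr_ge0//.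
by rewrite mulr_ile1.
Qed.

(* Adding the bound M makes all the integrands below nonnegative. *)
Section bound.
Variables (l M : R) (l0 : 0 < l).
Hypothesis fM : forall y, `|h y * gweight l y| <= M.

Lemma heat_root_integral tau y : 0 < tau ->
  (\int[gauss n tau]_z (h (y + z)%R * gweight l (y + z)%R + M)%:E =
   (heat_root l tau y + M)%:E)%E.
Proof.
move=> t0; have fi : (gauss n tau).-integrable setT
    (EFin \o (fun z => h (y + z) * gweight l (y + z))).
  apply: measurable_bounded_integrable => //.
  - by rewrite -ge0_fin_numE//; exact: fin_num_measure.
  - apply: measurable_funM; first by have [] := tame_root_productD Phi v y.
    exact: (measurableT_comp (@measurable_gweight _ n _) (measurable_rVD y)).
  - exists M; split; first exact: num_real.
    by move=> N MN z _ /=; rewrite (le_trans (fM _))// ltW.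
under eq_integral do rewrite EFinD.
rewrite integralD//; last exact: finite_measure_integrable_cst.
rewrite integral_cst// [X in (_ + _ * X)%E](_ : _ = 1%E); last exact: probability_setT.
rewrite mule1 EFinD; congr (_ + _)%E.
rewrite -[LHS]fineK; last exact: integrable_fin_num.
congr EFin; have := gmean_root_product_gweight rsPhi regv y t0 (ltW l0).
by rewrite /gmean /Rintegral.
Qed.

Lemma heat_root_bounds tau y : 0 <= tau ->
  0 <= heat_root l tau y + M <= 2 * M.
Proof.
have fM2 z : 0 <= h z * gweight l z + M <= 2 * M.
  by have := fM z; rewrite ler_norml => /andP[]; lra.
rewrite le_eqVlt => /orP[/eqP <-|t0]; first by rewrite heat_root0.
rewrite -!lee_fin -heat_root_integral//; apply/andP; split.
  by apply: integral_ge0 => z _; rewrite lee_fin; case/andP: (fM2 (y + z)).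
apply: (@le_trans _ _ (\int[gauss n tau]_z (2 * M)%:E)%E).
  apply: ge0_le_integral => //.
  - by move=> z _; rewrite lee_fin; case/andP: (fM2 (y + z)).
  - apply/measurable_EFinP/measurable_funD => //; apply: measurable_funM.
      by have [] := tame_root_productD Phi v y.
    exact: (measurableT_comp (@measurable_gweight _ n _) (measurable_rVD y)).
  - by move=> z _; rewrite lee_fin; case/andP: (fM2 (y + z)).
by rewrite integral_cst// [X in (_ * X)%E](_ : _ = 1%E) ?mule1//; exact: probability_setT.
Qed.

Section process.
Context d (T : measurableType d) (P : probability T R).
Variables (x : 'rV[R]_n) (B : R -> T -> 'rV[R]_n).
Hypotheses (BB : brownian P x B) (Cx : C x).
Variables (t : R) (t0 : 0 < t).

Lemma past_stay r : 0 <= r -> past B r (stay Phi v B r).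
Proof.
move=> r0; have [_ cB _ _] := BB.
apply: (@measurable_stay _ _ Phi v _ (g_sigma_algebraType _)) => //.
move=> s sr _ A mA; rewrite setTI; apply: sub_sigma_algebra.
by exists s, A.
Qed.

Lemma past_le r s : r <= s -> past B r `<=` past B s.
Proof.
move=> rs; apply: smallest_sub; first exact: smallest_sigma_algebra.
move=> _ [u [A [/andP[u0 ur] mA ->]]]; apply: sub_sigma_algebra.
by exists u, A; rewrite u0 (le_trans ur).
Qed.

Local Notation K := (stay Phi v B).

Let mheat s : measurable_fun setT (fun y => (heat_root l s y + M)%:E).
Proof.
by apply/measurable_EFinP/measurable_funD => //; exact: measurable_heat_root.
Qed.

Let markov_heat s E : 0 <= s <= t -> past B s E ->
  (\int[P]_(w in E) (heat_root l 0 (B t w) + M)%:E =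
   \int[P]_(w in E) (heat_root l (t - s) (B s w) + M)%:E)%E.
Proof.
move=> /andP[s0]; rewrite le_eqVlt => /orP[/eqP <- _|st pE].
  by rewrite subrr.
rewrite (brownian_markov BB s0 st pE (mheat 0)); last first.
  by move=> y; rewrite lee_fin; case/andP: (heat_root_bounds y (lexx 0)).
apply: eq_integral => w _.
rewrite -heat_root_integral ?subr_gt0//; apply: eq_integral => z _.
by rewrite heat_root0.
Qed.

Let mK r : 0 <= r -> measurable (K r).
Proof.
by move=> r0; have [mB _ _ _] := BB; apply: (past_measurable mB (past_stay r0)).
Qed.

Let K_le r s : r <= s -> K s `<=` K r.
Proof. by move=> rs w Kw u /andP[u0 ur]; apply: Kw; rewrite u0 (le_trans ur). Qed.

Let K0 : K 0 = setT.
Proof.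
have [_ _ B0 _] := BB; apply/seteqP; split => // w _ s.
by rewrite andbC -eq_le => /eqP ->; rewrite B0.
Qed.

Section grid.
Variable k : nat.

Let time (i : nat) : R := t * (i%:R / k.+1%:R).

Let time_ge0 i : 0 <= time i.
Proof. by apply: mulr_ge0; [exact: ltW|exact: divr_ge0]. Qed.

Let time_le i j : (i <= j)%N -> time i <= time j.
Proof. by move=> ij; rewrite ler_pM2l// ler_pM2r ?invr_gt0// ler_nat. Qed.

Let timek : time k.+1 = t.
Proof. by rewrite /time divff ?mulr1. Qed.

Let F i := K (time i) `\` K (time i.+1).

Let mF i : measurable (F i).
Proof. by apply: measurableD; exact: mK. Qed.

Let pastF i : past B (time i.+1) (F i).
Proof.
apply: (@measurableD _ (g_sigma_algebraType _)); last exact: past_stay.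
by apply: (past_le (time_le (leqnSn i))); exact: past_stay.
Qed.

Let sumF (V : nat -> R) w : ~ K t w -> exists i, [/\ (i < k.+1)%N, F i w &
  \sum_(j < k.+1) V j * \1_(F j) w = V i].
Proof.
move=> nKw; have ex : exists i, ~~ `[< K (time i.+1) w >].
  by exists k; apply/asboolPn; rewrite timek.
pose i := ex_minn ex; exists i.
have [nKi imin] : ~ K (time i.+1) w /\ forall j, ~ K (time j.+1) w -> (i <= j)%N.
  rewrite /i; case: ex_minnP => i0 /asboolPn nKi imin; split => // j nKj.
  by apply: imin; exact/asboolPn.
have ik : (i < k.+1)%N by rewrite ltnS; apply: imin; rewrite timek.
have Ki : K (time i) w.
  case iE : i => [|i']; first by rewrite /time mul0r mulr0 K0.
  apply: contrapT => nK; have := imin _ nK; rewrite iE; lia.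
have Fi : F i w by [].
split=> //; rewrite (bigD1 (Ordinal ik))//= indicE mem_set// mulr1 big1 ?addr0//.
move=> j ji; rewrite indicE memNset ?mulr0// => -[Kj nKj].
have {}ji : (j : nat) != i by apply: contra ji => /eqP e; apply/eqP/val_inj.
move: ji; rewrite neq_ltn => /orP[ji|ij].
  by apply: nKj; apply: K_le Ki; exact: time_le.
by apply: nKi; apply: K_le Kj; exact: time_le.
Qed.

Let sumF0 (V : nat -> R) w : K t w -> \sum_(j < k.+1) V j * \1_(F j) w = 0.
Proof.
move=> Kw; rewrite big1// => j _; rewrite indicE memNset ?mulr0// => -[_]; apply.
by apply: K_le Kw; rewrite -timek; exact: time_le.
Qed.

Let V i w := heat_root l (t - time i.+1) (B (time i.+1) w) + M.

(** The martingale heat_root, shifted by M, at the first time of the grid by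
    which the path has left the chamber: F j is the event that this is the time
    of index j.+1. *)
Definition exit_value w : R := \sum_(j < k.+1) V j w * \1_(F j) w.

Let time_t i : (i < k.+1)%N -> 0 <= t - time i.+1.
Proof. by move=> ik; rewrite subr_ge0 -[leRHS]timek time_le. Qed.

Let mV i : measurable_fun setT (V i).
Proof.
have [mB _ _ _] := BB.
apply: measurable_funD => //.
exact: (measurableT_comp (@measurable_heat_root _ _) (mB _ (time_ge0 _))).
Qed.

Lemma measurable_exit_value : measurable_fun setT exit_value.
Proof. by apply: measurable_sum => j; apply: measurable_funM. Qed.

Lemma exit_value_bounds w : 0 <= exit_value w <= 2 * M.
Proof.
have M0 : 0 <= M by apply: le_trans (fM x).
have [Kw|nKw] := pselect (K t w).
  by rewrite /exit_value (sumF0 (V ^~ w) Kw); lra.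
have [i [ik _ e]] := sumF (V ^~ w) nKw.
by rewrite /exit_value e; apply: heat_root_bounds; exact: time_t.
Qed.

Lemma exit_value_near w : ~ K t w -> exists u,
  [/\ 0 <= u <= t, `|exit_value w - M| <= `|h (B u w)| &
   forall tau, (forall r1 r2, 0 <= r1 -> r2 <= t ->
      (forall s, 0 <= s <= r1 -> C (B s w)) ->
      ~ (forall s, 0 <= s <= r2 -> C (B s w)) -> r1 <= tau <= r2) ->
    `|u - tau| <= t / k.+1%:R].
Proof.
move=> nKw; have [i [ik [Ki nKi] e]] := sumF (V ^~ w) nKw.
have it : time i.+1 <= t by rewrite -subr_ge0; exact: time_t.
exists (time i.+1); split.
- by rewrite time_ge0.
- by rewrite /exit_value e /V addrK; apply: heat_root_le; [exact: ltW|exact: time_t].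
- move=> tau /(_ (time i) (time i.+1) (time_ge0 _) it Ki nKi)/andP[t1 t2].
  rewrite ger0_norm ?subr_ge0//.
  have -> : t / k.+1%:R = time i.+1 - time i.
    by rewrite /time -mulrBr -mulrBl -[i.+1%:R]natr1 addrAC subrr add0r mul1r.
  by rewrite lerB.
Qed.

(** Leaving the chamber between two consecutive times of the grid is an event of
    the past up to the second one, so the martingale property applies to each
    F j from that time on. *)
Lemma integral_exit_value :
  (\int[P]_(w in ~` K t) (heat_root l 0 (B t w) + M)%:E =
   \int[P]_(w in ~` K t) (exit_value w)%:E)%E.
Proof.
have [mB _ _ _] := BB.
have mG : measurable_fun setT (fun w => (heat_root l 0 (B t w) + M)%:E).
  by apply: (measurableT_comp (mheat 0)); apply: mB; exact: ltW.
have decomp (W : nat -> T -> R) : (forall i, measurable_fun setT (W i)) ->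
    (forall i w, (i < k.+1)%N -> 0 <= W i w) ->
    (\int[P]_(w in ~` K t) (\sum_(j < k.+1) W j w * \1_(F j) w)%:E =
     \sum_(j < k.+1) \int[P]_(w in F j) (W j w)%:E)%E.
  move=> mW W0; rewrite integral_mul_indic.
  transitivity (\int[P]_w (\sum_(j < k.+1) ((W j w)%:E * (\1_(F j) w)%:E)))%E.
    apply: eq_integral => w _; have [Kw|nKw] := pselect (K t w).
      rewrite (sumF0 (W ^~ w) Kw) mul0e; apply/esym.
      under eq_bigr do rewrite -EFinM.
      by rewrite sumEFin (sumF0 (W ^~ w) Kw).
    rewrite [\1_(~` _) w]indicE mem_set// mule1 -sumEFin.
    by under eq_bigr do rewrite EFinM.
  rewrite ge0_integral_sum//.
  - by apply: eq_bigr => j _; rewrite [RHS]integral_mul_indic.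
  - move=> j; apply/measurable_EFinP; apply: measurable_funM => //.
  - by move=> j w _; rewrite mule_ge0// lee_fin W0.
transitivity (\int[P]_(w in ~` K t)
    (\sum_(j < k.+1) (heat_root l 0 (B t w) + M) * \1_(F j) w)%:E)%E.
  apply: eq_integral => w; rewrite inE => nKw.
  by have [i [_ _ ->]] := sumF (fun=> heat_root l 0 (B t w) + M) nKw.
rewrite (decomp (fun=> fun w => heat_root l 0 (B t w) + M)); last 2 first.
- by move=> _; exact/measurable_EFinP.
- by move=> _ w _; case/andP: (heat_root_bounds (B t w) (lexx 0)).
have V0 i w : (i < k.+1)%N -> 0 <= V i w.
  by move=> ik; case/andP: (heat_root_bounds (B (time i.+1) w) (time_t ik)).
etransitivity; last exact: (esym (decomp V mV V0)).
apply: eq_bigr => j _; apply: markov_heat => //.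
by rewrite time_ge0/= -[leRHS]timek time_le.
Qed.

End grid.

Let exit_value_cvg w : ~ K t w -> exit_value k w @[k --> \oo] --> M.
Proof.
move=> nKw; have [_ cB B0 _] := BB.
have [tau [/andP[tau0 taut] htau] tauP] :
    exists2 tau, 0 <= tau <= t /\ h (B tau w) = 0 & _ :=
  exit_time rsPhi (cB w) (eq_ind_r C Cx (B0 w)) (ltW t0) nKw.
apply/cvgrPdist_lt => e e0.
have [dl dl0 H] := path_continuous (cB w) (@continuous_root_product _ _ Phi v) tau0 e0.
have edl : 0 < dl / t by rewrite divr_gt0.
have := near_infty_natSinv_lt (PosNum edl); apply: filterS => k /= kdl.
have [u [/andP[u0 ut] Vu ud]] := exit_value_near k nKw.
rewrite distrC; apply: le_lt_trans Vu _.
have := H u u0; rewrite htau subr0; apply.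
apply: le_lt_trans (ud tau tauP) _.
by rewrite mulrC -ltr_pdivlMr.
Qed.

(** Optional stopping at the first exit from the chamber: the heat flow of
    h * gweight l is a bounded martingale along B, and it vanishes at the exit
    time because h does; so killing does not change its expectation. *)
Lemma killed_heat_root :
  (\int[P]_(w in K t) (h (B t w) * gweight l (B t w))%:E =
   (heat_root l t x)%:E)%E.
Proof.
have [mB _ B0 _] := BB.
have M0 : 0 <= M by apply: le_trans (fM x).
have mKt := mK (ltW t0).
have mG : measurable_fun setT (fun w => (heat_root l 0 (B t w) + M)%:E).
  by apply: (measurableT_comp (mheat 0)); apply: mB; exact: ltW.
have G0 w : (0 <= (heat_root l 0 (B t w) + M)%:E)%E.
  by rewrite lee_fin; case/andP: (heat_root_bounds (B t w) (lexx 0)).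
have out : (\int[P]_(w in ~` K t) (heat_root l 0 (B t w) + M)%:E =
    M%:E * P (~` K t))%E.
  have lim : (\int[P]_(w in ~` K t) (exit_value k w)%:E @[k --> \oo] -->
      \int[P]_(w in ~` K t) (cst M w)%:E)%E.
    apply: (@bounded_cvg_integral _ _ _ _ _ _ _ (2 * M)) => //.
    - exact: measurableC.
    - by move=> k; apply: measurable_funTS; exact: measurable_exit_value.
    - by move=> k w _; have /andP[e0 e1] := exit_value_bounds k w; rewrite ger0_norm.
  have c : (\int[P]_(w in ~` K t) (cst M w)%:E = M%:E * P (~` K t))%E.
    by apply: (integral_cst _ _ M%:E); exact: measurableC.
  rewrite c in lim.
  set I := LHS; have E : (fun k => \int[P]_(w in ~` K t) (exit_value k w)%:E)%E = cst I.
    by apply/funext => k; rewrite -integral_exit_value.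
  rewrite E in lim.
  have limI : (cst I @ \oo --> I)%classic by exact: cvg_cst.
  by rewrite -[LHS](cvg_lim (@ereal_hausdorff R) limI);
    exact: (cvg_lim (@ereal_hausdorff R) lim).
have total : (\int[P]_w (heat_root l 0 (B t w) + M)%:E = (heat_root l t x + M)%:E)%E.
  rewrite (@markov_heat 0 setT); last 2 first.
  - by rewrite lexx ltW.
  - exact: (@measurableT _ (g_sigma_algebraType _)).
  under eq_integral do rewrite B0 subr0.
  rewrite (integral_cst _ _ (heat_root l t x + M)%:E)//.
  by rewrite [X in (_ * X)%E](_ : _ = 1%E) ?mule1//; exact: probability_setT.
have : (\int[P]_w (heat_root l 0 (B t w) + M)%:E =
    \int[P]_(w in K t) (heat_root l 0 (B t w) + M)%:E + M%:E * P (~` K t))%E.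
  rewrite -out -ge0_integral_setU//; first by rewrite setUv.
  - exact: measurableC.
  - by rewrite setUv.
  - by rewrite disj_set2E setICr.
rewrite total.
under [X in (_ = X + _)%E -> _]eq_integral do rewrite heat_root0 EFinD.
rewrite ge0_integralD//; last 2 first.
- move=> w Kw; rewrite lee_fin mulr_ge0// ltW ?gweight_gt0// root_product_gt0//.
  by apply: Kw; rewrite lexx ltW.
- apply/measurable_EFinP; apply: measurable_funTS; apply: measurable_funM.
    apply: (measurableT_comp _ (mB _ (ltW t0))).
    by have [] := tame_root_product Phi v.
  exact: (measurableT_comp (@measurable_gweight _ n _) (mB _ (ltW t0))).
rewrite integral_cst// -addeA -ge0_muleDr// -measureU//; last 2 first.
- exact: measurableC.
- by rewrite setICr.
rewrite setUv [X in (_ + _ * X)%E](_ : _ = 1%E) ?mule1; last exact: probability_setT.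
set I := (\int[P]_(w in _) _)%E; rewrite EFinD => e.
have : (I + M%:E - M%:E = (heat_root l t x)%:E + M%:E - M%:E)%E by rewrite e.
by rewrite !addeK.
Qed.

End process.
End bound.
End killed.

(** * Radial parts with the same one-step relation *)

Section radial.
Context {R : realType}.

(** The one-step property shared by the radial parts of a k-dimensional
    Brownian motion and of the conditioned process: it determines the law of the
    norm at time t given the past up to time s through its Laplace transform. *)
Definition gauss_step (k n : nat) d (T : measurableType d) (P : probability T R)
    (Z : R -> T -> 'rV[R]_n) : Prop :=
  forall s t l E, 0 <= s < t -> 0 <= l -> past Z s E ->
  (\int[P]_(w in E) (gweight l (Z t w))%:E =
   (Num.sqrt (1 + l * (t - s))^-1 ^+ k)%:E *
   \int[P]_(w in E) (gweight ((1 + l * (t - s))^-1 * l) (Z s w))%:E)%E.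

Definition qnorm n (x : 'rV[R]_n) : R := dotv x x / 2.

Lemma measurable_qnorm n : measurable_fun setT (@qnorm n).
Proof. by apply: measurable_funM => //; exact: measurable_dotvv. Qed.

Lemma qnorm_ge0 n (x : 'rV[R]_n) : 0 <= qnorm x.
Proof. by rewrite divr_ge0// dotvv_ge0. Qed.

Definition marginals n (T : Type) (Z : R -> T -> 'rV[R]_n) (A : R -> set R)
    (s : seq R) : set T := [set w | forall u, u \in s -> A u (qnorm (Z u w))].

Section one_process.
Context n d (T : measurableType d) (P : probability T R) (Z : R -> T -> 'rV[R]_n).
Hypothesis mZ : forall t, 0 <= t -> measurable_fun setT (Z t).

Lemma past_marginals A s r : (forall u, measurable (A u)) ->
  (forall u, u \in s -> 0 <= u <= r) -> past Z r (marginals Z A s).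
Proof.
move=> mA sr.
rewrite (_ : marginals Z A s = \bigcap_(u in [set` s]) (Z u @^-1` (@qnorm n @^-1` A u))).
  apply: (@fin_bigcap_measurable _ (g_sigma_algebraType _)) => // u us.
  apply: sub_sigma_algebra; exists u, (@qnorm n @^-1` A u); split => //.
    exact: sr.
  by rewrite -[X in measurable X]setTI; exact: measurable_qnorm.
by apply/seteqP; split.
Qed.

Lemma marginals_rcons A s t : marginals Z A (rcons s t) =
  marginals Z A s `&` (fun w => qnorm (Z t w)) @^-1` A t.
Proof.
apply/seteqP; split => w /=.
  move=> H; split; last by apply: H; rewrite mem_rcons mem_head.
  by move=> u us; apply: H; rewrite mem_rcons inE us orbT.
move=> [H Ht] u; rewrite mem_rcons inE => /orP[/eqP ->//|]; exact: H.
Qed.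

(** A further condition at one of the times is absorbed in the sets A; this is
    what lets the induction on times carry the law at the last time. *)
Lemma marginalsI A s t (D : set R) : t \in s ->
  marginals Z (fun u => if u == t then A u `&` D else A u) s =
  marginals Z A s `&` (fun w => qnorm (Z t w)) @^-1` D.
Proof.
move=> ts; apply/seteqP; split => w /=.
  move=> H; split; last by have := H t ts; rewrite eqxx => -[].
  by move=> u us; have := H u us; case: ifP => // _ [].
by move=> [H Ht] u us; case: ifPn => [/eqP ->|_]; [split; [exact: H|]|exact: H].
Qed.

Lemma measurable_qnorm_path t : 0 <= t -> measurable_fun setT (fun w => qnorm (Z t w)).
Proof. by move=> t0; exact: (measurableT_comp (@measurable_qnorm n) (mZ t0)). Qed.

End one_process.

Lemma eq_law_integral d1 d2 (T1 : measurableType d1) (T2 : measurableType d2)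
    (P1 : probability T1 R) (P2 : probability T2 R)
    (E1 : set T1) (E2 : set T2) (q1 : T1 -> R) (q2 : T2 -> R) (g : R -> \bar R) :
  measurable E1 -> measurable E2 ->
  measurable_fun setT q1 -> measurable_fun setT q2 ->
  measurable_fun setT g -> (forall x, (0 <= g x)%E) ->
  (forall A, measurable A -> P1 (E1 `&` q1 @^-1` A) = P2 (E2 `&` q2 @^-1` A)) ->
  (\int[P1]_(w in E1) g (q1 w) = \int[P2]_(w in E2) g (q2 w))%E.
Proof.
move=> mE1 mE2 mq1 mq2 mg g0 H.
have lawE d (T : measurableType d) (P : probability T R) (E : set T) (q : T -> R)
    (mE : measurable E) (mq : measurable_fun setT q) :
    (\int[P]_(w in E) g (q w) = \int[pushforward (mrestr P mE) q]_y g y)%E.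
  rewrite (@ge0_integral_density _ _ _ _ _ P (pushforward (mrestr P mE) q) q (\1_E) g)//.
    by rewrite [LHS]integral_mul_indic; apply: eq_integral => w _; rewrite muleC.
  move=> A mA; rewrite /= /pushforward /mrestr setIC.
  have mqA : measurable (q @^-1` A) by rewrite -[X in measurable X]setTI; exact: mq.
  under eq_integral do rewrite -[\1_A (q _)]/(\1_(q @^-1` A) _).
  by rewrite -integral_mul_indic integral_indic// setIC.
rewrite (lawE _ _ _ _ _ mE1 mq1) (lawE _ _ _ _ _ mE2 mq2).
apply: eq_measure_integral => A mA _.
have : P1 (q1 @^-1` A `&` E1) = P2 (q2 @^-1` A `&` E2).
  by rewrite setIC H// setIC.
exact.
Qed.

Section two_processes.
Context n1 d1 (T1 : measurableType d1) (P1 : probability T1 R)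
  (Z1 : R -> T1 -> 'rV[R]_n1).
Context n2 d2 (T2 : measurableType d2) (P2 : probability T2 R)
  (Z2 : R -> T2 -> 'rV[R]_n2).
Hypothesis mZ1 : forall t, 0 <= t -> measurable_fun setT (Z1 t).
Hypothesis mZ2 : forall t, 0 <= t -> measurable_fun setT (Z2 t).
Variable k : nat.
Hypotheses (step1 : gauss_step k P1 Z1) (step2 : gauss_step k P2 Z2).
Hypothesis init : forall A, measurable A ->
  P1 ((fun w => qnorm (Z1 0 w)) @^-1` A) = P2 ((fun w => qnorm (Z2 0 w)) @^-1` A).

(** Induction on the last time t. On an event about the norms at earlier times,
    gauss_step expresses the Laplace transform of the norm at time t by that
    of the norm at the preceding time r, and the induction hypothesis gives
    the law of the latter on this event. *)
Lemma eq_marginals s A : path <%R 0 s -> (forall u, measurable (A u)) ->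
  P1 (marginals Z1 A (0 :: s)) = P2 (marginals Z2 A (0 :: s)).
Proof.
elim/last_ind: s A => [|s t IH] A.
  move=> _ mA; rewrite -!/(rcons [::] 0) !marginals_rcons.
  have nilT (T : Type) n (Z : R -> T -> 'rV[R]_n) : marginals Z A [::] = setT.
    by apply/seteqP; split.
  by rewrite !nilT !setTI init.
rewrite rcons_path => /andP[ps slt] mA.
set r := last 0 s in slt; have r_mem : r \in 0 :: s by exact: mem_last.
have s_le u : u \in 0 :: s -> 0 <= u <= r.
  have : sorted <=%R (0 :: s) by apply: sub_path ps => x y /ltW.
  move=> /= so us; apply/andP; split.
    move: us; rewrite inE => /orP[/eqP ->//|us].
    by have /allP := order_path_min le_trans so; apply.
  have sos : sorted <=%R (0 :: s) by [].
  have [i iu <-] := nthP 0 us.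
  rewrite /r (last_nth 0) -[nth 0 (0 :: s) (size s)]/(nth 0 (0 :: s) (size s)).
  by apply: (sorted_leq_nth le_trans le_refl 0 sos); rewrite ?inE//= -ltnS.
have r0 : 0 <= r by case/andP: (s_le _ r_mem).
have t0 : 0 <= t by rewrite (le_trans r0)// ltW.
have pE1 := past_marginals (Z := Z1) mA s_le.
have pE2 := past_marginals (Z := Z2) mA s_le.
have mE1 := past_measurable mZ1 pE1; have mE2 := past_measurable mZ2 pE2.
rewrite -rcons_cons !marginals_rcons.
apply: (laplace_unique mE1 mE2) => //.
- exact: measurable_qnorm_path.
- exact: measurable_qnorm_path.
- by move=> w; exact: qnorm_ge0.
- by move=> w; exact: qnorm_ge0.
move=> l l0.
have rt : 0 <= r < t by rewrite r0.
have := step1 rt l0 pE1; have := step2 rt l0 pE2.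
rewrite /gweight -/(qnorm _) => -> ->; congr (_ * _)%E.
set l' := _ * l.
apply: (eq_law_integral (g := fun x => (expR (- l' * x))%:E) mE1 mE2
  (measurable_qnorm_path mZ1 r0) (measurable_qnorm_path mZ2 r0)).
- by apply/measurable_EFinP; exact: measurableT_comp.
- by move=> x; rewrite lee_fin expR_ge0.
move=> D mD; rewrite -!(marginalsI _ _ _ r_mem); apply: IH => // u.
by case: ifP => // _; exact: measurableI.
Qed.

Lemma eq_enorm_law : same_law P1 (fun t w => enorm (Z1 t w))
  P2 (fun t w => enorm (Z2 t w)).
Proof.
move=> j t A t0 mA.
pose U := sort <=%R (undup [seq u <- [seq t i | i <- enum 'I_j] | 0 < u]).
have pU : path <%R 0 U.
  rewrite path_sortedE; last exact: lt_trans.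
  rewrite sort_lt_sorted undup_uniq andbT; apply/allP => u.
  by rewrite mem_sort mem_undup mem_filter => /andP[].
have tU i : t i \in 0 :: U.
  rewrite inE mem_sort mem_undup mem_filter.
  have := t0 i; rewrite le_eqVlt eq_sym => /orP[->//|->]/=.
  by rewrite map_f ?mem_enum ?orbT.
(* a time may occur several times in the list: all the conditions on it are
   gathered, and translated from the norm to half of its square *)
pose A' u := \bigcap_(i in [set: 'I_j])
  [set x : R | t i = u -> A i (Num.sqrt (2 * x))].
have msq : measurable_fun setT (fun x : R => Num.sqrt (2 * x)).
  have -> : (fun x : R => Num.sqrt (2 * x)) =
      (fun x => Num.max (2 * x) 0 `^ 2^-1).
    apply/funext => x; have [x0|x0] := leP 0 (2 * x).
      by rewrite -powR12_sqrt.
    by rewrite ltr0_sqrtr// powR0// invr_neq0// pnatr_eq0.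
  apply: (measurableT_comp (measurable_powR _)).
  by apply: measurable_maxr => //; exact: measurable_funM.
have mA' u : measurable (A' u).
  apply: fin_bigcap_measurable => // i _; have [tu|tu] := eqVneq (t i) u; last first.
    rewrite (_ : [set _ | _] = setT)//; apply/seteqP; split => // x _ /= tu'.
    by rewrite tu' eqxx in tu.
  rewrite (_ : [set _ | _] = (fun x : R => Num.sqrt (2 * x)) @^-1` A i).
    by rewrite -[X in measurable X]setTI; exact: msq.
  by apply/seteqP; split => x /=; [exact|].
have enq n (x : 'rV[R]_n) : enorm x = Num.sqrt (2 * qnorm x).
  by rewrite /enorm /qnorm mulrC divfK// pnatr_eq0.
have margE n (T : Type) (Z : R -> T -> 'rV[R]_n) :
    [set w | forall i, A i (enorm (Z (t i) w))] = marginals Z A' (0 :: U).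
  apply/seteqP; split => w /=.
    by move=> H u _ i _ /= tu; rewrite -enq -tu.
  by move=> H i; rewrite enq; exact: (H _ (tU i) i).
by rewrite !margE; exact: eq_marginals.
Qed.

End two_processes.
End radial.

Section brownian_step.
Context {R : realType} {n : nat} d (T : measurableType d) (P : probability T R).

Lemma brownian_gauss_step (x0 : 'rV[R]_n) (B : R -> T -> 'rV[R]_n) :
  brownian P x0 B -> gauss_step n P B.
Proof.
move=> BB s t l E /andP[s0 st] l0 pE.
have mg c : measurable_fun setT (fun x : 'rV[R]_n => (gweight c x)%:E : \bar R).
  by apply/measurable_EFinP; exact: measurable_gweight.
rewrite (brownian_markov BB s0 st pE (mg l)); last first.
  by move=> x; rewrite lee_fin ltW// gweight_gt0.
have [mB _ _ _] := BB; have mE := past_measurable mB pE.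
rewrite -ge0_integralZl//; last 2 first.
- by apply: measurable_funTS; exact: (measurableT_comp (mg _) (mB _ s0)).
- by move=> w _; rewrite lee_fin ltW// gweight_gt0.
apply: eq_integral => w _.
by rewrite integral_gauss_gweight ?subr_gt0// -EFinM.
Qed.

Lemma brownian_shift (x : 'rV[R]_n) (X : R -> T -> 'rV[R]_n) :
  brownian P 0 X -> brownian P x (fun s w => x + X s w).
Proof.
move=> [mX cX X0 iX]; split.
- by move=> t t0; exact: (measurableT_comp (measurable_rVD x) (mX _ t0)).
- move=> w u; apply: (@continuousD _ _ _ (fun=> x)); first exact: cst_continuous.
  exact: cX.
- by move=> w; rewrite X0 addr0.
- move=> k t A t0 tlt mA; rewrite -(iX k t A t0 tlt mA); congr (P _).
  by apply/seteqP; split => w /= H i j; have := H i j; rewrite opprD addrACA subrr add0r.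
Qed.

End brownian_step.

(** * The conditioned process *)

Section conditioned.
Context {R : realType} {n : nat}.
Variables (Phi : {fset 'rV[R]_n}) (v : 'rV[R]_n).
Hypotheses (rsPhi : root_system Phi) (regv : regular Phi v).
Local Notation C := (chamber Phi v).
Local Notation h := (root_product Phi v).
Local Notation m := #|` reduced_positive_roots Phi v|.

Lemma measurable_chamber : measurable C.
Proof.
rewrite (_ : C = \bigcap_(a in [set` positive_roots Phi v]) (dotv a @^-1` `]0, +oo[)).
  apply: fin_bigcap_measurable => // a _; rewrite -[X in measurable X]setTI.
  by apply: measurable_dotv.
by apply/seteqP; split => x /= H a aP; have := H a aP; rewrite /= in_itv/= andbT.
Qed.

Lemma measurable_root_product : measurable_fun setT h.
Proof. by have [] := tame_root_product Phi v. Qed.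

Context dX (TX : measurableType dX) (PX : probability TX R)
  (X : R -> TX -> 'rV[R]_n) (b : R -> 'rV[R]_n -> 'rV[R]_n -> R).
Hypotheses (BX : brownian PX 0 X) (Kb : killed_density PX X C b).

Let Bx x s w := (x + X s w : 'rV[R]_n).

Let mstay x r : 0 <= r -> measurable (stay Phi v (Bx x) r).
Proof.
have [mB cB _ _] := brownian_shift x BX.
by move=> r0; apply: measurable_stay => // s /andP[s0 _]; exact: mB.
Qed.

(** Both sides are the integral of F for the law of x + X t restricted to the
    paths that stay in the chamber. *)
Lemma killed_density_integral t x (F : 'rV[R]_n -> \bar R) : 0 < t -> C x ->
  measurable_fun setT F -> (forall y, (0 <= F y)%E) ->
  (\int[lebesgue_rV n]_y ((b t x y)%:E * F y) =
   \int[PX]_(w in stay Phi v (Bx x) t) F (x + X t w)%R)%E.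
Proof.
move=> t0 Cx mF F0; have [b0 mb bE] := Kb t0 Cx.
have [mB _ _ _] := brownian_shift x BX; have mBt := mB _ (ltW t0).
have mK := mstay x (ltW t0).
pose mu := pushforward (mrestr PX mK) (Bx x t).
have e1 : (\int[mu]_y F y = \int[lebesgue_rV n]_y ((b t x y)%:E * F y))%E.
  apply: (@ge0_integral_density _ _ _ _ _ (lebesgue_rV n) mu id) => //.
  move=> A mA; rewrite -integral_mul_indic bE// /mu /= /pushforward /mrestr.
have e2 : (\int[mu]_y F y =
    \int[PX]_w ((\1_(stay Phi v (Bx x) t) w)%:E * F (Bx x t w)))%E.
  apply: (@ge0_integral_density _ _ _ _ _ PX mu (Bx x t)) => //.
  move=> A mA; rewrite /mu /= /pushforward /mrestr.
  have mBA : measurable (Bx x t @^-1` A) by rewrite -[X in measurable X]setTI; exact: mBt.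
  rewrite -[LHS]integral_indic//.
  rewrite integral_mul_indic; apply: eq_integral => w _.
  by rewrite muleC.
rewrite -e1 e2 [RHS]integral_mul_indic; apply: eq_integral => w _.
by rewrite muleC.
Qed.

Context dY (TY : measurableType dY) (PY : probability TY R)
  (Y : R -> TY -> 'rV[R]_n).
Hypothesis MY : markov_process PY C (h_transform h b) Y.

Let mY t : 0 <= t -> measurable_fun setT (Y t).
Proof. by have [mY _ _] := MY; exact: mY. Qed.

Section step.
Variables (s t : R) (s0 : 0 <= s) (st : s < t) (E : set TY).
Hypothesis pE : past Y s E.

Let mE : measurable E.
Proof. exact: (past_measurable mY pE). Qed.

Let t0 : 0 <= t.
Proof. by rewrite (le_trans s0)// ltW. Qed.

Let ts0 : 0 < t - s.
Proof. by rewrite subr_gt0. Qed.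

(* for fixed p.1, a Brownian motion started at the position of Y at time s *)
Let Z u (p : TY * TX) := Y s p.1 + X u p.2.

Let mZ u : 0 <= u -> measurable_fun setT (Z u).
Proof.
move=> u0; have [mX _ _ _] := BX.
apply/measurable_fun_rVP => i; under eq_fun do rewrite mxE.
apply: measurable_funD; apply: (measurableT_comp (measurable_coord i)).
  by apply: (measurableT_comp (mY s0)); exact: measurable_fst.
by apply: (measurableT_comp (mX _ u0)); exact: measurable_snd.
Qed.

Let KZ := stay Phi v Z (t - s).

Let mKZ : measurable KZ.
Proof.
apply: measurable_stay; first exact: ltW.
  by move=> u /andP[u0 _]; exact: mZ.
move=> p; have [_ cB _ _] := brownian_shift (Y s p.1) BX; exact: (cB p.2).
Qed.

(* truncated at 0 because the quotient may be negative outside the chamber,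
   where it is multiplied by the indicator of KZ *)
Let ratio p := Num.max 0 (h (Z (t - s) p) / h (Y s p.1)).

Let mratio : measurable_fun setT ratio.
Proof.
apply: measurable_maxr => //; apply: measurable_funM.
  exact: (measurableT_comp measurable_root_product (mZ (ltW ts0))).
have -> : (fun p : TY * TX => (h (Y s p.1))^-1) =
    (fun p => h (Y s p.1) `^ (- 1)).
  (* h is positive along Y, so its inverse is a real power *)
  apply/funext => p; rewrite powR_inv1//.
  by have [_ CY _] := MY; rewrite ltW// root_product_gt0//; exact: CY.
apply: (measurableT_comp (measurable_powR _)).
apply: (measurableT_comp measurable_root_product).
by apply: (measurableT_comp (mY s0)); exact: measurable_fst.
Qed.

Let g p : R := \1_E p.1 * (\1_KZ p * ratio p).

Let g0 p : 0 <= g p.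
Proof. by rewrite !mulr_ge0// le_max lexx. Qed.

Let mg : measurable_fun setT g.
Proof.
apply: measurable_funM; last by apply: measurable_funM.
have m1E : measurable_fun setT (\1_E : TY -> R) by exact: measurable_indic.
exact: (measurableT_comp m1E measurable_fst).
Qed.

Let sectionE (F : 'rV[R]_n -> \bar R) w : measurable_fun setT F ->
  (forall y, (0 <= F y)%E) ->
  (\int[PX]_w' ((g (w, w'))%:E * F (Z (t - s) (w, w'))) =
   (\1_E w)%:E * \int[PX]_(w' in stay Phi v (Bx (Y s w)) (t - s))
     ((h (Bx (Y s w) (t - s) w') / h (Y s w))%:E * F (Bx (Y s w) (t - s) w')))%E.
Proof.
move=> mF F0; have [_ CY _] := MY.
have hY : 0 < h (Y s w) by apply: root_product_gt0; exact: CY.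
have [mB _ _ _] := brownian_shift (Y s w) BX; have mBt := mB _ (ltW ts0).
have mK := mstay (Y s w) (ltW ts0).
have F0' w' : (0 <= (h (Bx (Y s w) (t - s) w') / h (Y s w))%:E *
    F (Bx (Y s w) (t - s) w') * (\1_(stay Phi v (Bx (Y s w)) (t - s)) w')%:E)%E.
  rewrite indicE; have [Kw|nKw] := pselect (stay Phi v (Bx (Y s w)) (t - s) w').
    rewrite mule_ge0// mule_ge0// lee_fin divr_ge0 ?(ltW hY)// ltW//.
    by apply: root_product_gt0; apply: Kw; rewrite lexx ltW.
  by rewrite memNset// mule0.
rewrite [in RHS]integral_mul_indic -ge0_integralZl//; last first.
  apply: emeasurable_funM; last exact/measurable_EFinP.
  apply: emeasurable_funM; last exact: (measurableT_comp mF mBt).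
  apply/measurable_EFinP; apply: measurable_funM => //.
  exact: (measurableT_comp measurable_root_product mBt).
apply: eq_integral => w' _; rewrite /g /= -/(Bx (Y s w) (t - s) w') EFinM -muleA; congr (_ * _)%E.
have [Kw|nKw] := pselect (KZ (w, w')).
  rewrite !indicE (mem_set Kw) (_ : w' \in _ = true); last exact/mem_set.
  rewrite mul1r mule1; congr (_%:E * _)%E.
  rewrite /ratio /=; apply/max_idPr; rewrite divr_ge0 ?ltW//.
  by apply: root_product_gt0; apply: Kw; rewrite lexx ltW.
rewrite !indicE (memNset nKw) (_ : w' \in _ = false); last exact/memNset.
by rewrite mul0r !mule0 mul0e.
Qed.

(** The transition kernel of Y is realised by an independent Brownian motion that
    starts at Y s: on the product of the two probability spaces the integrands
    are jointly measurable, and Tonelli's theorem applies. *)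
Lemma conditioned_step (F : 'rV[R]_n -> \bar R) : measurable_fun setT F ->
  (forall y, (0 <= F y)%E) ->
  (\int[PY]_(w in E) F (Y t w) =
   \int[PY]_(w in E) \int[PX]_(w' in stay Phi v (Bx (Y s w)) (t - s))
     ((h (Bx (Y s w) (t - s) w') / h (Y s w))%:E * F (Bx (Y s w) (t - s) w')))%E.
Proof.
move=> mF F0; have [_ CY trY] := MY.
pose mu := pushforward (mrestr PY mE) (Y t).
have fub (G : 'rV[R]_n -> \bar R) : measurable_fun setT G -> (forall y, (0 <= G y)%E) ->
    (\int[PY \x PX]_p ((g p)%:E * G (Z (t - s) p)) =
     \int[PY]_(w in E) \int[PX]_(w' in stay Phi v (Bx (Y s w)) (t - s))
     ((h (Bx (Y s w) (t - s) w') / h (Y s w))%:E * G (Bx (Y s w) (t - s) w')))%E.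
  move=> mG G0.
  have mgG : measurable_fun setT (fun p => (g p)%:E * G (Z (t - s) p))%E.
    apply: emeasurable_funM; first by apply/measurable_EFinP; exact: mg.
    exact: (measurableT_comp mG (mZ (ltW ts0))).
  have gG0 p : (0 <= (g p)%:E * G (Z (t - s) p))%E.
    by apply: mule_ge0; [rewrite lee_fin; exact: g0|exact: G0].
  etransitivity; first exact: (fubini_tonelli1 _ mgG gG0).
  rewrite [RHS]integral_mul_indic; apply: eq_integral => w _.
  by rewrite /fubini_F sectionE// muleC.
have e1 : (\int[mu]_y F y = \int[PY \x PX]_p ((g p)%:E * F (Z (t - s) p)))%E.
  apply: (@ge0_integral_density _ _ _ _ _ (PY \x PX)%E mu (Z (t - s)) g F
    (mZ (ltW ts0)) mg g0 _ mF F0).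
    exact: mY.
  move=> ? A mA; rewrite (fub (fun y => (\1_A y)%:E))//; last first.
    by apply/measurable_EFinP; exact: measurable_indic.
  have s0t : 0 <= s < t by rewrite s0.
  rewrite /mu /= /pushforward /mrestr setIC (trY s t E A s0t pE mA).
  apply: eq_integral => w _; have Cw : C (Y s w) by exact: CY.
  have hw := root_product_gt0 Cw.
  rewrite integral_mul_indic /h_transform.
  pose G y := ((h y / h (Y s w)) * \1_(C `&` A) y)%:E.
  transitivity (\int[lebesgue_rV n]_y ((b (t - s) (Y s w) y)%:E * G y))%E.
    by apply: eq_integral => y _; rewrite /G -!EFinM; congr EFin; ring.
  have G0 y : (0 <= G y)%E.
    rewrite lee_fin indicE; have [[Cy Ay]|nCA] := pselect ((C `&` A) y).
      by rewrite mulr_ge0// divr_ge0// ltW// root_product_gt0.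
    by rewrite memNset// mulr0.
  have mG : measurable_fun setT G.
    apply/measurable_EFinP; apply: measurable_funM.
      by apply: measurable_funM => //; exact: measurable_root_product.
    by apply: measurable_indic; apply: measurableI => //; exact: measurable_chamber.
  rewrite killed_density_integral//.
  apply: eq_integral => w'; rewrite inE => Kw'; rewrite /G -EFinM; congr EFin.
  congr (_ * _); rewrite !indicE in_setI mem_set//=.
  by apply: Kw'; rewrite lexx ltW.
have e2 : (\int[mu]_y F y = \int[PY]_w ((\1_E w)%:E * F (Y t w)))%E.
  have mYt := mY t0.
  apply: (@ge0_integral_density _ _ _ _ _ PY mu (Y t)) => //.
  move=> A mA; rewrite /mu /= /pushforward /mrestr.
  have mYA : measurable (Y t @^-1` A) by rewrite -[X in measurable X]setTI; exact: mY.
  rewrite -[LHS]integral_indic//.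
  by rewrite integral_mul_indic; apply: eq_integral => w _; rewrite muleC.
rewrite -fub// -e1 e2 [LHS]integral_mul_indic.
by apply: eq_integral => w _; rewrite muleC.
Qed.

End step.

(** The factors h (Y t) / h (Y s) of the h-transform cancel those of
    killed_heat_root, which leaves the Gaussian formula in dimension
    n + 2 m. *)
Lemma conditioned_gauss_step : gauss_step (n + 2 * m) PY Y.
Proof.
move=> s t l E /andP[s0 st] l0 pE; have [_ CY _] := MY.
have mE : measurable E by exact: (past_measurable mY pE).
have ts0 : 0 < t - s by rewrite subr_gt0.
have mgw c : measurable_fun setT (fun x : 'rV[R]_n => (gweight c x)%:E : \bar R).
  by apply/measurable_EFinP; exact: measurable_gweight.
have gw0 c (x : 'rV[R]_n) : (0 <= (gweight c x)%:E)%E.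
  by rewrite lee_fin ltW// gweight_gt0.
move: l0; rewrite le_eqVlt => /orP[/eqP <-|l0].
  rewrite mul0r addr0 invr1 sqrtr1 expr1n mul1e mulr0.
  by apply: eq_integral => w _; rewrite !gweight0.
have [M fM] := tame_bounded l0 (tame_root_product Phi v).
rewrite (conditioned_step s0 st pE (mgw l) (gw0 l)).
rewrite -ge0_integralZl//; last 1 first.
  by apply: measurable_funTS; exact: (measurableT_comp (mgw _) (mY s0)).
apply: eq_integral => w _; have Cw : C (Y s w) by exact: CY.
have hw := root_product_gt0 Cw.
have := killed_heat_root rsPhi regv l0 fM (brownian_shift (Y s w) BX) Cw ts0.
set K := stay _ _ _ _ => kE.
transitivity (\int[PX]_(w' in K) ((h (Y s w))^-1%:E *
    (h (Bx (Y s w) (t - s) w') * gweight l (Bx (Y s w) (t - s) w'))%:E))%E.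
  by apply: eq_integral => w' _; rewrite -!EFinM; congr EFin; ring.
have [mB _ _ _] := brownian_shift (Y s w) BX; have mBt := mB _ (ltW ts0).
rewrite ge0_integralZl//.
- rewrite kE /heat_root -!EFinM; congr EFin; rewrite mulrCA; congr (_ * _).
  by rewrite mulrA mulVf ?mul1r// gt_eqF.
- exact: (mstay (Y s w) (ltW ts0)).
- apply/measurable_EFinP; apply: measurable_funTS; apply: measurable_funM.
    exact: (measurableT_comp measurable_root_product mBt).
  exact: (measurableT_comp (@measurable_gweight _ n _) mBt).
- move=> w' Kw'; rewrite lee_fin mulr_ge0// ltW ?gweight_gt0//.
  by apply: root_product_gt0; apply: Kw'; rewrite lexx ltW.
- by rewrite lee_fin invr_ge0 ltW.
Qed.

End conditioned.

(** * Initial law and conclusion *)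

Section initial_law.
Context {R : realType} {n : nat}.

Lemma enorm_radial_proj (r : {posnum R}) (x : 'rV[R]_n) :
  0 < enorm x -> enorm (radial_proj r x) = r%:num.
Proof.
move=> x0; rewrite /enorm /radial_proj dotvZl dotvZr mulrA -expr2.
rewrite sqrtrM ?sqr_ge0// sqrtr_sqr ger0_norm ?divr_ge0 ?(ltW x0)//.
by rewrite -/(enorm x) divfK// gt_eqF.
Qed.

(** The surface measure is an image under the radial projection onto the
    sphere. *)
Lemma sphere_measure_off (r : {posnum R}) (A : set 'rV[R]_n) :
  (forall x, A x -> enorm x != r%:num) -> sphere_measure r A = 0%E.
Proof.
move=> Ar; rewrite /sphere_measure (_ : _ `&` _ = set0) ?measure0 ?mule0//.
apply/seteqP; split => // x [/= /Ar + /andP[x0 _]].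
by rewrite enorm_radial_proj ?eqxx.
Qed.

Lemma enorm_qnorm (x : 'rV[R]_n) : enorm x ^+ 2 / 2 = qnorm x.
Proof. by rewrite /enorm /qnorm sqr_sqrtr// dotvv_ge0. Qed.

End initial_law.


Theorem theorem6 (R : realType) (n : nat)
  (Phi : {fset 'rV[R]_n}) (v : 'rV[R]_n) (r0 : {posnum R})
  (dX : measure_display) (TX : measurableType dX) (PX : probability TX R)
  (X : R -> TX -> 'rV[R]_n) (b : R -> 'rV[R]_n -> 'rV[R]_n -> R)
  (dY : measure_display) (TY : measurableType dY) (PY : probability TY R)
  (Y : R -> TY -> 'rV[R]_n) :
  root_system Phi -> regular Phi v ->
  brownian PX 0 X -> killed_density PX X (chamber Phi v) b ->
  markov_process PY (chamber Phi v) (h_transform (root_product Phi v) b) Y ->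
  (exists2 c : R, 0 < c & forall A : set 'rV[R]_n, measurable A ->
     PY (Y 0 @^-1` A) =
     (\int[sphere_measure r0]_(x in chamber Phi v `&` A)
        (c * root_product Phi v x ^+ 2)%:E)%E) ->
  bessel (n + 2 * #|` reduced_positive_roots Phi v|)%N r0%:num
    PY (fun t w => enorm (Y t w)).
Proof.
move=> rsPhi regv BX Kb MY [c c0 initY]; have [mY CY _] := MY.
split=> [t t0|d' T' P' x0 B x0r BB].
  exact: (measurableT_comp measurable_enorm (mY t t0)).
have [mB _ B0 _] := BB.
apply: (eq_enorm_law mY mB (conditioned_gauss_step rsPhi regv BX Kb MY)
  (brownian_gauss_step BB)) => A mA.
have mD : measurable [set x : 'rV[R]_n | enorm x != r0%:num].
  rewrite (_ : [set x | _] = ~` (@enorm R n @^-1` [set r0%:num])).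
    apply: measurableC; rewrite -[X in measurable X]setTI.
    by apply: measurable_enorm => //; exact: measurable_set1.
  by apply/seteqP; split => x /= /eqP.
(* the initial law is carried by the sphere of radius r0 *)
have Y0r : PY (Y 0 @^-1` [set x | enorm x != r0%:num]) = 0%E.
  have mCD := measurableI _ _ (measurable_chamber Phi v) mD.
  rewrite initY//; apply: null_set_integral => //.
    apply: measurable_funTS; apply/measurable_EFinP/measurable_funM => //.
    by apply: measurable_funX; exact: (@measurable_root_product R n Phi v).
  by apply: sphere_measure_off => x [].
have rB w : qnorm (B 0 w) = r0%:num ^+ 2 / 2 by rewrite B0 -enorm_qnorm x0r.
have mYA (D : set R) : measurable D -> measurable ((fun w => qnorm (Y 0 w)) @^-1` D).
  by move=> mD'; rewrite -[X in measurable X]setTI; exact: (measurable_qnorm_path mY).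
have off (D : set R) : measurable D -> ~ D (r0%:num ^+ 2 / 2) ->
    PY ((fun w => qnorm (Y 0 w)) @^-1` D) = 0%E.
  move=> mD' nD; apply/eqP; rewrite -measure_le0 -Y0r; apply: le_measure.
  - by rewrite inE; exact: mYA.
  - by rewrite inE -[X in measurable X]setTI; exact: mY.
  - move=> w /= Dw; apply/eqP => e; apply: nD.
    by rewrite -e enorm_qnorm.
have [rA|nrA] := pselect (A (r0%:num ^+ 2 / 2)); last first.
  rewrite off//; apply/esym; rewrite (_ : _ @^-1` _ = set0) ?measure0//.
  by apply/seteqP; split => // w /=; rewrite rB.
transitivity (1%E : \bar R).
  rewrite -[LHS]adde0 -(off _ (measurableC mA) (fun nA => nA rA)) preimage_setC.
  rewrite -measureU ?setICr//; last 2 first.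
  - exact: mYA.
  - exact/measurableC/mYA.
  by rewrite setUv; exact: probability_setT.
rewrite (_ : _ @^-1` _ = setT); first exact/esym/probability_setT.
by apply/seteqP; split => // w _ /=; rewrite rB.
Qed.
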